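(* Let $K\in\mathbb{N}$, $\{\alpha_k\}_{k=1}^K\subset(0,\infty)$, $\{r_k\}_{k=1}^K\subset\mathbb{R}^3$, $V_{TF}(x)=\sum_{k=1}^K\frac{\alpha_k}{|x-r_k|}$ and $\mathcal{Z}=\sum_{k=1}^K\alpha_k$. Let $0<\nu<1$, let $Z_n>0$ with $Z_n\to0$, and let $$V_n(x)=V_{TF}(x)+\frac{Z_n}{|x|^\nu}.$$ Let $M>0$ and let $u_n$ minimize $I_{V_n}(M)$ for each $n\in\mathbb{N}$. Then: (i) $\{u_n\}_{n\in\mathbb{N}}$ is a minimizing sequence for $I_{V_{TF}}(M)$. (ii) Either $M\in\mathcal{M}_{V_{TF}}$, or splitting occurs with $m^0\ge\mathcal{Z}$; that is, for concentration data $N,\{m^i\},\{x_n^i\},\{u^i\}$ of $\{u_n\}$ viewed as a minimizing sequence for $I_{V_{TF}}(M)$ (as defined in the context), one has $N\ge1$ and $m^0\ge\mathcal{Z}$.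
   Context: Fix constants $c_1,c_2>0$. Functions are real-valued. For a potential $V$ with $V\ge0$, $V\in L^{3/2}(\mathbb{R}^3)+L^\infty(\mathbb{R}^3)$, $\lim_{|x|\to\infty}V(x)=0$ (or $V\equiv0$), and $u\in H^1(\mathbb{R}^3)$, set $$\mathcal{E}_V(u)=\int_{\mathbb{R}^3}\left[|\nabla u|^2+c_1|u|^{10/3}-c_2|u|^{8/3}-V u^2\right]dx+\frac12\int_{\mathbb{R}^3}\int_{\mathbb{R}^3}\frac{u^2(x)u^2(y)}{|x-y|}\,dx\,dy,$$ and for $M>0$, $I_V(M)=\inf\{\mathcal{E}_V(u):u\in H^1(\mathbb{R}^3),\ \|u\|_{L^2}^2=M\}$. $\mathcal{E}_0$, $I_0$ denote these objects for $V\equiv0$. A minimizing sequence for $I_V(M)$ is a sequence $u_n\in H^1(\mathbb{R}^3)$ with $\|u_n\|_{L^2}^2=M$ and $\mathcal{E}_V(u_n)\to I_V(M)$. $\mathcal{M}_V$ is the set of $M>0$ such that $I_V(M)$ has a minimizer $u\in H^1(\mathbb{R}^3)$ with $\int u^2=M$. Concentration data for a minimizing sequence $\{u_n\}$ of $I_V(M)$ with $V\not\equiv0$ (such data always exist): a number $N\in\mathbb{N}\cup\{0\}$, masses $m^0,\dots,m^N>0$, translations $\{x_n^i\}_{n}\subset\mathbb{R}^3$ ($0\le i\le N$) with $x_n^0=0$, and functions $u^0,\dots,u^N\in H^1(\mathbb{R}^3)$ such that, along a subsequence: $u_n-\sum_{i=0}^Nu^i(\cdot-x_n^i)\to0$ in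 $H^1(\mathbb{R}^3)$; $\|u^i\|_{L^2}^2=m^i$; $\mathcal{E}_V(u^0)=I_V(m^0)$ and $\mathcal{E}_0(u^i)=I_0(m^i)$ for $i\ge1$; $\sum_{i=0}^Nm^i=M$; $I_V(m^0)+\sum_{i=1}^NI_0(m^i)=I_V(M)$; $|x_n^i-x_n^j|\to\infty$ for $i\neq j$; and there is a common $\mu\le0$ such that $-\Delta u^0+\frac53c_1u^0|u^0|^{4/3}-\frac43c_2u^0|u^0|^{2/3}-Vu^0+(|u^0|^2\star|\cdot|^{-1})u^0=\mu u^0$ and, for $i\ge1$, $-\Delta u^i+\frac53c_1u^i|u^i|^{4/3}-\frac43c_2u^i|u^i|^{2/3}+(|u^i|^2\star|\cdot|^{-1})u^i=\mu u^i$. Splitting occurs when $N\ge1$. *)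

(* Defs.v *)
From mathcomp Require Import all_boot all_order all_algebra.
From mathcomp Require Import all_classical all_reals all_analysis.

Set Implicit Arguments.
Unset Strict Implicit.
Unset Printing Implicit Defensive.

Import Order.TTheory GRing.Theory Num.Theory.
Import numFieldNormedType.Exports.

Local Open Scope classical_set_scope.
Local Open Scope ring_scope.

(* Topology, sigma-algebra and measure are the product ones.  The canonical
   norm of this type is the sup norm: |x| is [enorm x]. *)
Notation R3 R := (R * R * R)%type.

Definition enorm (R : realType) (x : R3 R) : R :=
  Num.sqrt (x.1.1 ^+ 2 + x.1.2 ^+ 2 + x.2 ^+ 2).

Definition basis3 (R : realType) (i : 'I_3) : R3 R :=
  ((i == 0%N :> nat)%:R, (i == 1%N :> nat)%:R, (i == 2%N :> nat)%:R).

Definition leb3 (R : realType) :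
    {measure set (measurableTypeR R * measurableTypeR R * measurableTypeR R)
       -> \bar R} :=
  ((@lebesgue_measure R \x @lebesgue_measure R) \x @lebesgue_measure R)%E.

Definition L2 (R : realType) (f : R3 R -> R) : Prop :=
  f \in Lfun (leb3 R) 2%:E.

Definition mass (R : realType) (f : R3 R -> R) : \bar R :=
  ('N[leb3 R]_2%:E[EFin \o f] ^+ 2)%E.

Definition partial (R : realType) (i : 'I_3) (f : R3 R -> R) : R3 R -> R :=
  'D_(basis3 R i) f.

Definition partials (R : realType) (s : seq 'I_3) (f : R3 R -> R) :
  R3 R -> R := foldr (@partial R) f s.

Definition smooth (R : realType) (f : R3 R -> R) : Prop :=
  forall s : seq 'I_3,
    continuous (partials s f) /\
    forall (i : 'I_3) (x : R3 R), derivable (partials s f) x (basis3 R i).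

Definition test_function (R : realType) (phi : R3 R -> R) : Prop :=
  smooth phi /\ compact (closure [set x | phi x != 0]).

Definition is_weak_gradient (R : realType) (u : R3 R -> R)
    (g : 'I_3 -> R3 R -> R) : Prop :=
  forall (i : 'I_3) (phi : R3 R -> R), test_function phi ->
    (\int[leb3 R]_x (u x * partial i phi x)%:E =
     - \int[leb3 R]_x (g i x * phi x)%:E)%E.

Definition L2_weak_gradients (R : realType) (u : R3 R -> R) :
    set ('I_3 -> R3 R -> R) :=
  [set g | (forall i, L2 (g i)) /\ is_weak_gradient u g].

Definition H1 (R : realType) (u : R3 R -> R) : Prop :=
  L2 u /\ L2_weak_gradients u !=set0.

(* A choice of the weak gradient; it is unique up to null sets when u is in
   H^1, and the value 0 outside H^1 is a dummy. *)
Definition wgrad (R : realType) (u : R3 R -> R) : 'I_3 -> R3 R -> R :=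
  xget (fun _ _ => 0) (L2_weak_gradients u).

Definition H1_norm (R : realType) (u : R3 R -> R) : \bar R :=
  sqrte (\int[leb3 R]_x (u x ^+ 2 + (\sum_i wgrad u i x ^+ 2))%:E)%E.

(* Both integrals are finite when u is in H^1 and V in L^(3/2) + L^oo; the
   second integrand is 0 on the null set x = y, where x / 0 = 0. *)
Definition energy (R : realType) (c1 c2 : R) (V u : R3 R -> R) : \bar R :=
  (\int[leb3 R]_x
      ((\sum_i wgrad u i x ^+ 2) + c1 * `|u x| `^ (10 / 3)
       - c2 * `|u x| `^ (8 / 3) - V x * u x ^+ 2)%:E
   + (2^-1)%:E * \int[leb3 R]_x \int[leb3 R]_y
                   (u x ^+ 2 * u y ^+ 2 / enorm (x - y))%:E)%E.

Definition admissible (R : realType) (M : R) : set (R3 R -> R) :=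
  [set u | H1 u /\ mass u = M%:E].

Definition inf_energy (R : realType) (c1 c2 : R) (V : R3 R -> R) (M : R) :
    \bar R :=
  ereal_inf (energy c1 c2 V @` admissible M).

Definition minimizer (R : realType) (c1 c2 : R) (V : R3 R -> R) (M : R)
    (u : R3 R -> R) : Prop :=
  admissible M u /\ energy c1 c2 V u = inf_energy c1 c2 V M.

Definition minimizing_sequence (R : realType) (c1 c2 : R) (V : R3 R -> R)
    (M : R) (u : nat -> R3 R -> R) : Prop :=
  (forall n, admissible M (u n)) /\
  energy c1 c2 V (u n) @[n --> \oo] --> inf_energy c1 c2 V M.

Definition attained_masses (R : realType) (c1 c2 : R) (V : R3 R -> R) : set R :=
  [set M | 0 < M /\ exists u, minimizer c1 c2 V M u].

Definition coulomb_potential (R : realType) (u : R3 R -> R) (x : R3 R) : R :=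
  (\int[leb3 R]_y (u y ^+ 2 / enorm (x - y)))%R.

(* -Lap u + (5/3) c1 u|u|^(4/3) - (4/3) c2 u|u|^(2/3) - V u
   + (|u|^2 * |.|^-1) u = mu u, tested against smooth functions of compact
   support. *)
Definition euler_lagrange (R : realType) (c1 c2 : R) (V : R3 R -> R) (mu : R)
    (u : R3 R -> R) : Prop :=
  forall phi : R3 R -> R, test_function phi ->
    (\int[leb3 R]_x
       ((\sum_i wgrad u i x * partial i phi x)
        + (5 / 3 * c1 * u x * `|u x| `^ (4 / 3)
           - 4 / 3 * c2 * u x * `|u x| `^ (2 / 3)
           - V x * u x + coulomb_potential u x * u x) * phi x)%:E
     = \int[leb3 R]_x (mu * u x * phi x)%:E)%E.

(* [t i n] is the translation x_n^i, and [s] extracts the subsequence along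
   which the decomposition holds. *)
Definition concentration_data (R : realType) (c1 c2 : R) (V : R3 R -> R)
    (M : R) (u : nat -> R3 R -> R) (N : nat) (m : 'I_N.+1 -> R)
    (t : 'I_N.+1 -> nat -> R3 R) (v : 'I_N.+1 -> R3 R -> R) : Prop :=
  let Vi (i : 'I_N.+1) : R3 R -> R := if i == ord0 then V else fun=> 0 in
  [/\ forall i, 0 < m i,
      forall n, t ord0 n = 0,
      forall i, minimizer c1 c2 (Vi i) (m i) (v i),
      \sum_i m i = M /\
      (\sum_i inf_energy c1 c2 (Vi i) (m i) = inf_energy c1 c2 V M)%E &
      (exists2 mu : R, mu <= 0 &
        forall i, euler_lagrange c1 c2 (Vi i) mu (v i)) /\
      exists s : nat -> nat,
        [/\ {homo s : a b / (a < b)%N},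
            H1_norm (fun x => u (s n) x - \sum_i v i (x - t i (s n)))
              @[n --> \oo] --> 0%E &
            forall i j, i != j ->
              enorm (t i (s n) - t j (s n)) @[n --> \oo] --> +oo]].

(* Equal to 0 instead of +oo in the k-th term at the point r k, a null set. *)
Definition V_TF (R : realType) (K : nat) (alpha : 'I_K -> R)
    (r : 'I_K -> R3 R) (x : R3 R) : R :=
  \sum_k alpha k / enorm (x - r k).

(* Main.v *)
(** Part (i): a potential of the form [sum_k alpha_k / |x - r_k|], plus a bounded
multiple of [|x|^-nu], is controlled pointwise by
[V t^2 <= eps |t|^(10/3) + k(x) + C t^2] with [k] integrable. Hence the energies
bound [int |u_n|^(10/3)] uniformly, so [Z_n int u_n^2 / |x|^nu] tends to [0] and
the energies of [u_n] are squeezed towards [I_(V_TF)(M)]. If that infimum is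
[+oo], every admissible function is a minimizer.

Part (ii): if [I_(V_TF)(M)] is not attained then [N >= 1], since [N = 0] would
make [u^0] a minimizer. Suppose [m^0 < sum_k alpha_k]. The superposition
[w = sqrt (u^2 + v(. - x)^2)] is in H^1, its mass is the sum of the masses,
[|grad w|^2 <= |grad u|^2 + |grad v(. - x)|^2], and
[f s = c1 s^(5/3) - c2 s^(4/3)] satisfies [f (a + b) <= f a + f b + C a b].
So the energy of [w] exceeds the sum of those of [u] and [v] by at most
[C int u^2 v(. - x)^2 + int int u^2 v(. - x)^2 / |y - z| - int V v(. - x)^2].
Averaging this over [x] in a large ball, where averages of [1 / |x - w|] are
largest for [w = 0] and asymptotically independent of [w], shows that it is
negative for some [x] as soon as [m^0] is less than [sum_k alpha_k], and that it
can be made arbitrarily small in any case. Superposing all the [u^i] therefore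
gives mass [M] with energy below [I_(V_TF)(M)], a contradiction. Neither the
Euler-Lagrange equations nor any decay of the [u^i] is needed. *)

(* No Sobolev or Hardy-Littlewood-Sobolev inequality is used: the energy may be +oo, and finiteness
   of its parts is recovered from finiteness of the whole, since c1 |u|^(10/3) controls the negative
   local terms up to integrable ones. Hence the separate treatment of an infinite infimum.

   Superposing densities instead of functions keeps masses exactly additive without cut-offs. The
   price is that sqrt (u^2 + v^2) is not smooth at common zeros. Its chain rule is proved with
   difference quotients: u (x + h e_i) - u x is the integral of the weak derivative along a segment,
   and the hypotenuse, regularised by e > 0, is linearised with a quadratic error.

   Attraction and Coulomb repulsion are both of order 1/|x|, so they are compared through integrals
   over a ball of radius S. The overlap integrates to at most m m' for every S, whereas the integral
   of 1/|x| grows at least like S^2. For this the local error must be a product of the two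
   densities; here c2 > 0 matters, as the superadditivity of r^(4/3) absorbs the excess of r^(5/3)
   at low density. *)
From HB Require Import structures.
Require Import Defs.
From mathcomp Require Import all_boot all_order all_algebra.
From mathcomp Require Import all_classical all_reals all_analysis.
From mathcomp Require Import measurable_realfun ring lra.

Set Implicit Arguments.
Unset Strict Implicit.
Unset Printing Implicit Defensive.

Import Order.TTheory GRing.Theory Num.Theory.
Import numFieldNormedType.Exports.

Local Open Scope classical_set_scope.
Local Open Scope ring_scope.

(** * Product measure on R^3 and translations *)

Section product_sigma_finite.
Context d1 d2 (T1 : measurableType d1) (T2 : measurableType d2) (R : realType).
Variables (m1 : {sigma_finite_measure set T1 -> \bar R})
  (m2 : {sigma_finite_measure set T2 -> \bar R}).

(* The library puts no sigma-finite structure on an iterated product measure,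
   as Tonelli's theorem on R^3 x R^3 requires. *)
Definition prod_sf := (m1 \x m2)%E.

HB.instance Definition _ := Measure.on prod_sf.

Let prod_sf_sigma_finite : sigma_finite setT prod_sf.
Proof.
have /sigma_finiteP[F [TF ndF Foo]] := sigma_finiteT m1.
have /sigma_finiteP[G [TG ndG Goo]] := sigma_finiteT m2.
exists (fun n => F n `*` G n).
  rewrite -setXTT TF TG predeqE => -[x y]; split.
    move=> [/= [n _ Fnx] [k _ Gky]]; exists (maxn n k) => //; split.
    - by move: x Fnx; exact/subsetPset/ndF/leq_maxl.
    - by move: y Gky; exact/subsetPset/ndG/leq_maxr.
  by move=> [n _ []/= ? ?]; split; exists n.
move=> k; have [? ?] := Foo k; have [? ?] := Goo k.
split; first exact: measurableX.
by rewrite /prod_sf product_measure1E// lte_mul_pinfty// ge0_fin_numE.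
Qed.

HB.instance Definition _ :=
  Measure_isSigmaFinite.Build _ _ _ prod_sf prod_sf_sigma_finite.

End product_sigma_finite.

Definition E3 (R : realType) : measurableType _ :=
  (measurableTypeR R * measurableTypeR R * measurableTypeR R)%type.

(* Convertible to [leb3]. *)
Definition mu3 (R : realType) : {sigma_finite_measure set (E3 R) -> \bar R} :=
  prod_sf (prod_sf (@lebesgue_measure R) (@lebesgue_measure R))
    (@lebesgue_measure R).

Section invariance.
Context d (T : measurableType d) (R : realType).
Variables (mu : {measure set T -> \bar R}) (phi : T -> T).
Hypothesis mphi : measurable_fun setT phi.
Hypothesis inv : forall A, measurable A -> mu (phi @^-1` A) = mu A.
Let mphi_pack : {mfun T >-> T} :=
  HB.pack phi (isMeasurableFun.Build _ _ _ _ _ mphi).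

Lemma ge0_integral_invariant (f : T -> \bar R) : measurable_fun setT f ->
  (forall x, 0 <= f x)%E -> (\int[mu]_x f (phi x) = \int[mu]_x f x)%E.
Proof.
move=> mf f0.
have := @ge0_integral_pushforward _ _ _ _ _ phi mphi mu setT f measurableT mf.
rewrite preimage_setT => <-; last by move=> ? _; exact: f0.
rewrite (@eq_measure_integral _ _ _ setT mu (pushforward mu mphi_pack)) // => A mA _.
by rewrite -inv.
Qed.

(** Positive and negative parts are transported separately, so no integrability is required. *)
Lemma integral_invariant (f : T -> \bar R) : measurable_fun setT f ->
  (\int[mu]_x f (phi x) = \int[mu]_x f x)%E.
Proof.
move=> mf; rewrite integralE [RHS]integralE.
congr (_ - _)%E.
  rewrite -(ge0_integral_invariant (measurable_funepos mf) (funepos_ge0 _)).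
  by apply: eq_integral => x _; rewrite !funeposE.
rewrite -(ge0_integral_invariant (measurable_funeneg mf) (funeneg_ge0 _)).
by apply: eq_integral => x _; rewrite !funenegE.
Qed.

End invariance.

Section product_invariance.
Context d1 d2 (T1 : measurableType d1) (T2 : measurableType d2) (R : realType).
Variables (m1 : {sigma_finite_measure set T1 -> \bar R})
  (m2 : {sigma_finite_measure set T2 -> \bar R}).
Variables (phi1 : T1 -> T1) (phi2 : T2 -> T2).
Hypothesis mphi1 : measurable_fun setT phi1.
Hypothesis mphi2 : measurable_fun setT phi2.
Hypothesis inv1 : forall A, measurable A -> m1 (phi1 @^-1` A) = m1 A.
Hypothesis inv2 : forall A, measurable A -> m2 (phi2 @^-1` A) = m2 A.
Let phi (x : T1 * T2) := (phi1 x.1, phi2 x.2).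

Lemma measurable_prod_map : measurable_fun [set: (T1 * T2)%type] phi.
Proof.
apply: measurable_fun_pair.
  exact: (measurableT_comp mphi1 measurable_fst).
exact: (measurableT_comp mphi2 measurable_snd).
Qed.

Let mphi_pack : {mfun (T1 * T2)%type >-> (T1 * T2)%type} :=
  HB.pack phi (isMeasurableFun.Build _ _ _ _ _ measurable_prod_map).

(** Uniqueness of the product measure: preimages of rectangles are rectangles, so the pushforward
    has the right value on them. Applied twice, it lifts translation invariance from the line to
    space. *)
Lemma prod_sf_invariant A : measurable A ->
  prod_sf m1 m2 (phi @^-1` A) = prod_sf m1 m2 A.
Proof.
move=> mA; rewrite /prod_sf; apply/esym.
apply: (@product_measure_unique _ _ _ _ _ _ _
  (pushforward (prod_sf m1 m2) mphi_pack)) => // B C mB mC.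
rewrite [LHS](_ : _ = (m1 \x m2)%E ((phi1 @^-1` B) `*` (phi2 @^-1` C)))//.
have mB' : measurable (phi1 @^-1` B) by rewrite -[X in measurable X]setTI; exact: mphi1.
have mC' : measurable (phi2 @^-1` C) by rewrite -[X in measurable X]setTI; exact: mphi2.
rewrite product_measure1E//; congr (_ * _)%E; [exact: inv1|exact: inv2].
Qed.

End product_invariance.

Section shift.
Variable R : realType.

Lemma measurable_shiftR (a : R) : measurable_fun [set: measurableTypeR R]
  ((fun x => x + a) : measurableTypeR R -> measurableTypeR R).
Proof. exact: measurable_funD. Qed.

Lemma lebesgue_measure_shift (a : R) (A : set (measurableTypeR R)) :
  measurable A ->
  lebesgue_measure ((fun x : measurableTypeR R => x + a : measurableTypeR R) @^-1` A) = lebesgue_measure A.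
Proof.
move=> mA.
pose f : {mfun measurableTypeR R >-> measurableTypeR R} :=
  HB.pack ((fun x => x + a) : measurableTypeR R -> measurableTypeR R)
    (isMeasurableFun.Build _ _ _ _ _ (measurable_shiftR a)).
apply/esym.
apply: (@lebesgue_measure_unique R (pushforward lebesgue_measure f)) => //.
move=> X [[b c] /= _ <-].
rewrite /pushforward [X in _ = _ X](_ : _ = `]b - a, c - a]%classic); last first.
  apply/seteqP; split => x /=; rewrite !in_itv/= ltrBlDr lerBrDr//.
rewrite !lebesgue_measure_itv/= !lte_fin ltrD2r.
by case: ifPn => // _; rewrite -!EFinB; congr EFin; ring.
Qed.

Lemma measurable_shift (a : R3 R) :
  measurable_fun [set: E3 R] ((fun x => x + a) : E3 R -> E3 R).
Proof.
exact: (measurable_prod_map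
  (measurable_prod_map (measurable_shiftR a.1.1) (measurable_shiftR a.1.2))
  (measurable_shiftR a.2)).
Qed.

Lemma mu3_shift (a : R3 R) (A : set (E3 R)) : measurable A ->
  mu3 R ((fun x : E3 R => x + a : E3 R) @^-1` A) = mu3 R A.
Proof.
have h := prod_sf_invariant
  (measurable_prod_map (measurable_shiftR a.1.1) (measurable_shiftR a.1.2))
  (measurable_shiftR a.2) _ (@lebesgue_measure_shift a.2).
apply: h.
exact: (prod_sf_invariant (measurable_shiftR a.1.1) (measurable_shiftR a.1.2)
  (@lebesgue_measure_shift a.1.1) (@lebesgue_measure_shift a.1.2)).
Qed.

Lemma integral_shift (a : R3 R) (f : E3 R -> \bar R) : measurable_fun setT f ->
  (\int[mu3 R]_x f (x + a)%R = \int[mu3 R]_x f x)%E.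
Proof.
exact: (@integral_invariant _ _ _ (mu3 R) _ (measurable_shift a) (@mu3_shift a)).
Qed.

End shift.

(** * Test functions *)

Section flat.
Variable R : realType.

(** The classical function exp(-1/t), flat at 0. The powers of 1/t are carried along so that
    differentiation stays within linear combinations of the family. *)
Definition flat (k : nat) (t : R) : R :=
  if 0 < t then t^-1 ^+ k * expR (- t^-1) else 0.

Lemma flat_ge0 k t : 0 <= flat k t.
Proof.
by rewrite /flat; case: ifPn => // t0; rewrite mulr_ge0 ?expR_ge0// exprn_ge0// invr_ge0 ltW.
Qed.

Lemma flat_gt0 k t : 0 < t -> 0 < flat k t.
Proof. by move=> t0; rewrite /flat t0 mulr_gt0 ?expR_gt0// exprn_gt0// invr_gt0. Qed.

Lemma flat_le0 k t : t <= 0 -> flat k t = 0.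
Proof. by move=> t0; rewrite /flat ltNge t0. Qed.

(** With s = 1/t, the exponential of s exceeds s^(k+1) / (k+1)!, which beats the factor s^k and
    leaves one power of t. *)
Lemma flat_le_norm k t : flat k t <= (k.+1)`!%:R * `|t|.
Proof.
rewrite /flat; case: ifPn => [t0|_]; last by rewrite mulr_ge0.
rewrite gtr0_norm// expRN ler_pdivrMr ?expR_gt0//.
have s0 : 0 < t^-1 by rewrite invr_gt0.
have h := expR_ge1Dxn k (ltW s0).
have f0 : 0 < (k.+1)`!%:R :> R by rewrite ltr0n fact_gt0.
apply: (@le_trans _ _ ((k.+1)`!%:R * t * (t^-1 ^+ k.+1 / (k.+1)`!%:R))).
  rewrite exprS le_eqVlt; apply/orP; left; apply/eqP.
  by rewrite exprVn; field; rewrite !gt_eqF ?exprn_gt0.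
apply: ler_wpM2l; first by rewrite mulr_ge0// ltW.
by apply: le_trans h; rewrite lerDr.
Qed.

Lemma flat_cvg0 k : flat k h @[h --> 0^'] --> (0 : R).
Proof.
apply: cvg_within_filter.
have h : (k.+1)`!%:R * `|h| @[h --> (0 : R)] --> (k.+1)`!%:R * `|0 : R|.
  by apply: cvgM; [exact: cvg_cst|apply: cvg_norm; exact: cvg_id].
rewrite normr0 mulr0 in h.
apply: (squeeze_cvgr _ (cvg_cst 0) h).
by near=> t; rewrite flat_ge0 flat_le_norm.
Unshelve. all: by end_near. Qed.

Lemma is_derive_flat k (t : R) :
  is_derive t 1 (flat k) (flat k.+2 t - k%:R * flat k.+1 t).
Proof.
have [t0|t0|->] := ltgtP t 0.
- rewrite !flat_le0 ?ltW// mulr0 subrr.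
  apply: (near_eq_is_derive _ (is_derive_cst (0 : R) t 1)).
  near=> x; rewrite flat_le0//; near: x; exact: lt_le_nbhsl.
- have d0 : is_derive t 1 (fun t => t^-1 ^+ k * expR (- t^-1))
      (flat k.+2 t - k%:R * flat k.+1 t).
    have d1 := @is_deriveV _ id t 1 1 (lt0r_neq0 t0) (is_derive_id _ _).
    have d2 := is_deriveX k d1.
    have d3 := is_derive1_comp (is_derive_expR _) (is_deriveN d1).
    rewrite (_ : (fun t => _) =
      ([eta GRing.inv] ^+ k * (expR \o - [eta GRing.inv]))); last first.
      by apply/funext => x; rewrite !fctE/=.
    apply: (is_derive_eq (is_deriveM d2 d3)).
    rewrite !fctE /GRing.scale /= /flat t0.
    set e := expR _; rewrite !mulr1 -exprVn; set s := t^-1.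
    by case: k {d2} => [|n] /=; rewrite ?exprS; ring.
  apply: (near_eq_is_derive _ d0).
  near=> x; rewrite /flat ifT//; near: x; exact: lt_nbhsr.
- rewrite !flat_le0// mulr0 subrr.
  (* The difference quotient of [flat k] at the origin is [flat k.+1] itself, which tends to 0. *)
  have h : h^-1 *: (flat k (h *: (1:R) + 0) - flat k 0) @[h --> 0^'] --> (0 : R).
    rewrite (_ : (fun h => _) = flat k.+1); first exact: flat_cvg0.
    apply/funext => h; rewrite addr0 [flat k 0]flat_le0// subr0 /GRing.scale/= mulr1.
    by rewrite /flat; case: ifPn => h0; rewrite ?mulr0// exprS mulrA.
  split; first by apply/cvg_ex; exists 0.
  exact: cvg_lim h.
Unshelve. all: by end_near. Qed.
End flat.

(** * Infinitely differentiable functions of one variable *)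

Section smooth1.
Variable R : realType.

(* Closed under products, affine substitutions and primitives, and stable under
   derivation; the members are therefore infinitely differentiable. *)
Inductive smooth1 : (R -> R) -> Prop :=
| Smooth1_flat k : smooth1 (flat k)
| Smooth1_cst c : smooth1 (fun=> c)
| Smooth1D f g of smooth1 f & smooth1 g : smooth1 (fun t => f t + g t)
| Smooth1M f g of smooth1 f & smooth1 g : smooth1 (fun t => f t * g t)
| Smooth1_affine f a b of smooth1 f : smooth1 (fun t => f (a * t + b))
| Smooth1_primitive f g of smooth1 g & (forall t : R, is_derive t 1 f (g t)) :
    smooth1 f.

Lemma smooth1_derive f : smooth1 f ->
  exists2 g, smooth1 g & forall t : R, is_derive t 1 f (g t).
Proof.
elim=> {f} [k|c|f g sf [f' sf' df] sg [g' sg' dg]|f g sf [f' sf' df] sg [g' sg' dg]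
           |f a b sf [f' sf' df]|f g sg _ dg].
- exists (fun t => flat k.+2 t + (- k%:R) * flat k.+1 t).
    apply: Smooth1D; first exact: Smooth1_flat.
    by apply: Smooth1M; [exact: Smooth1_cst|exact: Smooth1_flat].
  by move=> t; rewrite mulNr; exact: is_derive_flat.
- by exists (fun=> 0); [exact: Smooth1_cst|move=> t; exact: is_derive_cst].
- exists (fun t => f' t + g' t); first exact: Smooth1D.
  by move=> t; exact: is_deriveD.
- exists (fun t => f t * g' t + g t * f' t).
    by apply: Smooth1D; exact: Smooth1M.
  by move=> t; exact: is_deriveM.
- exists (fun t => f' (a * t + b) * a).
    by apply: Smooth1M; [exact: Smooth1_affine|exact: Smooth1_cst].
  move=> t.
  have h1 : is_derive t 1 (fun t : R => a * t + b) a.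
    have h := is_deriveD (is_deriveM (is_derive_cst a t 1) (is_derive_id t 1))
      (is_derive_cst b t 1).
    by apply: (is_derive_eq h); rewrite /GRing.scale/= mulr0 mulr1 !addr0.
  have h2 := @is_derive1_comp R f (fun t => a * t + b) t _ _ (df (a * t + b)) h1.
  exact h2.
- by exists g.
Qed.

Lemma smooth1_continuous f : smooth1 f -> continuous f.
Proof.
move=> /smooth1_derive[g _ dfg] t.
by apply: differentiable_continuous; apply/derivable1_diffP; exact: ex_derive.
Qed.

Lemma smooth1_measurable f : smooth1 f -> measurable_fun [set: measurableTypeR R] f.
Proof. by move=> /smooth1_continuous; exact: continuous_measurable_fun. Qed.

End smooth1.

(** * Compactly supported functions of one variable and approximate indicators *)

Section primitive.
Variable R : realType.
Implicit Types (a f : R -> R).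

Definition test1 f :=
  smooth1 f /\ exists L : R, forall t, L <= `|t| -> f t = 0.

Lemma smooth1_mvt f g (x y : R) : smooth1 f ->
  (forall t : R, is_derive t 1 f (g t)) -> x < y ->
  exists2 c, x < c < y & f y - f x = g c * (y - x).
Proof.
move=> sf df xy.
have [] := @MVT R f g x y xy (fun t _ => df t).
  by apply: continuous_subspaceT; exact: smooth1_continuous.
by move=> c /[!in_itv]/= cxy e; exists c.
Qed.

Lemma test1_integrable a : test1 a ->
  (@lebesgue_measure R).-integrable setT (EFin \o a).
Proof.
move=> [sa [L aL]].
have ia : (@lebesgue_measure R).-integrable `[- L, L]%classic (EFin \o a).
  apply: continuous_compact_integrable; first exact: segment_compact.
  by apply: continuous_subspaceT; exact: smooth1_continuous.
move/integrable_mkcond : ia => /(_ (measurable_itv _)).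
congr integrable; apply/funext => t; rewrite patchE.
case: ifPn => // /negP; rewrite inE/= in_itv/= => tL /=.
by rewrite aL// leNgt ltr_norml; apply/negP => /andP[h1 h2]; apply: tL; rewrite !ltW.
Qed.

Lemma test1_primitive a : test1 a ->
  exists2 A, smooth1 A & forall t : R, is_derive t 1 A (a t).
Proof.
move=> ta; have [sa _] := ta.
pose A x := (\int[@lebesgue_measure R]_(t in `]-oo, x]) a t)%R.
suff dA : forall t : R, is_derive t 1 A (a t).
  by exists A => //; exact: (Smooth1_primitive sa dA).
move=> t.
have := @continuous_FTC1 R a -oo%O t (t + 1).
rewrite ltrDl ltr01 => /(_ isT).
case.
- by apply: (integrableS measurableT) => //; exact: test1_integrable.
- by rewrite ltNyr.
- exact: smooth1_continuous.
by move=> d1 d2; split => //; rewrite -derive1E.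
Qed.

(** The normalised primitive of [flat 0 t * flat 0 (1 - t)], a bump supported in [0, 1].
    Monotonicity and the constant values outside [0, 1] follow from the mean value theorem. *)
Lemma smooth_step : exists S : R -> R, [/\ smooth1 S, forall x, x <= 0 -> S x = 0,
  forall x, 1 <= x -> S x = 1 & forall x, 0 <= S x <= 1].
Proof.
pose eta := fun t : R => flat 0 t * flat 0 (- 1 * t + 1).
have seta : smooth1 eta.
  apply: Smooth1M; first exact: Smooth1_flat.
  exact: (Smooth1_affine (-1) 1 (Smooth1_flat _ 0)).
have eta0 t : t <= 0 -> eta t = 0 by move=> t0; rewrite /eta flat_le0// mul0r.
have eta1 t : 1 <= t -> eta t = 0.
  by move=> t1; rewrite /eta [flat 0 (_ + _)]flat_le0 ?mulr0//; lra.
have eta_ge0 t : 0 <= eta t by rewrite mulr_ge0// flat_ge0.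
have [|A sA dA] := @test1_primitive eta.
  split => //; exists 1 => t; rewrite ler_normr => /orP[/eta1//|t1].
  by apply: eta0; lra.
have mono x y : x <= y -> A x <= A y.
  rewrite le_eqVlt => /predU1P[->//|xy]; rewrite -subr_ge0.
  have [c _ ->] := smooth1_mvt sA dA xy.
  by rewrite mulr_ge0// subr_ge0 ltW.
have A01 : 0 < A 1 - A 0.
  have [c /andP[c0 c1] ->] := smooth1_mvt sA dA ltr01.
  rewrite subr0 mulr1 /eta mulr_gt0// flat_gt0//; lra.
exists (fun t => (A 1 - A 0)^-1 * (A t + - A 0)); split.
- apply: Smooth1M; first exact: Smooth1_cst.
  by apply: Smooth1D => //; exact: Smooth1_cst.
- move=> x; rewrite le_eqVlt => /predU1P[->|x0]; first by rewrite subrr mulr0.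
  have [c /andP[_ c0]] := smooth1_mvt sA dA x0.
  rewrite (eta0 _ (ltW c0)) mul0r => /eqP; rewrite subr_eq0 => /eqP ->.
  by rewrite subrr mulr0.
- move=> x; rewrite le_eqVlt => /predU1P[<-|x1]; first by rewrite mulVf// gt_eqF.
  have [c /andP[c1 _]] := smooth1_mvt sA dA x1.
  rewrite (eta1 _ (ltW c1)) mul0r => /eqP; rewrite subr_eq0 => /eqP ->.
  by rewrite mulVf// gt_eqF.
- move=> x; rewrite ler_pdivlMl ?ler_pdivrMl// mulr0 mulr1.
  have [x0|x0] := leP x 0; last first.
    rewrite subr_ge0 (mono _ _ (ltW x0))/=.
    have [x1|x1] := leP x 1; first by rewrite lerB// mono.
    have [c /andP[c1 _]] := smooth1_mvt sA dA x1.
    by rewrite (eta1 _ (ltW c1)) mul0r => /eqP; rewrite subr_eq0 => /eqP ->.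
  suff -> : A x = A 0 by rewrite subrr lexx ltW.
  move: x0; rewrite le_eqVlt => /predU1P[->//|x0].
  have [c /andP[_ c0]] := smooth1_mvt sA dA x0.
  by rewrite (eta0 _ (ltW c0)) mul0r => /eqP; rewrite subr_eq0 => /eqP ->.
Qed.

(** The bumps are S ((n+1) (t - a)) - S ((n+1) (t - b)) for a smooth step S. As S vanishes at 0, the
    limit is the indicator of the half-open interval at every point, endpoints included. A slope of
    at least 1 confines all of them to one bounded interval, as dominated convergence will
    require. *)
Lemma test1_bump (a b : R) : a < b -> exists B : nat -> R -> R,
  [/\ forall n, test1 (B n), forall n t, `|B n t| <= 1,
      forall n t, ~ (a < t < b + 1) -> B n t = 0 &
      forall t, B n t @[n --> \oo] --> (\1_`]a, b]%classic t : R)].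
Proof.
move=> ab; have [S [sS S0 S1 S01]] := smooth_step.
pose B n t := S (n.+1%:R * t + - (n.+1%:R * a)) +
  (-1) * S (n.+1%:R * t + - (n.+1%:R * b)).
have n1 n : (1 : R) <= n.+1%:R by rewrite ler1n.
have n0 n : (0 : R) <= n.+1%:R by [].
have Ba n t : t <= a -> B n t = 0.
  move=> ta; rewrite /B !S0 ?mulr0 ?addr0// subr_le0 ler_wpM2l//.
  by rewrite (le_trans ta)// ltW.
have Bb n t : b + 1 <= t -> B n t = 0.
  move=> tb; rewrite /B !S1 ?mulr1 ?subrr//.
    rewrite -mulrBr; apply: le_trans (n1 n) _; rewrite ler_peMr//; lra.
  rewrite -mulrBr; apply: le_trans (n1 n) _; rewrite ler_peMr//; lra.
have Bout n t : ~ (a < t < b + 1) -> B n t = 0.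
  move=> h; have [/Ba//|ta] := leP t a; have [/Bb//|tb] := leP (b + 1) t.
  by exfalso; apply: h; rewrite ta.
have natSge (r : R) : \forall n \near \oo, r <= n.+1%:R.
  near=> n; apply: (@le_trans _ _ n%:R); last by rewrite ler_nat.
  near: n; exact: nbhs_infty_ger.
exists B; split => //.
- move=> n; split.
    apply: Smooth1D; first exact: Smooth1_affine.
    by apply: Smooth1M; [exact: Smooth1_cst|exact: Smooth1_affine].
  exists (`|a| + `|b| + 1) => t ht; apply: Bout => /andP[h1 h2].
  move: ht; apply/negP; rewrite -ltNge ltr_norml.
  have := ler_norm a; have := ler_norm (- a); have := ler_norm b.
  rewrite normrN; have := normr_ge0 b; have := normr_ge0 a => *.
  by apply/andP; split; lra.
- move=> n t; rewrite /B ler_norml.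
  have := S01 (n.+1%:R * t + - (n.+1%:R * a)).
  have := S01 (n.+1%:R * t + - (n.+1%:R * b)).
  by move=> /andP[? ?] /andP[? ?]; apply/andP; split; lra.
- move=> t; rewrite indicE.
  have [ta|ta] := leP t a.
    rewrite memNset/= ?in_itv/=; last by rewrite ltNge ta.
    by rewrite (_ : B ^~ t = fun=> 0) ?funeqE => [|n]; [exact: cvg_cst|exact: Ba].
  have [tb|tb] := leP t b.
    rewrite mem_set/= ?in_itv/= ?ta ?tb//.
    apply: cvg_near_cst; near=> n.
    rewrite /B [S (_ + - (_ * b))]S0 ?mulr0 ?addr0; last first.
      by rewrite subr_le0 ler_wpM2l.
    rewrite S1// -mulrBr -ler_pdivrMr ?subr_gt0// mul1r.
    near: n; exact: natSge.
  rewrite memNset/= ?in_itv/=; last by rewrite ta leNgt tb.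
  apply: cvg_near_cst; near=> n.
  have h : (t - b)^-1 <= n.+1%:R by near: n; exact: natSge.
  have h1 : 1 <= n.+1%:R * (t - b) by rewrite -ler_pdivrMr ?subr_gt0// mul1r.
  have Sc c : c <= b -> S (n.+1%:R * t + - (n.+1%:R * c)) = 1.
    by move=> cb; apply: S1; rewrite -mulrBr (le_trans h1)// ler_wpM2l// lerB.
  by rewrite /B !Sc ?(ltW ab)// mulr1 subrr.
Unshelve. all: by end_near. Qed.

End primitive.

(** * Products of one-variable test functions *)

Section tensor.
Variable R : realType.
Implicit Types (a b : 'I_3 -> R -> R) (x : R3 R).

Lemma is_derive_line (f : R3 R -> R) (x v : R3 R) (g : R -> R) (d : R) :
  (forall h, f (h *: v + x) = g h) -> is_derive (0 : R) 1 g d ->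
  is_derive x v f d.
Proof.
move=> fg [dg eg].
have e : (fun h : R => h^-1 *: (f (h *: v + x) - f x)) =
         (fun h : R => h^-1 *: (g (h *: (1 : R) + 0) - g 0)).
  apply/funext => h; rewrite fg -(fg 0) scale0r add0r addr0.
  by rewrite [h *: (1 : R)]mulr1.
split; first by rewrite /derivable /= e.
by rewrite -eg /derive /= e.
Qed.

Lemma is_derive_shift (f : R -> R) (t d : R) :
  is_derive t 1 f d -> is_derive (0 : R) 1 (fun h => f (h + t)) d.
Proof.
move=> [df ef].
have e : (fun h : R => h^-1 *: (f (h *: (1:R) + t) - f t)) =
         (fun h : R => h^-1 *: ((fun h => f (h + t)) (h *: (1 : R) + 0) - f (0 + t))).
  by apply/funext => h; rewrite addr0 add0r.
split; first by rewrite /derivable /= -e.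
by rewrite -ef /derive /= -e.
Qed.

(** These products are the only test functions ever constructed: partial derivatives act on one
    factor, and pointwise limits include the indicators of boxes. *)
Definition tens a x : R :=
  a (@Ordinal 3 0 isT) x.1.1 * a (@Ordinal 3 1 isT) x.1.2 *
  a (@Ordinal 3 2 isT) x.2.

Definition upd a (i : 'I_3) (f : R -> R) : 'I_3 -> R -> R :=
  fun j => if j == i then f else a j.

Lemma ord3P (P : 'I_3 -> Prop) : P (@Ordinal 3 0 isT) -> P (@Ordinal 3 1 isT) ->
  P (@Ordinal 3 2 isT) -> forall i, P i.
Proof.
move=> P0 P1 P2 [[|[|[|//]]] Hi]; [move: P0|move: P1|move: P2];
  by congr (P _); exact: val_inj.
Qed.

Lemma is_derive_tens a (a' : R -> R) i x : (forall t : R, is_derive t 1 (a i) (a' t)) ->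
  is_derive x (basis3 R i) (tens a) (tens (upd a i a') x).
Proof.
move: i; apply: ord3P => da.
- apply: (@is_derive_line _ _ _ (fun h => a (@Ordinal 3 0 isT) (h + x.1.1) *
    (a (@Ordinal 3 1 isT) x.1.2 * a (@Ordinal 3 2 isT) x.2))).
    by move=> h; rewrite /tens/= /GRing.scale/= mulr1 mulr0 !add0r mulrA.
  have := is_deriveM (is_derive_shift (da x.1.1)) (is_derive_cst
    (a (@Ordinal 3 1 isT) x.1.2 * a (@Ordinal 3 2 isT) x.2) (0 : R) 1).
  move=> h; apply: (is_derive_eq h).
  by rewrite /tens /upd/= /GRing.scale/= mulr0 add0r mulrC mulrA.
- apply: (@is_derive_line _ _ _ (fun h => a (@Ordinal 3 1 isT) (h + x.1.2) *
    (a (@Ordinal 3 0 isT) x.1.1 * a (@Ordinal 3 2 isT) x.2))).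
    by move=> h; rewrite /tens/= /GRing.scale/= mulr1 mulr0 !add0r; ring.
  have := is_deriveM (is_derive_shift (da x.1.2)) (is_derive_cst
    (a (@Ordinal 3 0 isT) x.1.1 * a (@Ordinal 3 2 isT) x.2) (0 : R) 1).
  move=> h; apply: (is_derive_eq h).
  by rewrite /tens /upd/= /GRing.scale/= mulr0 add0r; ring.
- apply: (@is_derive_line _ _ _ (fun h => a (@Ordinal 3 2 isT) (h + x.2) *
    (a (@Ordinal 3 0 isT) x.1.1 * a (@Ordinal 3 1 isT) x.1.2))).
    by move=> h; rewrite /tens/= /GRing.scale/= mulr1 mulr0 !add0r; ring.
  have := is_deriveM (is_derive_shift (da x.2)) (is_derive_cst
    (a (@Ordinal 3 0 isT) x.1.1 * a (@Ordinal 3 1 isT) x.1.2) (0 : R) 1).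
  move=> h; apply: (is_derive_eq h).
  by rewrite /tens /upd/= /GRing.scale/= mulr0 add0r; ring.
Qed.

Lemma partial_tens a (a' : R -> R) i : (forall t : R, is_derive t 1 (a i) (a' t)) ->
  partial i (tens a) = tens (upd a i a').
Proof.
move=> da; apply/funext => x; rewrite /partial.
exact: (@derive_val _ _ _ _ _ _ _ (is_derive_tens x da)).
Qed.

Lemma partials_tens a (s : seq 'I_3) : (forall i, smooth1 (a i)) ->
  exists2 b, forall i, smooth1 (b i) & partials s (tens a) = tens b.
Proof.
move=> sa; elim: s => [|i s [b sb eb]]; first by exists a.
have [b' sb' db'] := smooth1_derive (sb i).
exists (upd b i b'); first by move=> j; rewrite /upd; case: ifP.
by rewrite /= -/(partials s _) eb; exact: partial_tens.
Qed.

Lemma continuous_tens a : (forall i, smooth1 (a i)) -> continuous (tens a).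
Proof.
move=> sa x; rewrite /tens.
have c11 : continuous_at x (fun x : R3 R => x.1.1).
  by apply: cvg_comp; [exact: cvg_fst|exact: cvg_fst].
have c12 : continuous_at x (fun x : R3 R => x.1.2).
  by apply: cvg_comp; [exact: cvg_fst|exact: cvg_snd].
have c2 : continuous_at x (fun x : R3 R => x.2) by exact: cvg_snd.
apply: cvgM; [apply: cvgM|].
- by apply: (cvg_comp _ _ c11); exact: smooth1_continuous.
- by apply: (cvg_comp _ _ c12); exact: smooth1_continuous.
- by apply: (cvg_comp _ _ c2); exact: smooth1_continuous.
Qed.

Lemma test_function_tens a : (forall i, test1 (a i)) -> test_function (tens a).
Proof.
move=> ta.
have sa i : smooth1 (a i) by case: (ta i).
split.
  move=> s; have [b sb ->] := partials_tens s sa.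
  split; first exact: continuous_tens.
  move=> i x; have [b' _ db'] := smooth1_derive (sb i).
  exact: (@ex_derive _ _ _ _ _ _ _ (is_derive_tens x db')).
have /choice[L HL] i : exists L : R, forall t, L <= `|t| -> a i t = 0.
  by case: (ta i).
pose I i := `[- L i, L i]%classic.
have cI i : compact (I i) by exact: segment_compact.
apply: (@subclosed_compact _ _
  (I (@Ordinal 3 0 isT) `*` I (@Ordinal 3 1 isT) `*` I (@Ordinal 3 2 isT))).
- exact: closed_closure.
- by apply: compact_setX => //; exact: compact_setX.
have cl : closed (I (@Ordinal 3 0 isT) `*` I (@Ordinal 3 1 isT) `*` I (@Ordinal 3 2 isT)).
  by apply: compact_closed; [|apply: compact_setX => //; exact: compact_setX].
rewrite ((closure_id _).1 cl); apply: closure_subset => x /=; rewrite /tens.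
have aI i t : a i t != 0 -> I i t.
  move=> /eqP h; rewrite /I/= in_itv/= -ler_norml leNgt; apply/negP => /ltW /HL.
  exact: h.
by rewrite !mulf_eq0 !negb_or => /andP[/andP[/aI ? /aI ?] /aI ?].
Qed.

End tensor.

(** * Generators of a product sigma-algebra *)

Section generators.
Context d1 d2 (T1 : measurableType d1) (T2 : measurableType d2).
Variables (G1 : set (set T1)) (G2 : set (set T2)).

(** The countable covers by generators make a strip such as [B]*[setT] a countable union of
    generating rectangles; every measurable rectangle is then an intersection of two strips. *)
Lemma measurable_prod_generators (c1 : (set T1)^nat) (c2 : (set T2)^nat) :
  (forall n, G1 (c1 n)) -> \bigcup_n c1 n = setT ->
  (forall n, G2 (c2 n)) -> \bigcup_n c2 n = setT ->
  @measurable _ T1 = <<s G1 >> -> @measurable _ T2 = <<s G2 >> ->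
  @measurable _ (T1 * T2)%type = <<s [set A `*` B | A in G1 & B in G2] >>.
Proof.
move=> Gc1 Uc1 Gc2 Uc2 e1 e2.
set G := [set A `*` B | A in G1 & B in G2].
have h1 A : measurable A -> <<s G >> (A `*` setT).
  pose S := [set A | <<s G >> (A `*` (setT : set T2))].
  suff : <<s G1 >> `<=` S by move=> h; rewrite e1 => /h.
  apply: smallest_sub; last first.
    move=> B GB; rewrite /S/= -Uc2 setX_bigcupr.
    apply: sigma_algebra_bigcup => n; apply: sub_sigma_algebra.
    by exists B => //; exists (c2 n).
  split.
  - by rewrite /S/= set0X; exact: sigma_algebra0.
  - move=> B; rewrite /S/= => SB.
    rewrite (_ : _ `*` _ = ~` (B `*` setT)).
      rewrite -setTD; exact: sigma_algebraCD.
    by apply/seteqP; split => -[x y] /=; rewrite /setD/=; tauto.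
  - by move=> F SF; rewrite /S/= setX_bigcupl; exact: sigma_algebra_bigcup.
have h2 B : measurable B -> <<s G >> (setT `*` B).
  pose S := [set B | <<s G >> ((setT : set T1) `*` B)].
  suff : <<s G2 >> `<=` S by move=> h; rewrite e2 => /h.
  apply: smallest_sub; last first.
    move=> A GA; rewrite /S/= -Uc1 setX_bigcupl.
    apply: sigma_algebra_bigcup => n; apply: sub_sigma_algebra.
    by exists (c1 n) => //; exists A.
  split.
  - by rewrite /S/= setX0; exact: sigma_algebra0.
  - move=> A; rewrite /S/= => SA.
    rewrite (_ : _ `*` _ = ~` (setT `*` A)).
      rewrite -setTD; exact: sigma_algebraCD.
    by apply/seteqP; split => -[x y] /=; rewrite /setD/=; tauto.
  - by move=> F SF; rewrite /S/= setX_bigcupr; exact: sigma_algebra_bigcup.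
rewrite measurable_prod_measurableType eqEsubset; split.
  apply: smallest_sub; first exact: smallest_sigma_algebra.
  move=> _ [A mA] [B mB] <-.
  rewrite (_ : A `*` B = (A `*` setT) `&` (setT `*` B)); last first.
    by rewrite -setXI setIT setTI.
  exact: (@measurableI _ (g_sigma_algebraType G) _ _ (h1 _ mA) (h2 _ mB)).
apply: smallest_sub; first exact: smallest_sigma_algebra.
move=> _ [A GA] [B GB] <-; apply: sub_sigma_algebra; exists A.
  by rewrite e1; exact: sub_sigma_algebra.
by exists B => //; rewrite e2; exact: sub_sigma_algebra.
Qed.

End generators.

(** * The fundamental lemma of the calculus of variations *)

Section boxes.
Variable R : realType.

(** Half-open like the intervals generating the sigma-algebra of the line, and stable under
    intersection, so that boxes form a pi-system. *)
Definition ocbox (a b : 'I_3 -> R) : set (E3 R) :=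
  [set x : E3 R | [/\ a (@Ordinal 3 0 isT) < x.1.1 <= b (@Ordinal 3 0 isT),
    a (@Ordinal 3 1 isT) < x.1.2 <= b (@Ordinal 3 1 isT) &
    a (@Ordinal 3 2 isT) < x.2 <= b (@Ordinal 3 2 isT)]].

Lemma ocboxE a b : ocbox a b =
  `]a (@Ordinal 3 0 isT), b (@Ordinal 3 0 isT)]%classic `*`
  `]a (@Ordinal 3 1 isT), b (@Ordinal 3 1 isT)]%classic `*`
  `]a (@Ordinal 3 2 isT), b (@Ordinal 3 2 isT)]%classic.
Proof.
apply/seteqP; split => -[[x y] z] /=; rewrite !in_itv/=.
  by case.
by move=> [[]].
Qed.

Lemma measurable_ocbox a b : measurable (ocbox a b).
Proof.
rewrite ocboxE; apply: measurableX; last exact: measurable_itv.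
by apply: measurableX; exact: measurable_itv.
Qed.

Definition cube (n : nat) : set (E3 R) := ocbox (fun=> - n%:R) (fun=> n%:R).

Lemma measurable_cube n : measurable (cube n).
Proof. exact: measurable_ocbox. Qed.

Lemma measurable_E3 : @measurable _ (E3 R) =
  <<s [set A | exists ab : ('I_3 -> R) * ('I_3 -> R), A = ocbox ab.1 ab.2] >>.
Proof.
pose c n : set (measurableTypeR R) := `](- n%:R), n%:R]%classic.
have oc n : ocitv (c n) by exists (- n%:R, n%:R).
have Uc : \bigcup_n c n = setT.
  apply/seteqP; split => // x _.
  exists (Num.bound `|x|) => //; rewrite /c/= in_itv/=.
  have := archi_boundP (normr_ge0 x); rewrite ltr_norml => /andP[-> h /=].
  exact: ltW.
have e1 : @measurable _ (measurableTypeR R) = <<s @ocitv R >> by [].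
have e2 := measurable_prod_generators oc Uc oc Uc e1 e1.
have oc2 n : [set A `*` B | A in @ocitv R & B in @ocitv R] (c n `*` c n).
  by exists (c n) => //; exists (c n).
have Uc2 : \bigcup_n (c n `*` c n) = setT.
  apply/seteqP; split => // -[x y] _.
  have : (\bigcup_n c n) x by rewrite Uc.
  have : (\bigcup_n c n) y by rewrite Uc.
  move=> [i _ yi] [j _ xj]; exists (maxn i j) => //; move: xj yi.
  rewrite /c/= !in_itv/= => /andP[h1 h2] /andP[h3 h4].
  split; apply/andP; split.
  - by apply: le_lt_trans h1; rewrite lerN2 ler_nat leq_maxr.
  - by apply: (le_trans h2); rewrite ler_nat leq_maxr.
  - by apply: le_lt_trans h3; rewrite lerN2 ler_nat leq_maxl.
  - by apply: (le_trans h4); rewrite ler_nat leq_maxl.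
have := measurable_prod_generators oc2 Uc2 oc Uc e2 e1.
rewrite -[X in X = _ -> _]/(@measurable _ (E3 R)) => ->.
congr (<<s _ >>); apply/seteqP; split => A /=.
  move=> [_ [_ [[a0 b0] _ <-] [_ [[a1 b1] _ <-] <-]]] [_ [[a2 b2] _ <-] <-].
  exists (fun i : 'I_3 => nth 0 [:: a0; a1; a2] i, fun i : 'I_3 => nth 0 [:: b0; b1; b2] i).
  by rewrite ocboxE.
move=> [[a b] ->]; rewrite ocboxE/=.
exists (`]a (@Ordinal 3 0 isT), b (@Ordinal 3 0 isT)]%classic `*`
  `]a (@Ordinal 3 1 isT), b (@Ordinal 3 1 isT)]%classic).
  exists `]a (@Ordinal 3 0 isT), b (@Ordinal 3 0 isT)]%classic.
    by exists (a (@Ordinal 3 0 isT), b (@Ordinal 3 0 isT)).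
  exists `]a (@Ordinal 3 1 isT), b (@Ordinal 3 1 isT)]%classic => //.
  by exists (a (@Ordinal 3 1 isT), b (@Ordinal 3 1 isT)).
exists `]a (@Ordinal 3 2 isT), b (@Ordinal 3 2 isT)]%classic => //.
by exists (a (@Ordinal 3 2 isT), b (@Ordinal 3 2 isT)).
Qed.

Lemma ocboxI a b a' b' : ocbox a b `&` ocbox a' b' =
  ocbox (fun i => Num.max (a i) (a' i)) (fun i => Num.min (b i) (b' i)).
Proof.
apply/seteqP; split => x /=; rewrite /ocbox/= !gt_max !le_min.
  by move=> [[/andP[-> ->] /andP[-> ->] /andP[-> ->]]] [/andP[-> ->] /andP[-> ->] /andP[-> ->]].
move=> [/andP[/andP[-> ->] /andP[-> ->]]].
by move=> /andP[/andP[-> ->] /andP[-> ->]] /andP[/andP[-> ->] /andP[-> ->]].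
Qed.

(* Two steps: the integral over boxes determines it on every measurable set
   (Dynkin), hence determines the function. *)
Lemma ae0_ocbox (h : E3 R -> \bar R) (a0 b0 : 'I_3 -> R) :
  (mu3 R).-integrable setT h ->
  (forall x, ~ ocbox a0 b0 x -> h x = 0%E) ->
  (forall a b, \int[mu3 R]_(x in ocbox a b) h x = 0)%E ->
  {ae mu3 R, forall x, h x = 0%E}.
Proof.
move=> ih hout hbox.
have iS A : measurable A -> (mu3 R).-integrable A h.
  by move=> mA; exact: integrableS ih.
have hT : (\int[mu3 R]_x h x = 0)%E.
  rewrite -(hbox a0 b0) [RHS]integral_mkcond; apply: eq_integral => x _.
  rewrite patchE; case: ifPn => // /negP; rewrite inE => /hout; exact.
suff hA A : measurable A -> (\int[mu3 R]_(x in A) h x = 0)%E.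
  have := @integral_ae_eq _ _ _ (mu3 R) setT measurableT (cst 0%E) h ih (measurable_cst _).
  move=> H; have {H} : ae_eq (mu3 R) setT h (cst 0%E).
    by apply: H => E _ mE; rewrite hA// integral0.
  by apply: filterS => x; apply.
rewrite measurable_E3 => sA.
apply: (@dynkin_induction _ (E3 R) _
  [set A | (\int[mu3 R]_(x in A) h x = 0)%E] measurable_E3 _ _ _ _ _ A sA) => //.
- by move=> _ _ [[a b] ->] [[a' b'] ->]; rewrite ocboxI; exists (fun i => Num.max (a i) (a' i), fun i => Num.min (b i) (b' i)).
- by move=> _ [[a b] ->] /=; exact: hbox.
- move=> S mS /= S0; have := hT.
  have mh : measurable_fun (S `|` ~` S) h by rewrite setUv; exact: measurable_int ih.
  rewrite -(setUv S) (integral_setU _ mS (measurableC mS) mh); last exact/disj_setPCl.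
  by rewrite S0 add0e.
- move=> F mF tF F0 /=; rewrite integral_bigcup//; last by apply: iS; exact: bigcupT_measurable.
  by rewrite eseries0// => i _ _; exact: F0.
Qed.

End boxes.

Section fundamental.
Variable R : realType.
Implicit Types (h : E3 R -> R) (a : 'I_3 -> R -> R).

Lemma measurable_tens a : (forall i, smooth1 (a i)) ->
  measurable_fun [set: E3 R] (tens a : E3 R -> R).
Proof.
move=> sa; rewrite /tens; apply: measurable_funM; [apply: measurable_funM|].
- apply: (measurableT_comp (smooth1_measurable (sa _))).
  exact: (measurableT_comp measurable_fst measurable_fst).
- apply: (measurableT_comp (smooth1_measurable (sa _))).
  exact: (measurableT_comp measurable_snd measurable_fst).
- exact: (measurableT_comp (smooth1_measurable (sa _)) measurable_snd).
Qed.

Lemma sub_ocbox (a b a' b' : 'I_3 -> R) : (forall i, a' i <= a i) ->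
  (forall i, b i <= b' i) -> ocbox a b `<=` ocbox a' b'.
Proof.
move=> aa bb x [/andP[h1 h2] /andP[h3 h4] /andP[h5 h6]].
by split; rewrite (le_lt_trans (aa _))//= (le_trans _ (bb _)).
Qed.

Lemma bigcup_cube : \bigcup_n @cube R n = setT.
Proof.
apply/seteqP; split => // x _.
pose m := `|x.1.1| + `|x.1.2| + `|x.2|.
exists (Num.bound m) => //.
have mb : m < (Num.bound m)%:R by apply: archi_boundP; rewrite !addr_ge0.
have H t : `|t| <= m -> - (Num.bound m)%:R < t <= (Num.bound m)%:R.
  by move=> /le_lt_trans /(_ mb); rewrite ltr_norml => /andP[-> /ltW].
by split; apply: H; rewrite /m; [rewrite -addrA lerDl addr_ge0|
  rewrite addrAC lerDr addr_ge0|rewrite lerDr addr_ge0].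
Qed.

Lemma indic_ocbox (a b : 'I_3 -> R) (x : E3 R) :
  \1_(ocbox a b) x = tens (fun i => \1_(`]a i, b i]%classic) : R -> R) x.
Proof.
rewrite /tens ocboxE !indicE -!natrM; congr (_%:R).
case: x => -[x y] z; rewrite !in_setX/=.
by rewrite -!mulnb.
Qed.

(** Products of bumps converge to the indicator of the box, and |h| on the cube dominates. Since the
    bumps spill over up to [b i + 1], it is the enlarged box that must lie in the cube. *)
Lemma integral_ocbox_eq0 h (a b : 'I_3 -> R) (n : nat) :
  measurable_fun setT h ->
  (mu3 R).-integrable (@cube R n) (EFin \o h) ->
  (forall x, (forall i, a i < b i) -> ocbox a (fun i => b i + 1) x -> @cube R n x) ->
  (forall a, (forall i, test1 (a i)) -> \int[mu3 R]_x (h x * tens a x)%:E = 0)%E ->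
  (\int[mu3 R]_(x in ocbox a b) (h x)%:E = 0)%E.
Proof.
move=> mh ih sub hort.
have [ab|/existsNP[i /negP]] := pselect (forall i, a i < b i); last first.
  rewrite -leNgt => ba.
  suff -> : ocbox a b = set0 by rewrite integral_set0.
  apply/seteqP; split => // x; move: i ba; apply: ord3P => ba [].
  - by move=> /andP[h1 h2]; have := lt_le_trans h1 (le_trans h2 ba); rewrite ltxx.
  - by move=> _ /andP[h1 h2]; have := lt_le_trans h1 (le_trans h2 ba); rewrite ltxx.
  - by move=> _ _ /andP[h1 h2]; have := lt_le_trans h1 (le_trans h2 ba); rewrite ltxx.
have /choice[B HB] i := test1_bump (ab i).
pose phi k := tens (fun i => B i k).
have tB i k : test1 (B i k) by have [] := HB i.
have phi1 k x : `|phi k x| <= 1.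
  rewrite /phi /tens !normrM.
  have h1 i t : `|B i k t| <= 1 by have [_ + _ _] := HB i; exact.
  by rewrite !mulr_ile1 ?mulr_ge0.
have phi0 k x : ~ @cube R n x -> phi k x = 0.
  move=> nQ; apply: contrapT => /eqP.
  rewrite /phi /tens !mulf_eq0 !negb_or => /andP[/andP[/eqP n0 /eqP n1] /eqP n2].
  apply: nQ; apply: sub => //.
  have H i t : B i k t <> 0 -> a i < t <= b i + 1.
    move=> Bt; have [/andP[-> /ltW ->]//|nab] := pselect (a i < t < b i + 1).
    by exfalso; apply: Bt; have [_ _ + _] := HB i; exact.
  by split; exact: H.
have cphi x : phi k x @[k --> \oo] --> (\1_(ocbox a b) x : R).
  rewrite indic_ocbox /tens.
  have h1 i t : B i k t @[k --> \oo] --> (\1_`]a i, b i]%classic t : R).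
    by have [_ _ _ +] := HB i; exact.
  by apply: cvgM; [apply: cvgM|]; exact: h1.
have mphi k : measurable_fun setT (phi k : E3 R -> R).
  by apply: measurable_tens => i; case: (tB i k).
have [] := @dominated_convergence _ _ _ (mu3 R) setT measurableT
  (fun k x => (h x * phi k x)%:E) (fun x => (h x * \1_(ocbox a b) x)%:E)
  ((fun x => `|(h x)%:E|%E) \_ (@cube R n)).
- move=> k; apply/measurable_EFinP; exact: measurable_funM.
- apply/measurable_EFinP; apply: measurable_funM => //.
  by apply: measurable_indic; exact: measurable_ocbox.
- apply: aeW => x _.
  by apply: cvg_EFin; [by apply: nearW => k|apply: cvgM; [exact: cvg_cst|exact: (cphi x)]].
- by apply/(integrable_mkcond _ (@measurable_cube R n)); exact: integrable_abse.
- apply: aeW => x k _; rewrite patchE; case: ifPn => [_|/negP].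
    by rewrite /= lee_fin normrM ler_piMr.
  by rewrite inE => /phi0 ->; rewrite mulr0 abse0.
move=> _ _.
rewrite (_ : (fun k => _) = fun=> 0%E); last by apply/funext => k; rewrite /= hort.
move=> /(cvg_lim (@ereal_hausdorff R)); rewrite lim_cst => // e; rewrite [RHS]e.
rewrite [LHS]integral_mkcond; apply: eq_integral => x _.
by rewrite patchE indicE; case: ifPn => _; rewrite ?mulr1 ?mulr0.
Qed.

Lemma test_ortho_ae0 h : measurable_fun setT h ->
  (forall n, (mu3 R).-integrable (@cube R n) (EFin \o h)) ->
  (forall a, (forall i, test1 (a i)) -> \int[mu3 R]_x (h x * tens a x)%:E = 0)%E ->
  {ae mu3 R, forall x, h x = 0}.
Proof.
move=> mh ih hort.
have : forall n, {ae mu3 R, forall x, ((EFin \o h) \_ (@cube R n)) x = 0%E}.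
  move=> n; apply: (@ae0_ocbox _ _ (fun=> - n%:R) (fun=> n%:R)).
  - by apply/(integrable_mkcond _ (@measurable_cube R n)).
  - by move=> x nx; rewrite patchE memNset.
  move=> a b; rewrite integral_mkcond; under eq_integral => x _.
    rewrite (_ : ((EFin \o h) \_ (@cube R n) \_ (ocbox a b)) x =
      ((EFin \o h) \_ (ocbox a b `&` @cube R n)) x); last first.
      by rewrite !patchE in_setI; case: (x \in ocbox a b); case: (x \in cube n).
    over.
  rewrite -integral_mkcond /cube ocboxI.
  (* One size larger than [cube n]: the bumps approximating a box inside it reach up to one unit
     beyond. *)
  apply: (@integral_ocbox_eq0 h _ _ n.+1) => //.
  move=> x _; apply: sub_ocbox => i /=.
    by rewrite le_max lerN2 ler_nat leqnSn orbT.
  by rewrite -[n.+1%:R]natr1 lerD2r ge_min lexx orbT.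
move=> /ae_foralln; apply: filterS => x hx.
have [n Qx] : exists n, @cube R n x.
  have : (\bigcup_n @cube R n) x by rewrite bigcup_cube.
  by move=> [n _ ?]; exists n.
by have := hx n; rewrite patchE mem_set//= => -[].
Qed.

End fundamental.

(** * Square-integrable functions *)

Section measurability.
Variable R : realType.

Lemma measurable_coord11 : measurable_fun [set: E3 R] (fun x : E3 R => x.1.1 : R).
Proof. exact: (measurableT_comp measurable_fst measurable_fst). Qed.

Lemma measurable_coord12 : measurable_fun [set: E3 R] (fun x : E3 R => x.1.2 : R).
Proof. exact: (measurableT_comp measurable_snd measurable_fst). Qed.

Lemma measurable_coord2 : measurable_fun [set: E3 R] (fun x : E3 R => x.2 : R).
Proof. exact: measurable_snd. Qed.

Lemma measurable_floor_comp (N : R) (c : int -> int -> int -> R) : 0 < N ->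
  measurable_fun [set: E3 R] (fun x : E3 R =>
    c (Num.floor (x.1.1 * N)) (Num.floor (x.1.2 * N)) (Num.floor (x.2 * N))).
Proof.
move=> N0 _ Y mY; rewrite setTI.
rewrite (_ : _ @^-1` _ = \bigcup_(k : int * int * int)
    (if `[< Y (c k.1.1 k.1.2 k.2) >]
     then [set x : E3 R | [/\ Num.floor (x.1.1 * N) = k.1.1,
             Num.floor (x.1.2 * N) = k.1.2 & Num.floor (x.2 * N) = k.2]]
     else set0)); last first.
  apply/seteqP; split => x /=.
    move=> Yx; exists (Num.floor (x.1.1 * N), Num.floor (x.1.2 * N), Num.floor (x.2 * N)) => //=.
    by rewrite asboolT.
  by move=> [[[k l] m] _ /=]; case: ifPn => // /asboolP Yc [-> -> ->].
apply: countable_bigcupT_measurable; first exact: countableP.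
move=> [[k l] m] /=; case: ifPn => // _.
have H (p : E3 R -> R) j : measurable_fun setT p ->
    measurable [set x | Num.floor (p x * N) = j].
  move=> mp.
  rewrite (_ : [set x | _] = p @^-1` `[j%:~R / N, (j + 1)%:~R / N[%classic).
    by rewrite -[X in measurable X]setTI; apply: mp => //; exact: measurable_itv.
  apply/seteqP; split => x /=; rewrite in_itv/= ler_pdivrMr// ltr_pdivlMr//.
    by move=> <-; exact: floor_itv.
  by move=> h; apply/floor_def.
rewrite (_ : [set x | _] = [set x : E3 R | Num.floor (x.1.1 * N) = k] `&`
  [set x | Num.floor (x.1.2 * N) = l] `&` [set x | Num.floor (x.2 * N) = m]).
  apply: measurableI; last exact: H measurable_coord2.
  apply: measurableI; [exact: H measurable_coord11|exact: H measurable_coord12].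
by apply/seteqP; split => x /=; [case|move=> [[]]].
Qed.

(** The function is the pointwise limit of its values at the lower corners of the grid cells of mesh
    1/(n+1). Each approximation takes countably many values on measurable cells, so Borel sets of
    the product topology need not be compared with the product sigma-algebra. *)
Lemma continuous_measurable3 (f : R3 R -> R) : continuous f ->
  measurable_fun [set: E3 R] f.
Proof.
move=> cf.
pose fl n (t : R) : R := (Num.floor (t * n.+1%:R))%:~R / n.+1%:R.
have cfl t : fl n t @[n --> \oo] --> t.
  have h0 : (t - n.+1%:R^-1) @[n --> \oo] --> t - 0.
    by apply: cvgB; [exact: cvg_cst|exact: cvg_harmonic].
  rewrite subr0 in h0.
  apply: (squeeze_cvgr _ h0 (cvg_cst t)).
  apply: nearW => n; rewrite /fl.
  have N0 : 0 < n.+1%:R :> R by [].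
  rewrite ler_pdivrMr// ler_pdivlMr// floor_le andbT mulrBl mulVf ?gt_eqF//.
  by rewrite lerBlDr ltW// -[X in _ + X]/(1%:~R) -intrD floorD1_gt.
apply: (@measurable_fun_cvg _ _ _ setT
  (fun n x => f (fl n x.1.1, fl n x.1.2, fl n x.2)) f).
- move=> n.
  exact: (@measurable_floor_comp n.+1%:R (fun k l m =>
    f (k%:~R / n.+1%:R, l%:~R / n.+1%:R, m%:~R / n.+1%:R))).
- move=> x _.
  apply: (cvg_comp (fun n => (fl n x.1.1, fl n x.1.2, fl n x.2)) f _ (cf x)).
  case: x => -[x y] z /=.
  exact: (cvg_pair (cvg_pair (cfl x) (cfl y)) (cfl z)).
Qed.

End measurability.

Section L2_theory.
Variable R : realType.
Implicit Types (f g : E3 R -> R).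

Definition nsq f : \bar R := (\int[mu3 R]_x (f x ^+ 2)%:E)%E.

Lemma nsq_ge0 f : (0 <= nsq f)%E.
Proof. by apply: integral_ge0 => x _; rewrite lee_fin sqr_ge0. Qed.

Lemma massE f : mass f = nsq f.
Proof.
have e (y : \bar R) : (0 <= y)%E -> (y ^+ 2 = y `^ 2)%E.
  case: y => [r|_|//]; last by rewrite poweRyr// expe2 mulyy.
  by rewrite lee_fin => r0; rewrite poweR_EFin powR_mulrn.
rewrite /mass e ?Lnorm_ge0// poweR_Lnorm// /nsq.
by apply: eq_integral => x _; rewrite /= powR_mulrn// real_normK// num_real.
Qed.

Lemma L2P f : L2 f <-> measurable_fun [set: E3 R] f /\ (nsq f < +oo)%E.
Proof.
have E : ('N[leb3 R]_2[EFin \o f] < +oo)%E = (nsq f < +oo)%E.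
  rewrite -massE /mass; have := Lnorm_ge0 (leb3 R) 2 (EFin \o f).
  by case: 'N[leb3 R]_2[EFin \o f]%E => [r _|_|//]; rewrite expe2 -?EFinM ?mulyy ?ltry.
split=> [/andP[]|[mf ff]].
  rewrite !inE /= /finite_norm E => mf ff; split => //.
by apply/andP; rewrite !inE /= /finite_norm E; split.
Qed.

Lemma L2_measurable f : L2 f -> measurable_fun [set: E3 R] f.
Proof. by case/L2P. Qed.

Lemma nsq_measurable f : measurable_fun [set: E3 R] f ->
  measurable_fun [set: E3 R] (fun x => (f x ^+ 2)%:E).
Proof. by move=> mf; apply/measurable_EFinP; exact: measurable_funX. Qed.

Lemma L2_le f (F : E3 R -> R) : measurable_fun [set: E3 R] f ->
  measurable_fun [set: E3 R] F -> (forall x, f x ^+ 2 <= F x) ->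
  (\int[mu3 R]_x (F x)%:E < +oo)%E -> L2 f.
Proof.
move=> mf mF fF Foo; apply/L2P; split => //.
apply: le_lt_trans Foo; apply: ge0_le_integral => //.
- by move=> x _; rewrite lee_fin sqr_ge0.
- exact: nsq_measurable.
- exact/measurable_EFinP.
- by move=> x _; rewrite lee_fin.
Qed.

Lemma nsqD_lty f g : L2 f -> L2 g ->
  (\int[mu3 R]_x (f x ^+ 2 + g x ^+ 2)%:E < +oo)%E.
Proof.
move=> /L2P[mf ff] /L2P[mg gg].
under eq_integral do rewrite EFinD.
rewrite ge0_integralD//; last 4 first.
- by move=> x _; rewrite lee_fin sqr_ge0.
- exact: nsq_measurable.
- by move=> x _; rewrite lee_fin sqr_ge0.
- exact: nsq_measurable.
by rewrite lte_add_pinfty.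
Qed.

Lemma L2Z (c : R) f : L2 f -> L2 (fun x => c * f x).
Proof.
move=> /L2P[mf ff]; apply/L2P; split; first exact: measurable_funM.
rewrite /nsq; under eq_integral do rewrite exprMn EFinM.
rewrite ge0_integralZl ?lee_fin ?sqr_ge0//.
- by rewrite lte_mul_pinfty// lee_fin sqr_ge0.
- exact: nsq_measurable.
- by move=> x _; rewrite lee_fin sqr_ge0.
Qed.

Lemma L2D f g : L2 f -> L2 g -> L2 (fun x => f x + g x).
Proof.
move=> Lf Lg; have mf := L2_measurable Lf; have mg := L2_measurable Lg.
apply: (@L2_le _ (fun x => (Num.sqrt 2 * f x) ^+ 2 + (Num.sqrt 2 * g x) ^+ 2)).
- exact: measurable_funD.
- by apply: measurable_funD; apply: measurable_funX; exact: measurable_funM.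
- move=> x; rewrite !exprMn sqr_sqrtr// -subr_ge0.
  have -> : 2 * f x ^+ 2 + 2 * g x ^+ 2 - (f x + g x) ^+ 2 = (f x - g x) ^+ 2 by ring.
  exact: sqr_ge0.
- by apply: nsqD_lty; exact: L2Z.
Qed.

Lemma L2B f g : L2 f -> L2 g -> L2 (fun x => f x - g x).
Proof.
move=> Lf /(L2Z (-1)) Lg; have := L2D Lf Lg.
by congr L2; apply/funext => x; rewrite mulN1r.
Qed.

Lemma nsq_shift a f : measurable_fun [set: E3 R] f ->
  nsq (fun x => f (x + a)) = nsq f.
Proof. by move=> mf; rewrite /nsq -(integral_shift a (nsq_measurable mf)). Qed.

Lemma L2_shift a f : L2 f -> L2 (fun x => f (x + a)).
Proof.
move=> /L2P[mf ff]; apply/L2P; split; last by rewrite nsq_shift.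
exact: (measurableT_comp mf (measurable_shift a)).
Qed.

Lemma L2_bounded f g (C : R) : L2 f -> measurable_fun [set: E3 R] g ->
  (forall x, `|g x| <= C * `|f x|) -> L2 g.
Proof.
move=> Lf mg gf; have /L2P[mCf Cff] := L2Z C Lf.
apply: (@L2_le _ (fun x => (C * f x) ^+ 2)) => //; first exact: measurable_funX.
move=> x; rewrite exprMn -(real_normK (num_real (g x))) -(real_normK (num_real (f x))).
by rewrite -exprMn lerXn2r// nnegrE (le_trans _ (gf x)).
Qed.

Lemma integrable_L2M f g : L2 f -> L2 g ->
  (mu3 R).-integrable setT (fun x => (f x * g x)%:E).
Proof.
move=> Lf Lg; apply/integrableP; split.
  by apply/measurable_EFinP; apply: measurable_funM; exact: L2_measurable.
apply: le_lt_trans (nsqD_lty Lf Lg); apply: ge0_le_integral => //.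
- apply: measurableT_comp => //; apply/measurable_EFinP.
  by apply: measurable_funM; exact: L2_measurable.
- apply/measurable_EFinP; apply: measurable_funD;
    by apply: measurable_funX; exact: L2_measurable.
- move=> x _; rewrite /= lee_fin normrM.
  rewrite -(real_normK (num_real (f x))) -(real_normK (num_real (g x))).
  by have := sqr_ge0 (`|f x| - `|g x|); have := mulr_ge0 (normr_ge0 (f x)) (normr_ge0 (g x)); nra.
Qed.

Lemma nsq_fin f : L2 f -> (nsq f \is a fin_num)%E.
Proof. by move=> /L2P[_ ff]; rewrite ge0_fin_numE// nsq_ge0. Qed.

(** Meaningful on L2 only: an infinite integral would be sent to 0. *)
Definition nr f : R := fine (nsq f).

Lemma nrE f : L2 f -> nsq f = (nr f)%:E.
Proof. by move=> Lf; rewrite /nr fineK// nsq_fin. Qed.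

Lemma nr_ge0 f : 0 <= nr f. Proof. by rewrite fine_ge0// nsq_ge0. Qed.

(** Weighted form of Cauchy-Schwarz. The weight stays free because it is later taken equal to the
    step of a difference quotient, which balances a fixed factor against one of size h^2. *)
Lemma le_Rintegral_L2M f g (e : R) : L2 f -> L2 g -> 0 < e ->
  `|\int[mu3 R]_x (f x * g x)| <= (e * nr f + e^-1 * nr g) / 2.
Proof.
move=> Lf Lg e0; have ifg := integrable_L2M Lf Lg.
have i2 h : L2 h -> (mu3 R).-integrable setT (fun x => (h x ^+ 2)%:E).
  by move=> Lh; under eq_fun do rewrite expr2; exact: integrable_L2M.
apply: le_trans (le_normr_Rintegral _ _) _ => //.
have Rnr h : nr h = \int[mu3 R]_x (h x ^+ 2) by [].
have iZ c h : L2 h -> (mu3 R).-integrable setT (EFin \o (fun x => c * h x ^+ 2)).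
  by move=> Lh; exact: (integrableZl measurableT c (i2 _ Lh)).
have iD : (mu3 R).-integrable setT (EFin \o (fun x => e * f x ^+ 2 + e^-1 * g x ^+ 2)).
  exact: (integrableD measurableT (iZ _ _ Lf) (iZ _ _ Lg)).
rewrite !Rnr -!RintegralZl//; [|exact: i2|exact: i2].
rewrite -RintegralD//; [|exact: iZ|exact: iZ].
rewrite mulrC -RintegralZl//; apply: le_Rintegral => //.
- exact: (integrable_abse ifg).
- exact: (integrableZl measurableT 2^-1 iD).
move=> x _; rewrite normrM mulrC [leRHS]mulrC ler_pdivlMr ?ltr0n//.
rewrite -(real_normK (num_real (f x))) -(real_normK (num_real (g x))).
rewrite -subr_ge0.
have -> : e * `|f x| ^+ 2 + e^-1 * `|g x| ^+ 2 - `|g x| * `|f x| * 2 =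
  e^-1 * (e * `|f x| - `|g x|) ^+ 2 by field; rewrite gt_eqF.
by rewrite mulr_ge0 ?sqr_ge0// invr_ge0 ltW.
Qed.

Lemma mu3_cube_lty n : (mu3 R (cube n) < +oo)%E.
Proof.
rewrite /cube ocboxE; set I := `](- _), _]%classic.
have mI : measurable (I : set (measurableTypeR R)) by exact: measurable_itv.
have -> : mu3 R (I `*` I `*` I) =
    (lebesgue_measure I * lebesgue_measure I * lebesgue_measure I)%E.
  rewrite -(product_measure1E lebesgue_measure lebesgue_measure mI mI).
  by rewrite -product_measure1E//; exact: measurableX.
by rewrite lebesgue_measure_itv/=; case: ifP => _; rewrite ?mule0 ?mul0e ?ltry.
Qed.

Lemma integrable_cube f n : L2 f -> (mu3 R).-integrable (cube n) (EFin \o f).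
Proof.
move=> Lf; have mf := L2_measurable Lf; have mQ := @measurable_cube R n.
have L1 : L2 (\1_(cube n) : E3 R -> R).
  apply/L2P; split; first exact: measurable_indic.
  apply: le_lt_trans (mu3_cube_lty n); rewrite /nsq.
  rewrite (eq_integral (fun x => (\1_(cube n) x)%:E)).
    by rewrite integral_indic// setIT.
  by move=> x _; rewrite indicE; case: (_ \in _); rewrite ?expr1n// expr0n.
apply/(integrable_mkcond _ mQ); have := integrable_L2M Lf L1.
congr integrable; apply/funext => x; rewrite patchE indicE.
by case: ifPn => _; rewrite ?mulr1 ?mulr0.
Qed.

Lemma L2_compact f (C : R) n : measurable_fun [set: E3 R] f ->
  (forall x, `|f x| <= C) -> (forall x, ~ cube n x -> f x = 0) -> L2 f.
Proof.
move=> mf fC f0; have mQ := @measurable_cube R n.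
apply: (@L2_le _ (fun x => C ^+ 2 * \1_(cube n) x)) => //.
- by apply: measurable_funM => //; exact: measurable_indic.
- move=> x; rewrite indicE; case: (boolP (x \in _)) => [_|/negP].
    rewrite mulr1 -(real_normK (num_real (f x))) lerXn2r// nnegrE.
    exact: le_trans (fC x).
  by rewrite inE => /f0 ->; rewrite expr0n mulr0.
- under eq_integral do rewrite EFinM.
  rewrite ge0_integralZl ?lee_fin ?sqr_ge0//.
  + by rewrite integral_indic// setIT lte_mul_pinfty ?lee_fin ?sqr_ge0// mu3_cube_lty.
  + by apply/measurable_EFinP; exact: measurable_indic.
Qed.

End L2_theory.

(** * Weak derivatives and difference quotients *)

Section line_average.
Variable R : realType.
Implicit Types (f g psi : E3 R -> R) (v : R3 R) (h : R).

Definition D_ h : set (measurableTypeR R) := `[0, h]%classic.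

Lemma measurable_D_ h : measurable (D_ h). Proof. exact: measurable_itv. Qed.

(** Not divided by [h]: it is meant to equal u (x + h v) - u x when [g] is the weak derivative of u
    along [v]. The indicator keeps the domain of integration fixed, as the Fubini arguments
    prefer. *)
Definition lavg v g h (x : E3 R) : R :=
  \int[@lebesgue_measure R]_t (g (x + t *: v) * \1_(D_ h) t).

Lemma measurable_line v : measurable_fun [set: E3 R * measurableTypeR R]
  ((fun z => z.1 + z.2 *: v) : E3 R * measurableTypeR R -> E3 R).
Proof.
have m1 : measurable_fun [set: E3 R * measurableTypeR R] (fun z => z.1.1.1 : measurableTypeR R).
  exact: (measurableT_comp (@measurable_coord11 R) measurable_fst).
have m2 : measurable_fun [set: E3 R * measurableTypeR R] (fun z => z.1.1.2 : measurableTypeR R).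
  exact: (measurableT_comp (@measurable_coord12 R) measurable_fst).
have m3 : measurable_fun [set: E3 R * measurableTypeR R] (fun z => z.1.2 : measurableTypeR R).
  exact: (measurableT_comp (@measurable_coord2 R) measurable_fst).
have mt (c : R) : measurable_fun [set: E3 R * measurableTypeR R] (fun z => z.2 * c : measurableTypeR R).
  exact: (@measurable_funM _ _ _ setT snd (cst c) measurable_snd).
apply: measurable_fun_pair; [apply: measurable_fun_pair|].
- exact: (@measurable_funD _ _ _ _ _ _ m1 (mt v.1.1)).
- exact: (@measurable_funD _ _ _ _ _ _ m2 (mt v.1.2)).
- exact: (@measurable_funD _ _ _ _ _ _ m3 (mt v.2)).
Qed.

Lemma measurable_D2 h : measurable_fun [set: E3 R * measurableTypeR R]
  (fun z => \1_(D_ h) z.2 : R).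
Proof. exact: (measurableT_comp (measurable_indic (measurable_D_ h)) measurable_snd). Qed.

Lemma measurable_line_comp g v h : measurable_fun setT g ->
  measurable_fun [set: E3 R * measurableTypeR R] (fun z => g (z.1 + z.2 *: v) * \1_(D_ h) z.2).
Proof.
move=> mg; apply: measurable_funM; last exact: measurable_D2.
exact: (measurableT_comp mg (measurable_line v)).
Qed.

Lemma measurable_integral_t (J : E3 R * measurableTypeR R -> R) :
  measurable_fun setT J ->
  measurable_fun [set: E3 R] (fun x => \int[@lebesgue_measure R]_t (J (x, t))%:E)%E.
Proof.
move=> mJ; have mJE : measurable_fun setT (EFin \o J) by exact/measurable_EFinP.
have mp := @measurable_fun_fubini_tonelli_F _ _ _ _ _ (@lebesgue_measure R) _
  (measurable_funepos mJE) (funepos_ge0 _).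
have mn := @measurable_fun_fubini_tonelli_F _ _ _ _ _ (@lebesgue_measure R) _
  (measurable_funeneg mJE) (funeneg_ge0 _).
apply: eq_measurable_fun (emeasurable_funB mp mn) => x _.
rewrite integralE /fubini_F; congr (_ - _)%E.
  by apply: eq_integral => t _; rewrite !funeposE.
by apply: eq_integral => t _; rewrite !funenegE.
Qed.

Lemma measurable_lavg v g h : measurable_fun setT g ->
  measurable_fun [set: E3 R] (lavg v g h).
Proof.
move=> mg; rewrite /lavg /Rintegral.
apply: (measurableT_comp (@fine_measurable R setT measurableT)).
exact: (measurable_integral_t (measurable_line_comp v h mg)).
Qed.

Lemma integral_D_ h (c : R) : 0 <= h ->
  (\int[@lebesgue_measure R]_t (c * \1_(D_ h) t)%:E = (c * h)%:E)%E.
Proof.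
move=> h0.
have e : (\int[@lebesgue_measure R]_t (\1_(D_ h) t)%:E = h%:E)%E.
  rewrite integral_indic//; last exact: measurable_D_.
  rewrite setIT (_ : _ (D_ h) = if (0 < h%:E)%E then (h%:E - 0)%E else 0%E); last first.
    exact: (lebesgue_measure_itv `[0, h]).
  rewrite lte_fin.
  by case: ltgtP h0 => // [_ _|<- _]; rewrite ?sube0 ?subr0.
under eq_integral do rewrite EFinM.
rewrite integralZl ?e//.
apply/integrableP; split.
  by apply/measurable_EFinP; apply: measurable_indic; exact: measurable_D_.
under eq_integral => t _ do rewrite gee0_abs ?lee_fin//.
by rewrite e ltry.
Qed.

Lemma integrable_section (f : measurableTypeR R -> R) h : 0 < h ->
  measurable_fun setT f ->
  (\int[@lebesgue_measure R]_t (f t ^+ 2 * \1_(D_ h) t)%:E < +oo)%E ->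
  (@lebesgue_measure R).-integrable setT (fun t => (f t * \1_(D_ h) t)%:E).
Proof.
move=> h0 mf foo.
have mI : measurable_fun setT (\1_(D_ h) : measurableTypeR R -> R).
  by apply: measurable_indic; exact: measurable_D_.
apply/integrableP; split; first by apply/measurable_EFinP; exact: measurable_funM.
apply: (@le_lt_trans _ _ (\int[@lebesgue_measure R]_t
   ((1 * \1_(D_ h) t)%:E + (f t ^+ 2 * \1_(D_ h) t)%:E))%E).
  apply: ge0_le_integral => //.
  - by apply: measurableT_comp => //; apply/measurable_EFinP; exact: measurable_funM.
  - apply/measurable_EFinP; apply: measurable_funD; first exact: measurable_funM.
    by apply: measurable_funM => //; exact: measurable_funX.
  - move=> t _; rewrite -EFinD /= lee_fin -mulrDl normrM [`|\1__ _|]ger0_norm//.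
    apply: ler_wpM2r => //; rewrite -(real_normK (num_real (f t))).
    by have := sqr_ge0 (`|f t| - 1); have := normr_ge0 (f t); nra.
have p1 t : setT t -> (0 <= (1 * \1_(D_ h) t : R)%:E)%E.
  by rewrite lee_fin mulr_ge0.
have p2 t : setT t -> (0 <= (f t ^+ 2 * \1_(D_ h) t)%:E)%E.
  by rewrite lee_fin mulr_ge0 ?sqr_ge0.
have m1 : measurable_fun setT (fun t : measurableTypeR R => (1 * \1_(D_ h) t : R)%:E).
  by apply/measurable_EFinP; exact: measurable_funM.
have m2 : measurable_fun setT (fun t : measurableTypeR R => (f t ^+ 2 * \1_(D_ h) t)%:E).
  by apply/measurable_EFinP; apply: measurable_funM => //; exact: measurable_funX.
rewrite (ge0_integralD _ measurableT p1 m1 p2 m2).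
by rewrite integral_D_ ?ltW// lte_add_pinfty// ltry.
Qed.

Lemma sqr_integral_section (f : measurableTypeR R -> R) h : 0 < h ->
  measurable_fun setT f ->
  (((\int[@lebesgue_measure R]_t (f t * \1_(D_ h) t)) ^+ 2)%:E <=
   h%:E * \int[@lebesgue_measure R]_t (f t ^+ 2 * \1_(D_ h) t)%:E)%E.
Proof.
move=> h0 mf; set S := (\int[_]_t (_ ^+ 2 * _)%:E)%E.
have S0 : (0 <= S)%E.
  by apply: integral_ge0 => t _; rewrite lee_fin mulr_ge0 ?sqr_ge0.
have [Soo|] := ltP S +oo%E; last first.
  by rewrite leye_eq => /eqP ->; rewrite gt0_muley ?lte_fin// leey.
have iJ := integrable_section h0 mf Soo.
have mI : measurable_fun setT (\1_(D_ h) : measurableTypeR R -> R).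
  by apply: measurable_indic; exact: measurable_D_.
have Sfin : S = (fine S)%:E by rewrite fineK// ge0_fin_numE.
have iS : (@lebesgue_measure R).-integrable setT (fun t => (f t ^+ 2 * \1_(D_ h) t)%:E).
  apply/integrableP; split.
    by apply/measurable_EFinP; apply: measurable_funM => //; exact: measurable_funX.
  rewrite (eq_integral (fun t => (f t ^+ 2 * \1_(D_ h) t)%:E)) => [//|t _].
  by rewrite gee0_abs// lee_fin mulr_ge0// sqr_ge0.
have i1 (c : R) : (@lebesgue_measure R).-integrable setT (fun t => (c * \1_(D_ h) t)%:E).
  apply/integrableP; split; first by apply/measurable_EFinP; exact: measurable_funM.
  rewrite (eq_integral (fun t => (`|c| * \1_(D_ h) t)%:E)) => [|t _].
    by rewrite integral_D_ ?ltry// ltW.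
  by rewrite /= normrM [`|\1__ _|]ger0_norm.
pose A : R := `|\int[@lebesgue_measure R]_t (f t * \1_(D_ h) t)|.
have Ac (c : R) : 0 < c -> 2 * A <= c * h + c^-1 * fine S.
  move=> c0.
  have -> : c * h + c^-1 * fine S =
      \int[@lebesgue_measure R]_t (c * \1_(D_ h) t + c^-1 * (f t ^+ 2 * \1_(D_ h) t)).
    rewrite RintegralD//; last 2 first.
    - exact: (i1 c).
    - exact: (integrableZl measurableT c^-1 iS).
    congr (_ + _); first by rewrite /Rintegral integral_D_ ?ltW.
    by rewrite RintegralZl.
  apply: (@le_trans _ _ (2 * \int[@lebesgue_measure R]_t `|f t * \1_(D_ h) t|)).
    by rewrite ler_pM2l// /A le_normr_Rintegral.
  have iA := integrable_abse iJ.
  rewrite -RintegralZl//; apply: le_Rintegral => //.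
  - exact: (integrableZl measurableT 2 iA).
  - exact: (integrableD measurableT (i1 c) (integrableZl measurableT c^-1 iS)).
  move=> t _; rewrite normrM [`|\1__ _|]ger0_norm//.
  rewrite [2 * _]mulrA (mulrA c^-1 (f t ^+ 2)) -mulrDl.
  apply: ler_wpM2r => //; rewrite -(real_normK (num_real (f t))) -subr_ge0.
  have -> : c + c^-1 * `|f t| ^+ 2 - 2 * `|f t| = c^-1 * (`|f t| - c) ^+ 2.
    by field; rewrite gt_eqF.
  by rewrite mulr_ge0 ?sqr_ge0// invr_ge0 ltW.
rewrite Sfin -EFinM lee_fin -(real_normK (num_real (Rintegral _ _ _))) -/A.
have [A0|A0] := eqVneq A 0.
  by rewrite A0 expr0n mulr_ge0 ?fine_ge0 ?(ltW h0).
have Ap : 0 < A by rewrite lt_neqAle eq_sym A0 normr_ge0.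
(* The optimal parameter, which turns the family [Ac] of Young inequalities into A^2 <= h S. *)
have := Ac (A / h) (divr_gt0 Ap h0).
rewrite divfK ?gt_eqF// invf_div => H.
have : A <= h / A * fine S by lra.
by rewrite mulrAC ler_pdivlMr// expr2.
Qed.

End line_average.

Section line_average_L2.
Variable R : realType.
Implicit Types (f g psi : E3 R -> R) (v : R3 R) (h : R).

Lemma measurable_shift_comp g (a : R3 R) : measurable_fun setT g ->
  measurable_fun [set: E3 R] (fun x => g (x + a)).
Proof. by move=> mg; exact: (measurableT_comp mg (measurable_shift a)). Qed.

Lemma measurable_line_section g v (x : E3 R) : measurable_fun setT g ->
  measurable_fun [set: measurableTypeR R] (fun t => g (x + t *: v)).
Proof.
move=> mg; apply: (measurableT_comp mg).
exact: (measurableT_comp (measurable_line v) (pair1_measurable x)).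
Qed.

Lemma integral_sqr_line g v h : L2 g -> 0 < h ->
  (\int[mu3 R]_x \int[@lebesgue_measure R]_t (g (x + t *: v) ^+ 2 * \1_(D_ h) t)%:E =
   h%:E * nsq g)%E.
Proof.
move=> Lg h0; have mg := L2_measurable Lg.
have mJ : measurable_fun [set: E3 R * measurableTypeR R]
    (fun z => (g (z.1 + z.2 *: v) ^+ 2 * \1_(D_ h) z.2)%:E).
  apply/measurable_EFinP.
  exact: (@measurable_line_comp _ (fun x => g x ^+ 2) v h (measurable_funX 2 mg)).
have J0 (z : E3 R * measurableTypeR R) :
    (0 <= (g (z.1 + z.2 *: v) ^+ 2 * \1_(D_ h) z.2)%:E)%E.
  by rewrite lee_fin mulr_ge0 ?sqr_ge0.
rewrite (fubini_tonelli (m1 := mu3 R) (m2 := @lebesgue_measure R) _ mJ J0)/=.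
rewrite (eq_integral (fun t => (nr g * \1_(D_ h) t)%:E)) => [|t _].
  by rewrite integral_D_ ?(ltW h0)// nrE// -EFinM mulrC.
under eq_integral do rewrite mulrC EFinM.
rewrite ge0_integralZl//; last 2 first.
- by apply: nsq_measurable; exact: measurable_shift_comp.
- by move=> x _; rewrite lee_fin sqr_ge0.
by rewrite -/(nsq _) (nsq_shift (t *: v))// nrE// -EFinM mulrC.
Qed.

Lemma nsq_lavg v g h : L2 g -> 0 < h -> (nsq (lavg v g h) <= (h ^+ 2 * nr g)%:E)%E.
Proof.
move=> Lg h0; have mg := L2_measurable Lg.
have mS : measurable_fun [set: E3 R] (fun x => \int[@lebesgue_measure R]_t
    (g (x + t *: v) ^+ 2 * \1_(D_ h) t)%:E)%E.
  apply: (@measurable_integral_t _ (fun z => g (z.1 + z.2 *: v) ^+ 2 * \1_(D_ h) z.2)).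
  exact: (@measurable_line_comp _ (fun x => g x ^+ 2) v h (measurable_funX 2 mg)).
have S0 (x : E3 R) : (0 <= \int[@lebesgue_measure R]_t
    (g (x + t *: v) ^+ 2 * \1_(D_ h) t)%:E)%E.
  by apply: integral_ge0 => t _; rewrite lee_fin mulr_ge0 ?sqr_ge0.
have -> : ((h ^+ 2 * nr g)%:E = \int[mu3 R]_x (h%:E * \int[@lebesgue_measure R]_t
    (g (x + t *: v) ^+ 2 * \1_(D_ h) t)%:E))%E.
  rewrite ge0_integralZl// ?lee_fin ?ltW//.
  by rewrite integral_sqr_line// nrE// -!EFinM expr2 mulrA.
apply: ge0_le_integral => //.
- by move=> x _; rewrite lee_fin sqr_ge0.
- by apply: nsq_measurable; exact: measurable_lavg.
- exact: measurable_funeM.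
- by move=> x _; apply: sqr_integral_section => //; exact: measurable_line_section.
Qed.

Lemma L2_lavg v g h : L2 g -> 0 < h -> L2 (lavg v g h).
Proof.
move=> Lg h0; apply/L2P; split; first by apply: measurable_lavg; exact: L2_measurable.
by apply: le_lt_trans (nsq_lavg v Lg h0) _; rewrite ltry.
Qed.

Lemma ae_section_lty v g h : L2 g -> 0 < h ->
  {ae mu3 R, forall x, (@lebesgue_measure R).-integrable setT
     (fun t => (g (x + t *: v) * \1_(D_ h) t)%:E)}.
Proof.
move=> Lg h0; have mg := L2_measurable Lg.
have iS : (mu3 R).-integrable setT (fun x => \int[@lebesgue_measure R]_t
    (g (x + t *: v) ^+ 2 * \1_(D_ h) t)%:E)%E.
  apply/integrableP; split.
    apply: (@measurable_integral_t _ (fun z => g (z.1 + z.2 *: v) ^+ 2 * \1_(D_ h) z.2)).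
    exact: (@measurable_line_comp _ (fun x => g x ^+ 2) v h (measurable_funX 2 mg)).
  rewrite (eq_integral (fun x : E3 R => \int[@lebesgue_measure R]_t
    (g (x + t *: v) ^+ 2 * \1_(D_ h) t)%:E)%E) => [|x _].
    by rewrite integral_sqr_line// nrE// -EFinM ltry.
  by rewrite gee0_abs//; apply: integral_ge0 => t _; rewrite lee_fin mulr_ge0 ?sqr_ge0.
have := integrable_ae measurableT iS; apply: filterS => x /(_ I) Sfin.
apply: integrable_section => //; first exact: measurable_line_section.
by move: Sfin; rewrite fin_numE => /andP[_]; rewrite ltey.
Qed.

(** Fubini; the absolute double integral is finite because |psi g| <= psi^2 + g^2 and translations
    preserve the norm of [g]. The inner integral is split only at points whose section is
    integrable, hence the almost everywhere argument. *)
Lemma integral_lavg_dual v psi g h : L2 psi -> L2 g -> 0 < h ->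
  (\int[mu3 R]_x (psi x * lavg v g h x)%:E =
   \int[@lebesgue_measure R]_t ((\int[mu3 R]_x (psi x * g (x + t *: v))) * \1_(D_ h) t)%:E)%E.
Proof.
move=> Lpsi Lg h0; have mg := L2_measurable Lg; have mpsi := L2_measurable Lpsi.
pose f (z : E3 R * measurableTypeR R) : \bar R :=
  (psi z.1 * (g (z.1 + z.2 *: v) * \1_(D_ h) z.2))%:E.
have mf : measurable_fun setT f.
  apply/measurable_EFinP; apply: measurable_funM; last exact: measurable_line_comp.
  exact: (measurableT_comp mpsi measurable_fst).
have iprod (t : R) : (mu3 R).-integrable setT (fun x => (psi x * g (x + t *: v))%:E).
  by apply: integrable_L2M => //; exact: L2_shift.
have fi : (mu3 R \x @lebesgue_measure R)%E.-integrable setT f.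
  apply: (@integrable21ltyP _ _ _ _ _ (mu3 R) (@lebesgue_measure R) f mf).2.
  apply: (@le_lt_trans _ _ (\int[@lebesgue_measure R]_t ((nr psi + nr g) * \1_(D_ h) t)%:E)%E).
    apply: ge0_le_integral => //.
    - by move=> t _; exact: integral_ge0.
    - apply: (measurable_fun_fubini_tonelli_G (m1 := mu3 R) (abse \o f)) => //=.
      exact: measurableT_comp.
    - apply/measurable_EFinP; apply: measurable_funM => //.
      by apply: measurable_indic; exact: measurable_D_.
    move=> t _; rewrite /f/=.
    have Lgt := L2_shift (t *: v) Lg.
    apply: (@le_trans _ _ (\int[mu3 R]_x ((\1_(D_ h) t)%:E *
        (psi x ^+ 2 + g (x + t *: v) ^+ 2)%:E))%E).
      apply: ge0_le_integral => //.
      - apply/measurable_EFinP; apply: measurableT_comp => //.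
        apply: measurable_funM => //; apply: measurable_funM => //.
        exact: L2_measurable.
      - apply/measurable_EFinP; apply: measurable_funM => //.
        by apply: measurable_funD; apply: measurable_funX => //; exact: L2_measurable.
      - move=> x _; rewrite -EFinM lee_fin !normrM [`|\1__ _|]ger0_norm//.
        rewrite mulrA mulrC; apply: ler_wpM2l => //.
        rewrite -(real_normK (num_real (psi x))) -(real_normK (num_real (g (x + t *: v)))).
        have := sqr_ge0 (`|psi x| - `|g (x + t *: v)|).
        by have := mulr_ge0 (normr_ge0 (psi x)) (normr_ge0 (g (x + t *: v))); nra.
    rewrite ge0_integralZl//; last 2 first.
    - apply/measurable_EFinP.
      by apply: measurable_funD; apply: measurable_funX => //; exact: L2_measurable.
    - by move=> x _; rewrite lee_fin addr_ge0 ?sqr_ge0.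
    under eq_integral do rewrite EFinD.
    rewrite ge0_integralD//; last 4 first.
    - by move=> x _; rewrite lee_fin sqr_ge0.
    - exact: nsq_measurable.
    - by move=> x _; rewrite lee_fin sqr_ge0.
    - by apply: nsq_measurable; exact: L2_measurable.
    by rewrite -/(nsq psi) -/(nsq (fun x => g (x + t *: v))) nsq_shift// !nrE// -EFinD -EFinM mulrC.
  by rewrite integral_D_ ?(ltW h0)// ltry.
transitivity (\int[mu3 R]_x \int[@lebesgue_measure R]_t f (x, t))%E; last first.
  rewrite (Fubini fi); apply: eq_integral => t _; rewrite /f/=.
  under eq_integral do rewrite mulrA mulrC EFinM.
  rewrite (integralZl measurableT (iprod t)).
  by rewrite mulrC EFinM /Rintegral fineK// integrable_fin_num.
apply: ae_eq_integral => //.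
- apply/measurable_EFinP; apply: measurable_funM => //; exact: measurable_lavg.
- exact: (measurable_fubini_F fi).
have := ae_section_lty v Lg h0.
apply: (@filterS _ _ (ae_filter_ringOfSetsType (mu3 R))) => x ix _.
rewrite /f/=; under [RHS]eq_integral do rewrite EFinM.
by rewrite integralZl// EFinM /lavg /Rintegral fineK// integrable_fin_num.
Qed.

(** Integration along - v is the adjoint of integration along v. This moves the segment integral
    from the weak derivative to the test function. *)
Lemma integral_lavg_swap v psi g h : L2 psi -> L2 g -> 0 < h ->
  (\int[mu3 R]_x (psi x * lavg v g h x)%:E =
   \int[mu3 R]_x (g x * lavg (- v) psi h x)%:E)%E.
Proof.
move=> Lpsi Lg h0; rewrite !integral_lavg_dual//.
apply: eq_integral => t _; congr (_ * _)%:E.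
rewrite /Rintegral; congr fine.
rewrite -[LHS](integral_shift (- (t *: v))).
  apply: eq_integral => x _; congr EFin.
  by rewrite subrK mulrC scalerN.
apply/measurable_EFinP; apply: measurable_funM; first exact: L2_measurable.
by apply: measurable_shift_comp; exact: L2_measurable.
Qed.

End line_average_L2.

(** * Bounds and difference quotients of test functions *)

Section test_functions.
Variable R : realType.
Implicit Types (phi : R3 R -> R) (i : 'I_3).

Lemma is_derive_test phi i (y : R3 R) (t : R) : test_function phi ->
  is_derive t 1 (fun t => phi (t *: basis3 R i + y))
    (partial i phi (t *: basis3 R i + y)).
Proof.
move=> [sphi _]; have [_ /(_ i (t *: basis3 R i + y)) dphi] := sphi [::].
have e : (fun h : R => h^-1 *: (phi (h *: basis3 R i + (t *: basis3 R i + y)) -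
           phi (t *: basis3 R i + y))) =
         (fun h : R => h^-1 *: ((fun t => phi (t *: basis3 R i + y)) (h *: (1 : R) + t) -
           phi (t *: basis3 R i + y))).
  apply/funext => h; congr (_ *: (phi _ - _)).
  by rewrite [h *: (1 : R)]mulr1 scalerDl addrA.
split; first by move: dphi; rewrite /derivable /= e.
by rewrite /partial /derive /= e.
Qed.

Lemma test_mvt phi i (y : R3 R) (h : R) : test_function phi -> 0 < h ->
  exists2 c, 0 < c < h & phi (h *: basis3 R i + y) - phi y =
    partial i phi (c *: basis3 R i + y) * h.
Proof.
move=> tphi h0.
have d (t : R) := is_derive_test i y t tphi.
have [|c] := MVT h0 (fun t _ => d t).
  by apply: derivable_within_continuous => t _; exact: ex_derive.
rewrite in_itv/= scale0r add0r subr0 => ch e.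
by exists c.
Qed.

Lemma test_facts phi : test_function phi ->
  [/\ measurable_fun [set: E3 R] phi,
      forall i, measurable_fun [set: E3 R] (partial i phi) &
      exists C n, [/\ 0 <= C, forall x, `|phi x| <= C,
        forall i x, `|partial i phi x| <= C &
        forall x, ~ cube n x -> phi x = 0 /\ forall i, partial i phi x = 0]].
Proof.
move=> [sphi cphi].
have c0 : continuous phi by have [] := sphi [::].
have c1 i : continuous (partial i phi) by have [] := sphi [:: i].
split; [exact: continuous_measurable3|by move=> i; exact: continuous_measurable3|].
set K := closure [set x | phi x != 0] in cphi.
have K0 x : ~ K x -> phi x = 0.
  move=> nKx; apply: contrapT => /eqP phi0; apply: nKx; exact: subset_closure.
have K1 i x : ~ K x -> partial i phi x = 0.
  move=> nKx; rewrite /partial.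
  have -> : 'D_(basis3 R i) phi x = 'D_(basis3 R i) (cst (0 : R)) x.
    apply: near_eq_derive.
    have oK : open (~` K) by apply: closed_openC; exact: closed_closure.
    by near=> z; rewrite K0//; near: z; exact: open_nbhs_nbhs.
  exact: derive_cst.
have bnd (f : R3 R -> R) : continuous f -> (forall x, ~ K x -> f x = 0) ->
    exists2 C, 0 <= C & forall x, `|f x| <= C.
  move=> cf f0.
  have /compact_bounded : compact (f @` K).
    by apply: continuous_compact => //; exact: continuous_subspaceT.
  move=> [M [_ /(_ (`|M| + 1))]].
  rewrite (le_lt_trans (ler_norm M)) ?ltrDl// => /(_ isT) HM.
  exists (`|M| + 1) => [|x]; first by rewrite addr_ge0.
  have [Kx|/f0 ->] := pselect (K x); last by rewrite normr0 addr_ge0.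
  by apply: HM; exists x.
have [C C0 HC] := bnd _ c0 K0.
have /choice[D HD] i : exists D, 0 <= D /\ forall x, `|partial i phi x| <= D.
  by have [D D0 HD] := bnd _ (c1 i) (K1 i); exists D.
have /compact_bounded [M [_ /(_ (`|M| + 1))]] := cphi.
rewrite (le_lt_trans (ler_norm M)) ?ltrDl// => /(_ isT) HM.
pose n := Num.bound (`|M| + 1).
have Kn x : K x -> cube n x.
  move=> /HM /= xM.
  have mb : `|M| + 1 < n%:R by apply: archi_boundP; rewrite addr_ge0.
  have H (t : R) : `|t| <= `|x| -> - n%:R < t <= n%:R.
    move=> /le_trans /(_ xM) /le_lt_trans /(_ mb).
    by rewrite ltr_norml => /andP[-> /ltW].
  split; apply: H.
  - by rewrite [leRHS]prod_normE le_max [X in _ <= X]prod_normE le_max lexx.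
  - by rewrite [leRHS]prod_normE le_max [X in _ <= X]prod_normE le_max lexx orbT.
  - by rewrite [leRHS]prod_normE le_max lexx orbT.
exists (C + \sum_i D i), n; split.
- by rewrite addr_ge0// sumr_ge0// => i _; case: (HD i).
- move=> x; rewrite (le_trans (HC x))// lerDl sumr_ge0// => i _; by case: (HD i).
- move=> i x; rewrite (le_trans ((HD i).2 x))// (bigD1 i)//= addrCA lerDl addr_ge0//.
  by rewrite sumr_ge0// => j _; case: (HD j).
- move=> x nQ; have nK : ~ K x by move=> /Kn.
  by split=> [|i]; [exact: K0|exact: K1].
Unshelve. all: by end_near. Qed.

Lemma L2_test phi : test_function phi -> L2 phi /\ forall i, L2 (partial i phi).
Proof.
move=> /test_facts[m0 m1 [C [n [C0 b0 b1 out]]]]; split=> [|i].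
  by apply: (L2_compact m0 b0) => x /out[].
by apply: (L2_compact (m1 i) (b1 i)) => x /out[_]; exact.
Qed.

(** Backward quotients, since a forward difference of the other factor becomes a backward one on
    [phi] after a change of variables. *)
Lemma cvg_test_quotient phi i (x : R3 R) : test_function phi ->
  (phi x - phi (x - n.+1%:R^-1 *: basis3 R i)) * n.+1%:R @[n --> \oo] -->
  partial i phi x.
Proof.
move=> tphi; have [sphi _] := tphi.
have [_ /(_ i x) dphi] := sphi [::].
have hn : - n.+1%:R^-1 @[n --> \oo] --> (0 : R)^'.
  have h0 : - n.+1%:R^-1 @[n --> \oo] --> (0 : R).
    by rewrite -[0 in X in _ --> X]oppr0; apply: cvgN; exact: cvg_harmonic.
  move=> A HA.
  have h1 : \forall n \near \oo, - n.+1%:R^-1 != 0 :> R -> A (- n.+1%:R^-1).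
    exact: (h0 _ HA).
  apply: filterS h1 => n; apply.
  by rewrite oppr_eq0 invr_eq0 pnatr_eq0.
have := cvg_comp _ _ hn dphi.
rewrite -/(partial i phi x).
apply: cvg_trans; apply: near_eq_cvg; apply: nearW => n /=.
rewrite scaleNr [- _ + x]addrC invrN invrK /GRing.scale/= mulNr mulrC -mulNr.
by rewrite opprB.
Qed.

Lemma test_shift_le phi i : test_function phi -> exists2 C : R, 0 <= C &
  forall h x, 0 < h -> `|phi x - phi (x - h *: basis3 R i)| <= C * h.
Proof.
move=> tphi; have [_ _ [C [n [C0 _ b1 _]]]] := test_facts tphi.
exists C => // h x h0.
have [c _] := test_mvt i (x - h *: basis3 R i) tphi h0.
rewrite [_ *: _ + (x - _)]addrC subrK => ->.
by rewrite normrM (gtr0_norm h0) ler_pM2r.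
Qed.

End test_functions.

Section window.
Variable R : realType.

(** [Psi] is A s - A (s - h) for a primitive A of [a]. A alone need not have compact support; the
    difference does, being constant-minus-constant far out, so it may serve as a factor of a test
    function whose derivative is a difference of translates. *)
Lemma test1_window (a : R -> R) (h : R) : test1 a -> 0 < h ->
  exists Psi : R -> R, [/\ test1 Psi,
    forall t : R, is_derive t 1 Psi (a t - a (t - h)) &
    forall s, \int[@lebesgue_measure R]_t (a (s - t) * \1_(D_ h) t) = Psi s].
Proof.
move=> ta h0; have [A sA dA] := test1_primitive ta; have [sa [L HL]] := ta.
have dAs (c t : R) : is_derive t 1 (fun t => A (1 * t + - c)) (a (t - c)).
  have d1 : is_derive t 1 (fun t : R => 1 * t + - c) 1.
    have h1 := is_deriveD (is_deriveM (is_derive_cst (1 : R) t 1) (is_derive_id t 1))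
      (is_derive_cst (- c) t 1).
    by apply: (is_derive_eq h1); rewrite /GRing.scale/= mulr0 mulr1 !addr0.
  have d2 := @is_derive1_comp R A (fun t => 1 * t + - c) t _ _ (dA _) d1.
  by apply: (is_derive_eq d2); rewrite mulr1 mul1r.
pose Psi (s : R) : R := A s + -1 * A (1 * s + - h).
exists Psi; split.
- split.
    apply: Smooth1D => //; apply: Smooth1M; first exact: Smooth1_cst.
    exact: Smooth1_affine.
  exists (`|L| + h) => t ht.
  have th : t - h < t by rewrite ltrBlDr ltrDl.
  have [c /andP[c1 c2]] := smooth1_mvt sA dA th.
  rewrite HL ?mul0r => [e|].
    by rewrite /Psi mul1r mulN1r.
  apply: (le_trans (ler_norm L)); rewrite ler_normr.
  by move: ht; rewrite ler_normr => /orP[ht|ht]; apply/orP; [left|right]; lra.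
- move=> t.
  have d1 := is_deriveD (dA t) (is_deriveM (is_derive_cst (-1 : R) t 1) (dAs h t)).
  by apply: (is_derive_eq d1); rewrite /GRing.scale/= mulr0 addr0 mulN1r.
move=> s.
pose F (t : R) : R := -1 * A (-1 * t + s).
have dF (t : R) : is_derive t 1 F (a (s - t)).
  have d1 : is_derive t 1 (fun t : R => -1 * t + s) (-1).
    have h1 := is_deriveD (is_deriveM (is_derive_cst (-1 : R) t 1) (is_derive_id t 1))
      (is_derive_cst s t 1).
    by apply: (is_derive_eq h1); rewrite /GRing.scale/= mulr0 mulr1 !addr0.
  have d2 := @is_derive1_comp R A (fun t => -1 * t + s) t _ _ (dA _) d1.
  have d3 := is_deriveM (is_derive_cst (-1 : R) t 1) d2.
  apply: (is_derive_eq d3); have -> : s - t = -1 * t + s by ring.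
  by rewrite /GRing.scale/=; ring.
have sF : smooth1 F.
  by apply: Smooth1M; [exact: Smooth1_cst|exact: Smooth1_affine].
have cas : continuous (fun t : R => a (s - t)).
  rewrite (_ : (fun t : R => _) = (fun t => a (-1 * t + s))).
    exact: smooth1_continuous (Smooth1_affine (-1) s sa).
  by apply/funext => t; rewrite mulN1r addrC.
have cF := smooth1_continuous sF.
have FTC : (\int[@lebesgue_measure R]_(t in `[0%R, h]) (a (s - t))%:E = (F h)%:E - (F 0)%:E)%E.
  apply: continuous_FTC2 => //.
  - exact: continuous_subspaceT.
  - split.
    + by move=> t _; exact: ex_derive.
    + by apply: cvg_at_right_filter; exact: cF.
    + by apply: cvg_at_left_filter; exact: cF.
  - by move=> t _; rewrite derive1E; exact: derive_val.
rewrite /Rintegral.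
rewrite (_ : (\int[_]_t _)%E = (\int[@lebesgue_measure R]_(t in `[0%R, h]) (a (s - t))%:E)%E).
  rewrite FTC -EFinB/= /F /Psi.
  have -> : -1 * h + s = 1 * s + - h by ring.
  have -> : -1 * 0 + s = s by ring.
  by ring.
rewrite [RHS]integral_mkcond; apply: eq_integral => t _.
by rewrite patchE indicE /D_; case: ifPn => _; rewrite ?mulr1 ?mulr0.
Qed.

End window.

Section tensor_shift.
Variable R : realType.
Implicit Types (a : 'I_3 -> R -> R) (x : R3 R).

Definition coord (i : 'I_3) (x : R3 R) : R :=
  if i == 0%N :> nat then x.1.1 else if i == 1%N :> nat then x.1.2 else x.2.

Lemma tens_upd a i f x :
  tens (upd a i f) x = f (coord i x) * tens (upd a i (fun=> 1)) x.
Proof. by move: i; apply: ord3P; rewrite /tens /upd /coord/=; ring. Qed.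

Lemma upd_id a i : upd a i (a i) = a.
Proof. by apply/funext => j; rewrite /upd; case: eqP => [->|]. Qed.

Lemma tens_shift a i x (t : R) :
  tens a (x + t *: basis3 R i) = tens (upd a i (fun s => a i (s + t))) x.
Proof.
by move: i; apply: ord3P; rewrite /tens /upd/= /GRing.scale/= !mulr1 !mulr0 !addr0.
Qed.

End tensor_shift.

(** * Weak derivatives and their integrals along segments *)

Section weak_derivative.
Variable R : realType.
Implicit Types (u g w : E3 R -> R) (phi : R3 R -> R) (i : 'I_3).

Definition weakd i u g := forall phi, test_function phi ->
  (\int[mu3 R]_x (u x * partial i phi x)%:E = - \int[mu3 R]_x (g x * phi x)%:E)%E.

Lemma integral_EFin f : (mu3 R).-integrable setT (EFin \o f) ->
  (\int[mu3 R]_x (f x)%:E)%E = (\int[mu3 R]_x f x)%:E.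
Proof. by move=> If; rewrite /Rintegral fineK// integrable_fin_num. Qed.

Lemma weakd_Rintegral i u g phi : L2 u -> L2 g -> test_function phi -> weakd i u g ->
  \int[mu3 R]_x (u x * partial i phi x) = - \int[mu3 R]_x (g x * phi x).
Proof.
move=> Lu Lg tphi /(_ _ tphi); have [Lphi Ldphi] := L2_test tphi.
rewrite !integral_EFin; [|exact: integrable_L2M|exact: integrable_L2M].
by rewrite -EFinN => -[].
Qed.

Lemma L2_ortho_ae0 (k : E3 R -> R) : L2 k ->
  (forall a, (forall i, test1 (a i)) -> \int[mu3 R]_x (k x * tens a x) = 0) ->
  {ae mu3 R, forall x, k x = 0}.
Proof.
move=> Lk H; apply: test_ortho_ae0; first exact: L2_measurable.
  by move=> n; exact: integrable_cube.
move=> a ta; have [Lphi _] := L2_test (test_function_tens ta).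
by rewrite integral_EFin ?H//; exact: integrable_L2M.
Qed.

Lemma weakd_unique i u g g' : L2 u -> L2 g -> L2 g' -> weakd i u g -> weakd i u g' ->
  {ae mu3 R, forall x, g x = g' x}.
Proof.
move=> Lu Lg Lg' wg wg'.
have : {ae mu3 R, forall x, g x - g' x = 0}.
  apply: L2_ortho_ae0; first exact: L2B.
  move=> a ta; have tphi := test_function_tens ta; have [Lphi _] := L2_test tphi.
  under eq_Rintegral do rewrite mulrBl.
  rewrite RintegralB//; [|exact: integrable_L2M|exact: integrable_L2M].
  have := weakd_Rintegral Lu Lg tphi wg; rewrite (weakd_Rintegral Lu Lg' tphi wg').
  by move=> /oppr_inj ->; rewrite subrr.
by apply: filterS => x /eqP; rewrite subr_eq0 => /eqP.
Qed.

Lemma Rintegral_shift (a : R3 R) (f : E3 R -> R) : measurable_fun setT f ->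
  \int[mu3 R]_x f (x + a)%R = \int[mu3 R]_x f x.
Proof.
move=> mf; rewrite /Rintegral; congr fine.
by rewrite -(integral_shift a (f := EFin \o f))//; exact/measurable_EFinP.
Qed.

(** The fundamental theorem of calculus for weak derivatives. Tested against [tens a], the segment
    integral of [g] becomes [g] tested against the product whose i-th factor is replaced by the
    window integral [Psi] of [a i]. The partial derivative of that product is [tens a] minus its
    translate, and the weak derivative identity concludes. *)
Lemma weakd_shift i u g h : L2 u -> L2 g -> weakd i u g -> 0 < h ->
  {ae mu3 R, forall x, u (x + h *: basis3 R i) - u x = lavg (basis3 R i) g h x}.
Proof.
move=> Lu Lg wg h0; set v := basis3 R i.
have Lus := L2_shift (h *: v) Lu.
have Ll := L2_lavg v Lg h0.
have : {ae mu3 R, forall x, u (x + h *: v) - u x - lavg v g h x = 0}.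
  apply: L2_ortho_ae0; first by apply: L2B => //; exact: L2B.
  move=> a ta; have tphi := test_function_tens ta; have [Lphi _] := L2_test tphi.
  have [Psi [tPsi dPsi iPsi]] := test1_window (ta i) h0.
  have taPsi j : test1 (upd a i Psi j) by rewrite /upd; case: ifP.
  have tPsi3 := test_function_tens taPsi; have [LPsi _] := L2_test tPsi3.
  have Lphis := L2_shift (- (h *: v)) Lphi.
  under eq_Rintegral do rewrite !mulrBl.
  rewrite RintegralB//; last 2 first.
  - have Ld := L2B Lus Lu; have := integrable_L2M Ld Lphi.
    by congr integrable; apply/funext => x; rewrite /= mulrBl.
  - exact: integrable_L2M.
  rewrite RintegralB//; [|exact: integrable_L2M|exact: integrable_L2M].
  have e1 : \int[mu3 R]_x (u (x + h *: v)%R * tens a x) =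
      \int[mu3 R]_x (u x * tens a (x - h *: v)).
    rewrite -[RHS](Rintegral_shift (h *: v)).
      by apply: eq_Rintegral => x _; rewrite addrK.
    by apply: measurable_funM; exact: L2_measurable.
  have e2 : \int[mu3 R]_x (lavg v g h x * tens a x) =
      \int[mu3 R]_x (g x * tens (upd a i Psi) x).
    under eq_Rintegral do rewrite mulrC.
    rewrite /Rintegral integral_lavg_swap//; congr fine.
    apply: eq_integral => x _; congr (_ * _)%:E.
    rewrite tens_upd -iPsi mulrC /lavg -RintegralZl//; last first.
      have tc : test1 (fun t => a i (coord i x - t)).
        have [sa [L HL]] := ta i; split.
          have := Smooth1_affine (-1) (coord i x) sa.
          by congr smooth1; apply/funext => t; rewrite mulN1r addrC.
        exists (L + `|coord i x|) => t ht; apply: HL.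
        have := ler_normB (coord i x) (coord i x - t).
        by rewrite opprB addrC subrK; lra.
      have := integrableS measurableT (measurable_D_ h) (@subsetT _ _) (test1_integrable tc).
      move/(integrable_mkcond _ (measurable_D_ h)); congr integrable.
      apply/funext => t; rewrite patchE /= indicE.
      by case: ifPn => _; rewrite /= ?mulr1 ?mulr0.
    apply: eq_Rintegral => t _.
    by rewrite scalerN -scaleNr tens_shift tens_upd mulrAC mulrC.
  have e3 := weakd_Rintegral Lu Lg tPsi3 wg.
  have pt : partial i (tens (upd a i Psi)) =
      tens (upd (upd a i Psi) i (fun t => a i t - a i (t - h))).
    by apply: partial_tens => t; rewrite /upd eqxx.
  rewrite pt in e3.
  have e4 x : tens (upd (upd a i Psi) i (fun t => a i t - a i (t - h))) x =
      tens a x - tens a (x - h *: v).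
    have ea : tens a x = a i (coord i x) * tens (upd a i (fun=> 1)) x.
      by rewrite -(tens_upd a i (a i) x) upd_id.
    have uu f : upd (upd a i Psi) i f = upd a i f.
      by apply/funext => j; rewrite /upd; case: eqP.
    have -> : x - h *: v = x + (- h) *: v by rewrite scaleNr.
    rewrite uu (tens_upd a i (fun t => a i t - a i (t - h))) ea /v tens_shift.
    rewrite (tens_upd a i (fun s => a i (s + - h))).
    exact: mulrBl.
  have e5 : \int[mu3 R]_x (u x * tens (upd (upd a i Psi) i (fun t => a i t - a i (t - h))) x) =
      \int[mu3 R]_x (u x * tens a x) - \int[mu3 R]_x (u x * tens a (x - h *: v)).
    under eq_Rintegral do rewrite e4 mulrBr.
    by rewrite RintegralB//; exact: integrable_L2M.
  by rewrite e5 in e3; rewrite e1 e2; lra.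
apply: (@filterS _ _ (ae_filter_ringOfSetsType (mu3 R))) => x /eqP.
by rewrite subr_eq0 => /eqP.
Qed.

End weak_derivative.

(** * The chain rule for the hypotenuse *)

Section root.
Variable R : realType.
Variable e : R.
Hypothesis e0 : 0 < e.
Implicit Types a b : R.

(** For e > 0 a smooth convex regularisation of the hypotenuse of [a] and [b], which is itself the
    case e = 0. *)
Definition root a b := Num.sqrt (e ^+ 2 + (a ^+ 2 + b ^+ 2)).

Lemma root_sqr a b : root a b ^+ 2 = e ^+ 2 + (a ^+ 2 + b ^+ 2).
Proof. by rewrite sqr_sqrtr// !addr_ge0// sqr_ge0. Qed.

Lemma root_ge a b : e <= root a b.
Proof.
rewrite -[leLHS](ger0_norm (ltW e0)) -sqrtr_sqr ler_wsqrtr//.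
by rewrite lerDl addr_ge0// sqr_ge0.
Qed.

Lemma root_gt0 a b : 0 < root a b.
Proof. exact: lt_le_trans e0 (root_ge a b). Qed.

Lemma norm_le_root1 a b : `|a| <= root a b.
Proof.
rewrite -sqrtr_sqr ler_wsqrtr//.
by have := sqr_ge0 e; have := sqr_ge0 b; lra.
Qed.

Lemma norm_le_root2 a b : `|b| <= root a b.
Proof.
rewrite -sqrtr_sqr ler_wsqrtr//.
by have := sqr_ge0 e; have := sqr_ge0 a; lra.
Qed.

(** With P and P' the two roots, the remainder is (P' P - e^2 - a a' - b b') / P. Cauchy-Schwarz for
    (e, a, b) and (e, a', b') makes it nonnegative; (P' - P)^2 >= 0 bounds its numerator by half the
    squared distance, and P >= e. *)
Lemma root_tangent a b a' b' :
  0 <= root a' b' - root a b - (a / root a b * (a' - a) + b / root a b * (b' - b)) <=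
  ((a' - a) ^+ 2 + (b' - b) ^+ 2) / (2 * e).
Proof.
have P0 := root_gt0 a b; have P0' := root_gt0 a' b'.
have E := root_sqr a b; have E' := root_sqr a' b'; have Pe := root_ge a b.
set P := root a b in P0 E Pe *; set P' := root a' b' in P0' E' *.
have -> : P' - P - (a / P * (a' - a) + b / P * (b' - b)) =
    (P' * P - (e ^+ 2 + a * a' + b * b')) / P.
  have -> : e ^+ 2 + a * a' + b * b' =
      P ^+ 2 + (a * (a' - a) + b * (b' - b)) by rewrite E; ring.
  by field; rewrite gt_eqF.
have CS : e ^+ 2 + a * a' + b * b' <= P' * P.
  have [le0|gt0] := leP (e ^+ 2 + a * a' + b * b') 0.
    by rewrite (le_trans le0)// mulr_ge0// ltW.
  have PP : 0 <= P' * P by rewrite mulr_ge0// ltW.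
  rewrite -(@ler_pXn2r _ 2)// ?nnegrE ?(ltW gt0)//.
  rewrite exprMn E E' -subr_ge0.
  have -> : (e ^+ 2 + (a' ^+ 2 + b' ^+ 2)) * (e ^+ 2 + (a ^+ 2 + b ^+ 2)) -
     (e ^+ 2 + a * a' + b * b') ^+ 2 =
     (e * (a' - a)) ^+ 2 + (e * (b' - b)) ^+ 2 + (a * b' - b * a') ^+ 2 by ring.
  by rewrite !addr_ge0// sqr_ge0.
apply/andP; split; first by rewrite divr_ge0 ?(ltW P0)// subr_ge0.
rewrite ler_pdivrMr//.
apply: (@le_trans _ _ (((a' - a) ^+ 2 + (b' - b) ^+ 2) / 2)).
  have : 0 <= (P' - P) ^+ 2 by exact: sqr_ge0.
  rewrite sqrrB E E' => H.
  have -> : ((a' - a) ^+ 2 + (b' - b) ^+ 2) / 2 =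
     (a' ^+ 2 + b' ^+ 2 + a ^+ 2 + b ^+ 2) / 2 - a * a' - b * b' by field.
  lra.
rewrite invfM mulrA -[leRHS]mulrA; apply: ler_peMr.
  by rewrite divr_ge0// addr_ge0// sqr_ge0.
by rewrite mulrC ler_pdivlMr// mul1r.
Qed.

Lemma norm_root_frac1 a b : `|a / root a b| <= 1.
Proof.
by rewrite normrM normfV (gtr0_norm (root_gt0 a b)) ler_pdivrMr ?root_gt0// mul1r norm_le_root1.
Qed.

Lemma norm_root_frac2 a b : `|b / root a b| <= 1.
Proof.
by rewrite normrM normfV (gtr0_norm (root_gt0 a b)) ler_pdivrMr ?root_gt0// mul1r norm_le_root2.
Qed.

Lemma root_lip a b a' b' : `|root a' b' - root a b| <= `|a' - a| + `|b' - b|.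
Proof.
have H c d c' d' : root c d - root c' d' <= `|c' - c| + `|d' - d|.
  have /andP[h _] := root_tangent c d c' d'.
  have h1 : `|c / root c d * (c' - c)| <= `|c' - c|.
    by rewrite normrM ler_piMl// norm_root_frac1.
  have h2 : `|d / root c d * (d' - d)| <= `|d' - d|.
    by rewrite normrM ler_piMl// norm_root_frac2.
  have := ler_norm (- (c / root c d * (c' - c))).
  have := ler_norm (- (d / root c d * (d' - d))).
  rewrite !normrN; lra.
rewrite ler_norml; apply/andP; split; last first.
  by have := H a' b' a b; rewrite [`|a - a'|]distrC [`|b - b'|]distrC.
by have := H a b a' b'; lra.
Qed.

Lemma root_frac_lip a b a' b' :
  `|a' / root a' b' - a / root a b| <= 2 / e * (`|a' - a| + `|b' - b|).
Proof.
have P0 := root_gt0 a b; have P0' := root_gt0 a' b'; have Pe' := root_ge a' b'.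
have L := root_lip a b a' b'; have F := norm_root_frac1 a b.
set P := root a b in P0 L F *; set P' := root a' b' in P0' Pe' L *.
have -> : a' / P' - a / P = ((a' - a) - a / P * (P' - P)) / P'.
  by field; rewrite !gt_eqF.
have D0 : 0 <= `|a' - a| + `|b' - b| by rewrite addr_ge0.
rewrite normrM normfV (gtr0_norm P0') [leRHS]mulrAC.
apply: (@le_trans _ _ (2 * (`|a' - a| + `|b' - b|) / P')).
  rewrite ler_pM2r ?invr_gt0//.
  have h1 : `|a / P * (P' - P)| <= `|P' - P| by rewrite normrM ler_piMl.
  have h2 : `|a' - a - a / P * (P' - P)| <= `|a' - a| + `|a / P * (P' - P)|.
    exact: ler_normB.
  have h3 := le_trans h1 L.
  have h4 : 0 <= `|b' - b| by [].
  apply: (le_trans h2); lra.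
by rewrite ler_wpM2l ?mulr_ge0// lef_pV2.
Qed.

End root.

(** * Difference quotients in L2 *)

Section difference_quotients.
Variable R : realType.
Implicit Types (u g psi : E3 R -> R) (i : 'I_3) (h : R).

Lemma nr_le u w : L2 w -> measurable_fun [set: E3 R] u ->
  {ae mu3 R, forall x, `|u x| <= `|w x|} -> L2 u /\ nr u <= nr w.
Proof.
move=> Lw mu uw; have mw := L2_measurable Lw.
have h : (nsq u <= nsq w)%E.
  apply: ae_ge0_le_integral => //.
  - by move=> x _; rewrite lee_fin sqr_ge0.
  - exact: nsq_measurable.
  - by move=> x _; rewrite lee_fin sqr_ge0.
  - exact: nsq_measurable.
  move: uw; apply: (@filterS _ _ (ae_filter_ringOfSetsType (mu3 R))) => x ux _.
  rewrite lee_fin -(real_normK (num_real (u x))) -(real_normK (num_real (w x))).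
  by rewrite lerXn2r// nnegrE.
have Lu : L2 u by apply/L2P; split => //; apply: le_lt_trans h _; case/L2P: Lw.
by split => //; move: h; rewrite !nrE// lee_fin.
Qed.

Lemma nr_shift_le i u g h : L2 u -> L2 g -> weakd i u g -> 0 <= h ->
  nr (fun x => u (x - h *: basis3 R i) - u x) <= h ^+ 2 * nr g.
Proof.
move=> Lu Lg wg; rewrite le_eqVlt => /predU1P[<-|h0].
  rewrite expr0n mul0r /nr /nsq (eq_integral (fun=> 0%E)) ?integral0// => x _.
  by rewrite scale0r subr0 subrr expr0n.
have Ll := L2_lavg (basis3 R i) Lg h0.
set v := basis3 R i.
have mk : measurable_fun [set: E3 R] (fun x => u (x + h *: v) - u x).
  by apply: L2_measurable; apply: L2B => //; exact: L2_shift.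
have [_ le1] : L2 (fun x => u (x + h *: v) - u x) /\
    nr (fun x => u (x + h *: v) - u x) <= nr (lavg v g h).
  apply: nr_le => //; have := weakd_shift Lu Lg wg h0.
  by apply: (@filterS _ _ (ae_filter_ringOfSetsType (mu3 R))) => x ->.
have -> : nr (fun x => u (x - h *: v) - u x) = nr (fun x => u (x + h *: v) - u x).
  rewrite /nr -(nsq_shift (- (h *: v)) mk); congr fine.
  by apply: eq_integral => x _; rewrite subrK -sqrrN opprB.
apply: (le_trans le1); rewrite -lee_fin -nrE//; exact: nsq_lavg.
Qed.

(** The quantity estimated is the integral over t in [0, h] of C t - C 0, where C t pairs [psi] with
    the translate of [g] by t. No continuity of translations of [g] is invoked: the shift is moved
    onto [psi], whose modulus of continuity is assumed, and Young's inequality with weight [h] gives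
    the explicit rate. *)
Lemma weak_quotient i u g psi (K h : R) : L2 u -> L2 g -> weakd i u g -> L2 psi ->
  (forall t, 0 <= t <= 1 ->
     nr (fun x => psi (x - t *: basis3 R i) - psi x) <= K * t ^+ 2) ->
  0 < h <= 1 -> 0 <= K ->
  `|\int[mu3 R]_x (psi x * (u (x + h *: basis3 R i) - u x)) -
    h * \int[mu3 R]_x (psi x * g x)| <= h * (h * (nr g + K) / 2).
Proof.
move=> Lu Lg wg Lpsi HK /andP[h0 h1] K0; set v := basis3 R i in HK *.
have mg := L2_measurable Lg; have mpsi := L2_measurable Lpsi.
have Ll := L2_lavg v Lg h0.
pose C t := \int[mu3 R]_x (psi x * g (x + t *: v)).
pose C0 := \int[mu3 R]_x (psi x * g x).
have e1 : \int[mu3 R]_x (psi x * (u (x + h *: v) - u x)) =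
    \int[mu3 R]_x (psi x * lavg v g h x).
  rewrite /Rintegral; congr fine; apply: ae_eq_integral => //.
  - apply/measurable_EFinP; apply: measurable_funM => //; apply: L2_measurable.
    by apply: L2B => //; exact: L2_shift.
  - by apply/measurable_EFinP; apply: measurable_funM => //; exact: L2_measurable.
  have := weakd_shift Lu Lg wg h0.
  by apply: (@filterS _ _ (ae_filter_ringOfSetsType (mu3 R))) => x ->.
have e2 : \int[mu3 R]_x (psi x * lavg v g h x) =
    \int[@lebesgue_measure R]_t (C t * \1_(D_ h) t).
  by rewrite /Rintegral (integral_lavg_dual v Lpsi Lg h0).
have mC : measurable_fun [set: measurableTypeR R] C.
  rewrite /C /Rintegral; apply: measurableT_comp => //.
  pose J (z : E3 R * measurableTypeR R) := psi z.1 * g (z.1 + z.2 *: v).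
  have mJ : measurable_fun setT (EFin \o J).
    apply/measurable_EFinP; apply: measurable_funM.
      exact: (measurableT_comp mpsi measurable_fst).
    exact: (measurableT_comp mg (measurable_line v)).
  have mp := @measurable_fun_fubini_tonelli_G _ _ _ _ _ (mu3 R) _
    (measurable_funepos mJ) (funepos_ge0 _).
  have mn := @measurable_fun_fubini_tonelli_G _ _ _ _ _ (mu3 R) _
    (measurable_funeneg mJ) (funeneg_ge0 _).
  apply: eq_measurable_fun (emeasurable_funB mp mn) => t _.
  rewrite integralE /fubini_G; congr (_ - _)%E.
    by apply: eq_integral => x _; rewrite !funeposE.
  by apply: eq_integral => x _; rewrite !funenegE.
pose B := h * (nr g + K) / 2.
have B0 : 0 <= B by rewrite divr_ge0// mulr_ge0 ?(ltW h0)// addr_ge0// nr_ge0.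
have CB t : D_ h t -> `|C t - C0| <= B.
  rewrite /D_/= in_itv/= => /andP[t0 th].
  have Lpt := L2_shift (- (t *: v)) Lpsi.
  have -> : C t - C0 = \int[mu3 R]_x ((psi (x - t *: v) - psi x) * g x).
    under eq_Rintegral do rewrite mulrBl.
    rewrite RintegralB//; [|exact: integrable_L2M|exact: integrable_L2M].
    congr (_ - _); rewrite /C -(Rintegral_shift (- (t *: v))).
      by apply: eq_Rintegral => x _; rewrite subrK.
    by apply: measurable_funM => //; exact: L2_measurable (L2_shift _ Lg).
  under eq_Rintegral do rewrite mulrC.
  apply: (le_trans (le_Rintegral_L2M Lg (L2B Lpt Lpsi) h0)).
  rewrite /B ler_pM2r ?invr_gt0// mulrDr lerD2l ler_pdivrMl//.
  apply: (le_trans (HK t _)); first by rewrite t0 (le_trans th).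
  by rewrite [leRHS]mulrA mulrC ler_wpM2r// -expr2 lerXn2r// nnegrE ltW.
have iB (c : R) : (@lebesgue_measure R).-integrable setT (fun t => (c * \1_(D_ h) t)%:E).
  apply/integrableP; split.
    apply/measurable_EFinP; apply: measurable_funM => //.
    by apply: measurable_indic; exact: measurable_D_.
  rewrite (eq_integral (fun t => (`|c| * \1_(D_ h) t)%:E)) => [|t _].
    by rewrite integral_D_ ?ltry// ltW.
  by rewrite /= normrM [`|\1__ _|]ger0_norm.
have iD : (@lebesgue_measure R).-integrable setT (fun t => ((C t - C0) * \1_(D_ h) t)%:E).
  apply: (le_integrable measurableT _ _ (iB B)).
    apply/measurable_EFinP; apply: measurable_funM; first exact: measurable_funB.
    by apply: measurable_indic; exact: measurable_D_.
  move=> t _; rewrite /= lee_fin [leLHS]normrM [leRHS]normrM (ger0_norm B0) indicE.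
  by case: (boolP (t \in D_ h)) => [|_]; rewrite ?normr0 ?mulr0// inE normr1 !mulr1 => /CB.
have iC : (@lebesgue_measure R).-integrable setT (fun t => (C t * \1_(D_ h) t)%:E).
  have := integrableD measurableT iD (iB C0).
  by congr integrable; apply/funext => t; rewrite -EFinD -mulrDl subrK.
have e3 (c : R) : \int[@lebesgue_measure R]_t (c * \1_(D_ h) t) = c * h.
  by rewrite /Rintegral integral_D_ ?ltW.
rewrite e1 e2 -/C0 [h * C0]mulrC -(e3 C0) -RintegralB//; last exact: iB.
under eq_Rintegral do rewrite -mulrBl.
apply: (le_trans (le_normr_Rintegral _ iD)) => //.
rewrite -/B mulrC -e3; apply: le_Rintegral => //.
- exact: (integrable_abse iD).
- exact: iB.
move=> t _; rewrite normrM [`|\1__ _|]ger0_norm// indicE.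
by case: (boolP (t \in D_ h)) => [|_]; rewrite ?mulr0// inE !mulr1 => /CB.
Qed.

End difference_quotients.

Section chain_rule.
Variable R : realType.
Implicit Types (u g psi : E3 R -> R) (i : 'I_3) (h : R).

Lemma Rintegral_dct (f_ : nat -> E3 R -> R) (f F : E3 R -> R) :
  (forall n, measurable_fun [set: E3 R] (f_ n)) ->
  (forall x, f_ n x @[n --> \oo] --> f x) ->
  (mu3 R).-integrable setT (EFin \o F) ->
  (forall n x, `|f_ n x| <= F x) ->
  \int[mu3 R]_x f_ n x @[n --> \oo] --> \int[mu3 R]_x f x.
Proof.
move=> mf_ cf iF fF.
have mf : measurable_fun [set: E3 R] f.
  by apply: (@measurable_fun_cvg _ _ _ setT f_ f) => // x _; exact: cf.
have [] := @dominated_convergence _ _ _ (mu3 R) setT measurableT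
  (fun k x => (f_ k x)%:E) (EFin \o f) (EFin \o F).
- by move=> k; exact/measurable_EFinP.
- exact/measurable_EFinP.
- apply: aeW => x _; apply: cvg_EFin; first exact: nearW.
  exact: cf.
- exact: iF.
- by apply: aeW => x n _; rewrite /= lee_fin.
move=> If _ c; apply: fine_cvg.
rewrite -(integral_EFin If) in c *.
exact: c.
Qed.

Lemma nr_le3 (f a b c : E3 R -> R) : L2 a -> L2 b -> L2 c ->
  measurable_fun [set: E3 R] f ->
  (forall x, `|f x| <= `|a x| + `|b x| + `|c x|) ->
  L2 f /\ nr f <= 3 * (nr a + nr b + nr c).
Proof.
move=> La Lb Lc mf fabc.
have i2 k : L2 k -> (mu3 R).-integrable setT (EFin \o (fun x => k x ^+ 2)).
  by move=> Lk; have := integrable_L2M Lk Lk; congr integrable; apply/funext => x /=; rewrite expr2.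
have iab := integrableD measurableT (i2 _ La) (i2 _ Lb).
have iabc := integrableD measurableT iab (i2 _ Lc).
have i3 : (mu3 R).-integrable setT (EFin \o (fun x => 3 * (a x ^+ 2 + b x ^+ 2 + c x ^+ 2))).
  exact: (integrableZl measurableT 3 iabc).
have le x : f x ^+ 2 <= 3 * (a x ^+ 2 + b x ^+ 2 + c x ^+ 2).
  rewrite -(real_normK (num_real (f x))) -(real_normK (num_real (a x))).
  rewrite -(real_normK (num_real (b x))) -(real_normK (num_real (c x))).
  apply: (@le_trans _ _ ((`|a x| + `|b x| + `|c x|) ^+ 2)).
    by rewrite lerXn2r// nnegrE ?addr_ge0.
  rewrite -subr_ge0.
  have -> : 3 * (`|a x| ^+ 2 + `|b x| ^+ 2 + `|c x| ^+ 2) - (`|a x| + `|b x| + `|c x|) ^+ 2 =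
    (`|a x| - `|b x|) ^+ 2 + (`|b x| - `|c x|) ^+ 2 + (`|a x| - `|c x|) ^+ 2 by ring.
  by rewrite !addr_ge0// sqr_ge0.
have Lf : L2 f.
  have mF : measurable_fun [set: E3 R] (fun x => 3 * (a x ^+ 2 + b x ^+ 2 + c x ^+ 2)).
    by have /integrableP[/measurable_EFinP] := i3.
  apply: (L2_le mf mF le).
  have /integrableP[_] := i3; apply: le_lt_trans.
  apply: ge0_le_integral => //.
  - by move=> x _; rewrite lee_fin (le_trans (sqr_ge0 _) (le x)).
  - by have /integrableP[] := i3.
  - by apply: measurableT_comp => //; have /integrableP[] := i3.
  - by move=> x _; exact: lee_abs.
split => //.
have Rnr k : nr k = \int[mu3 R]_x (k x ^+ 2) by [].
rewrite !Rnr -RintegralD//; [|exact: i2|exact: i2].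
rewrite -RintegralD//; last exact: i2.
rewrite -RintegralZl//; apply: le_Rintegral => //; first exact: i2.
Qed.

Lemma nr_shiftN u (a : R3 R) : measurable_fun [set: E3 R] u ->
  nr (fun x => u (x - a) - u x) = nr (fun x => u (x + a) - u x).
Proof.
move=> mu.
have mk : measurable_fun [set: E3 R] (fun x => u (x + a) - u x).
  by apply: measurable_funB => //; exact: measurable_shift_comp.
rewrite /nr -(nsq_shift (- a) mk); congr fine.
by apply: eq_integral => x _; rewrite subrK -sqrrN opprB.
Qed.

Lemma cube_shift n i t (x : E3 R) : 0 <= t <= 1 -> cube n (x - t *: basis3 R i) ->
  cube n.+1 x.
Proof.
move=> /andP[t0 t1]; move: i; apply: ord3P => -[];
  rewrite /= /GRing.scale/= ?mulr1 ?mulr0 ?oppr0 ?addr0 => /andP[? ?] /andP[? ?] /andP[? ?];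
  by split; rewrite -[n.+1%:R]natr1; apply/andP; split; lra.
Qed.

Lemma cubeS n (x : E3 R) : cube n x -> cube n.+1 x.
Proof.
apply: sub_ocbox => i; first by rewrite lerN2 ler_nat leqnSn.
by rewrite ler_nat leqnSn.
Qed.

Lemma test_shift_nr phi i : test_function phi -> exists2 K : R, 0 <= K &
  forall t, 0 <= t <= 1 -> nr (fun x => phi (x - t *: basis3 R i) - phi x) <= K * t ^+ 2.
Proof.
move=> tphi; have [m0 _ [C [n [C0 b0 _ out]]]] := test_facts tphi.
have [C' C'0 HC'] := test_shift_le i tphi.
have mQ := @measurable_cube R n.+1.
pose F (x : E3 R) : R := C' * \1_(cube n.+1) x.
have LF : L2 F.
  apply: (@L2_compact _ _ C' n.+1).
  - by apply: measurable_funM => //; exact: measurable_indic.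
  - by move=> x; rewrite normrM (ger0_norm C'0) ler_piMr// indicE normr_nat; case: (_ \in _).
  - by move=> x nQ; rewrite /F indicE memNset// mulr0.
exists (nr F) => [|t /andP[t0 t1]]; first exact: nr_ge0.
have LtF := L2Z t LF.
have mk : measurable_fun [set: E3 R] (fun x => phi (x - t *: basis3 R i) - phi x).
  by apply: measurable_funB => //; exact: measurable_shift_comp.
have [_ le1] : L2 (fun x => phi (x - t *: basis3 R i) - phi x) /\
    nr (fun x => phi (x - t *: basis3 R i) - phi x) <= nr (fun x => t * F x).
  apply: nr_le => //; apply: aeW => x.
  rewrite /F indicE; case: (boolP (x \in cube n.+1)) => [_|/negP nQ].
    rewrite mulr1 distrC; move: t0; rewrite le_eqVlt => /predU1P[<-|t0].
      by rewrite scale0r subr0 subrr normr0.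
    apply: (le_trans (HC' _ _ t0)).
    by rewrite mulrC ler_norm.
  rewrite inE in nQ.
  have nx : ~ cube n x by move=> /cubeS.
  have ny : ~ cube n (x - t *: basis3 R i).
    by move=> /(@cube_shift n i t x) H; apply: nQ; apply: H; rewrite t0.
  by have [-> _] := out _ nx; have [-> _] := out _ ny; rewrite subrr normr0.
apply: (le_trans le1).
have e : nsq (fun x => t * F x) = ((t ^+ 2)%:E * nsq F)%E.
  rewrite /nsq; under eq_integral do rewrite exprMn EFinM.
  rewrite ge0_integralZl ?lee_fin ?sqr_ge0//.
  - by apply: nsq_measurable; exact: L2_measurable.
  - by move=> x _; rewrite lee_fin sqr_ge0.
by rewrite {1}/nr e nrE// -EFinM/= mulrC.
Qed.

(** Supplies the modulus of continuity that [weak_quotient] asks for. The factor [p], later a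
    partial derivative of the regularised root, is not smooth, but its increments are bounded by
    those of u and u', hence in L2 by their weak derivatives. *)
Lemma frac_test_shift i u g u' g' (p : E3 R -> R) phi (L : R) :
  L2 u -> L2 g -> L2 u' -> L2 g' -> weakd i u g -> weakd i u' g' ->
  measurable_fun [set: E3 R] p -> (forall x, `|p x| <= 1) -> 0 <= L ->
  (forall x y, `|p y - p x| <= L * (`|u y - u x| + `|u' y - u' x|)) ->
  test_function phi ->
  L2 (fun x => p x * phi x) /\ exists2 K : R, 0 <= K & forall t, 0 <= t <= 1 ->
    nr (fun x => p (x - t *: basis3 R i) * phi (x - t *: basis3 R i) - p x * phi x) <=
    K * t ^+ 2.
Proof.
move=> Lu Lg Lu' Lg' wg wg' mp p1 L0 pL tphi.
have [Lphi _] := L2_test tphi; have [m0 _ [C [n [C0 b0 _ _]]]] := test_facts tphi.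
have [K1 K10 HK1] := test_shift_nr i tphi.
have Lpsi : L2 (fun x => p x * phi x).
  apply: (@L2_bounded _ phi _ 1 Lphi); first exact: measurable_funM.
  by move=> x; rewrite normrM ler_wpM2r.
split => //.
exists (3 * ((C * L) ^+ 2 * nr g + (C * L) ^+ 2 * nr g' + K1)).
  by rewrite mulr_ge0// !addr_ge0// mulr_ge0 ?sqr_ge0// nr_ge0.
move=> t t01; have /andP[t0 t1] := t01; set a := t *: basis3 R i.
have Ldu := L2B (L2_shift (- a) Lu) Lu; have Ldu' := L2B (L2_shift (- a) Lu') Lu'.
have Ldphi := L2B (L2_shift (- a) Lphi) Lphi.
have nrZ c k : L2 k -> nr (fun x => c * k x) = c ^+ 2 * nr k.
  move=> Lk; have mk := L2_measurable Lk.
  have e : nsq (fun x => c * k x) = ((c ^+ 2)%:E * nsq k)%E.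
    rewrite /nsq; under eq_integral do rewrite exprMn EFinM.
    rewrite ge0_integralZl ?lee_fin ?sqr_ge0//; first exact: nsq_measurable.
    by move=> x _; rewrite lee_fin sqr_ge0.
  by rewrite {1}/nr e nrE// -EFinM.
have [|x|_ le3] := @nr_le3 (fun x => p (x - a) * phi (x - a) - p x * phi x)
  _ _ _ (L2Z (C * L) Ldu) (L2Z (C * L) Ldu') Ldphi.
- apply: L2_measurable; apply: L2B => //; exact: (L2_shift (- a) Lpsi).
- have -> : p (x - a) * phi (x - a) - p x * phi x =
    phi (x - a) * (p (x - a) - p x) + p x * (phi (x - a) - phi x) by ring.
  apply: (le_trans (ler_normD _ _)); apply: lerD; last by rewrite normrM ler_piMl.
  rewrite normrM !normrM (ger0_norm C0) (ger0_norm L0) -mulrDr -mulrA.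
  by apply: ler_pM => //; exact: pL.
apply: (le_trans le3); rewrite !nrZ// -[leRHS]mulrA ler_pM2l// !mulrDl.
apply: lerD; last exact: HK1.
by apply: lerD; rewrite -[leRHS]mulrA; apply: ler_wpM2l; rewrite ?sqr_ge0// mulrC; exact: nr_shift_le.
Qed.

End chain_rule.

Section hypot.
Variable R : realType.
Implicit Types (u g : E3 R -> R) (i : 'I_3).

Lemma measurable_root e u u' : measurable_fun [set: E3 R] u ->
  measurable_fun [set: E3 R] u' ->
  measurable_fun [set: E3 R] (fun x => root e (u x) (u' x)).
Proof.
move=> mu mu'; rewrite /root; apply: measurableT_comp => //.
  exact: continuous_measurable_fun (@sqrt_continuous R).
apply: measurable_funD => //; apply: measurable_funD; exact: measurable_funX.
Qed.

Lemma cvg_harmonic_bound (K : R) (A : nat -> R) (l : R) :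
  (forall n, `|A n - l| <= n.+1%:R^-1 * K) -> A n @[n --> \oo] --> l.
Proof.
move=> AK.
have h0 : n.+1%:R^-1 * K @[n --> \oo] --> 0 * K.
  by apply: cvgM; [exact: cvg_harmonic|exact: cvg_cst].
rewrite mul0r in h0.
have h1 : l - n.+1%:R^-1 * K @[n --> \oo] --> l - 0 by apply: cvgB => //; exact: cvg_cst.
have h2 : l + n.+1%:R^-1 * K @[n --> \oo] --> l + 0 by apply: cvgD => //; exact: cvg_cst.
rewrite subr0 in h1; rewrite addr0 in h2.
apply: squeeze_cvgr h1 h2; apply: nearW => n.
by have := AK n; rewrite ler_distl.
Qed.

(** Subtracting [e] makes the function at most |u| + |u'|, hence square integrable. Its difference
    quotients are linearised at x: [weak_quotient] treats the two linear terms, with the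
    coefficients moved into the test function. *)
Lemma weakd_root i u g u' g' (e : R) : 0 < e ->
  L2 u -> L2 g -> L2 u' -> L2 g' -> weakd i u g -> weakd i u' g' ->
  weakd i (fun x => root e (u x) (u' x) - e)
    (fun x => u x / root e (u x) (u' x) * g x + u' x / root e (u x) (u' x) * g' x).
Proof.
move=> e0 Lu Lg Lu' Lg' wg wg' phi tphi.
have mu := L2_measurable Lu; have mg := L2_measurable Lg.
have mu' := L2_measurable Lu'; have mg' := L2_measurable Lg'.
pose P x := root e (u x) (u' x).
have P0 x : 0 < P x by exact: root_gt0.
have mP : measurable_fun [set: E3 R] P by exact: measurable_root.
have mV : measurable_fun [set: E3 R] (fun x => (P x)^-1).
  have mpow : measurable_fun [set: R] (fun y : R => y `^ (-1)) by exact: measurable_powR.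
  have := measurableT_comp mpow mP.
  congr measurable_fun; apply/funext => x /=.
  by rewrite powR_inv1// ltW.
pose p x := u x / P x; pose q x := u' x / P x.
have mp : measurable_fun [set: E3 R] p by exact: measurable_funM.
have mq : measurable_fun [set: E3 R] q by exact: measurable_funM.
have p1 x : `|p x| <= 1 by exact: norm_root_frac1.
have q1 x : `|q x| <= 1 by exact: norm_root_frac2.
have rootC a b : root e a b = root e b a by rewrite /root [a ^+ 2 + _]addrC.
have pL x y : `|p y - p x| <= 2 / e * (`|u y - u x| + `|u' y - u' x|).
  exact: root_frac_lip.
have qL x y : `|q y - q x| <= 2 / e * (`|u y - u x| + `|u' y - u' x|).
  rewrite [X in _ * X]addrC /q /P ![root e (u _) _]rootC; exact: root_frac_lip.
have e2 : 0 <= 2 / e by rewrite divr_ge0// ltW.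
have [Lphi Ldphi] := L2_test tphi.
have [m0 m1 [C [n0 [C0 b0 b1 out]]]] := test_facts tphi.
have [Lpsi1 [K1 K10 HK1]] := frac_test_shift Lu Lg Lu' Lg' wg wg' mp p1 e2 pL tphi.
have [Lpsi2 [K2 K20 HK2]] := frac_test_shift Lu Lg Lu' Lg' wg wg' mq q1 e2 qL tphi.
pose W x := P x - e.
have mW : measurable_fun [set: E3 R] W by exact: measurable_funB.
have W_le x : `|W x| <= `|u x| + `|u' x|.
  have := root_lip e0 0 0 (u x) (u' x).
  have -> : root e 0 0 = e.
    by rewrite /root expr0n/= !addr0 sqrtr_sqr gtr0_norm.
  by rewrite !subr0.
have L0 : L2 (fun=> 0 : R).
  by apply: (@L2_compact _ _ 0 0%N) => // x; rewrite normr0.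
have LW : L2 W.
  apply: (nr_le3 Lu Lu' L0 mW _).1 => x.
  by rewrite normr0 addr0.
pose G x := p x * g x + q x * g' x.
have mG : measurable_fun [set: E3 R] G.
  by apply: measurable_funD; exact: measurable_funM.
have LG : L2 G.
  apply: (nr_le3 Lg Lg' L0 mG _).1 => x.
  rewrite normr0 addr0; apply: (le_trans (ler_normD _ _)).
  by apply: lerD; rewrite normrM ler_piMl.
rewrite !integral_EFin; [|exact: integrable_L2M|exact: integrable_L2M].
rewrite -EFinN; congr EFin.
pose h (n : nat) : R := n.+1%:R^-1; pose v := basis3 R i.
have h01 n : 0 < h n <= 1 by rewrite invr_gt0 ltr0n/= invf_le1// ler1n.
have hn n : h n * n.+1%:R = 1 by rewrite mulVf.
pose A n := \int[mu3 R]_x (W x * ((phi x - phi (x - h n *: v)) * n.+1%:R)).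
have cA : A n @[n --> \oo] --> \int[mu3 R]_x (W x * partial i phi x).
  have [C' C'0 HC'] := test_shift_le i tphi.
  pose F (x : E3 R) : R := C' * \1_(cube n0.+1) x.
  have mQ := @measurable_cube R n0.+1.
  have LF : L2 F.
    apply: (@L2_compact _ _ C' n0.+1).
    - by apply: measurable_funM => //; exact: measurable_indic.
    - by move=> x; rewrite normrM (ger0_norm C'0) ler_piMr// indicE normr_nat; case: (_ \in _).
    - by move=> x nQ; rewrite /F indicE memNset// mulr0.
  apply: (@Rintegral_dct _ _ _ (fun x => `|W x * F x|)).
  - move=> n; apply: measurable_funM => //; apply: measurable_funM => //.
    by apply: measurable_funB => //; exact: (measurable_shift_comp (- (h n *: v))).
  - by move=> x; apply: cvgM; [exact: cvg_cst|exact: cvg_test_quotient].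
  - exact: (integrable_abse (integrable_L2M LW LF)).
  move=> n x; rewrite !normrM ler_wpM2l// -!normrM.
  have [hn0 hn1] := andP (h01 n).
  rewrite /F indicE; case: (boolP (x \in cube n0.+1)) => [_|/negP nQ].
    rewrite mulr1 (ger0_norm C'0) normrM normr_nat.
    by rewrite -ler_pdivlMr// (HC' _ x hn0).
  rewrite inE in nQ.
  have nx : ~ cube n0 x by move=> /cubeS.
  have ny : ~ cube n0 (x - h n *: v).
    by move=> /(@cube_shift _ n0 i (h n) x) H; apply: nQ; apply: H; rewrite (ltW hn0).
  by have [-> _] := out _ nx; have [-> _] := out _ ny; rewrite subrr mul0r normr0.
pose K := (nr g + K1) / 2 + (nr g' + K2) / 2 + C / (2 * e) * (nr g + nr g').
have AK n : `|A n - - \int[mu3 R]_x (G x * phi x)| <= h n * K.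
  have [hn0 hn1] := andP (h01 n); have hn0' := ltW hn0.
  have LWs := L2_shift (h n *: v) LW.
  have Lus := L2_shift (h n *: v) Lu; have Lus' := L2_shift (h n *: v) Lu'.
  have Ldu := L2B Lus Lu; have Ldu' := L2B Lus' Lu'; have LdW := L2B LWs LW.
  have Lphis := L2_shift (- (h n *: v)) Lphi.
  pose S := \int[mu3 R]_x ((W (x + h n *: v) - W x) * phi x).
  have eA : A n = - (n.+1%:R * S).
    have -> : A n = n.+1%:R * \int[mu3 R]_x (W x * (phi x - phi (x - h n *: v))).
      rewrite -RintegralZl//; last by apply: integrable_L2M => //; exact: L2B.
      by apply: eq_Rintegral => x _; rewrite mulrCA mulrA mulrC mulrA [RHS]mulrCA mulrC.
    rewrite -mulrN; congr (_ * _).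
    under eq_Rintegral do rewrite mulrBr.
    rewrite RintegralB//; [|exact: integrable_L2M|exact: integrable_L2M].
    rewrite /S; under [in RHS]eq_Rintegral do rewrite mulrBl.
    rewrite RintegralB//; [|exact: integrable_L2M|exact: integrable_L2M].
    rewrite opprB; congr (_ - _).
    rewrite -[LHS](Rintegral_shift (h n *: v)).
      by apply: eq_Rintegral => x _; rewrite addrK.
    by apply: measurable_funM => //; exact: L2_measurable Lphis.
  pose S1 := \int[mu3 R]_x (p x * phi x * (u (x + h n *: v) - u x)).
  pose S2 := \int[mu3 R]_x (q x * phi x * (u' (x + h n *: v) - u' x)).
  have B1 := weak_quotient Lu Lg wg Lpsi1 HK1 (h01 n) K10.
  have B2 := weak_quotient Lu' Lg' wg' Lpsi2 HK2 (h01 n) K20.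
  (* By [root_tangent] this is quadratic in the increments of u and u', whose squared norms are of
     order h^2; after division by h it still vanishes. *)
  pose rem x := (W (x + h n *: v) - W x) -
    (p x * (u (x + h n *: v) - u x) + q x * (u' (x + h n *: v) - u' x)).
  have i1 := integrable_L2M Lpsi1 Ldu; have i2 := integrable_L2M Lpsi2 Ldu'.
  have iS := integrable_L2M LdW Lphi.
  have irem : (mu3 R).-integrable setT (EFin \o (fun x => rem x * phi x)).
    have := integrableB measurableT iS (integrableD measurableT i1 i2).
    congr integrable; apply/funext => x /=.
    rewrite -[RHS]/((rem x * phi x)%:E) -[LHS]/((_ - (_ + _))%:E); congr EFin.
    by rewrite /rem; ring.
  have eS : S = S1 + S2 + \int[mu3 R]_x (rem x * phi x).
    rewrite /S1 /S2 -RintegralD// -RintegralD//; last exact: (integrableD measurableT i1 i2).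
    by apply: eq_Rintegral => x _; rewrite /rem; ring.
  have sq k : L2 k -> (mu3 R).-integrable setT (EFin \o (fun x => k x ^+ 2)).
    by move=> Lk; have := integrable_L2M Lk Lk; congr integrable; apply/funext => x /=; rewrite expr2.
  have Brem : `|\int[mu3 R]_x (rem x * phi x)| <=
      C / (2 * e) * (h n ^+ 2 * nr g + h n ^+ 2 * nr g').
    apply: (le_trans (le_normr_Rintegral _ irem)) => //.
    have isum := integrableD measurableT (sq _ Ldu) (sq _ Ldu').
    apply: (@le_trans _ _ (C / (2 * e) * (nr (fun x => u (x + h n *: v) - u x) +
       nr (fun x => u' (x + h n *: v) - u' x)))).
      rewrite /nr /nsq -/(Rintegral _ _ _) -/(Rintegral _ _ _).
      rewrite -RintegralD//; [|exact: sq|exact: sq].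
      rewrite -RintegralZl//; apply: le_Rintegral => //.
      - exact: (integrable_abse irem).
      - exact: (integrableZl measurableT (C / (2 * e)) isum).
      move=> x _; rewrite normrM mulrC -mulrA [X in _ <= _ * X]mulrC.
      apply: ler_pM => //.
      have /andP[r0 r1] := root_tangent e0 (u x) (u' x) (u (x + h n *: v)) (u' (x + h n *: v)).
      rewrite ger0_norm.
        by apply: le_trans r1; rewrite /rem /W /P /p /q /P; lra.
      by apply: le_trans r0 _; rewrite /rem /W /P /p /q /P; lra.
    apply: ler_wpM2l; first by rewrite divr_ge0// mulr_ge0// ltW.
    by apply: lerD; rewrite -nr_shiftN//; exact: nr_shift_le.
  have eG : \int[mu3 R]_x (G x * phi x) =
      \int[mu3 R]_x (p x * phi x * g x) + \int[mu3 R]_x (q x * phi x * g' x).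
    rewrite -RintegralD//; [|exact: integrable_L2M|exact: integrable_L2M].
    by apply: eq_Rintegral => x _; rewrite /G; ring.
  rewrite eA eG opprK.
  rewrite -/v -/S1 in B1; rewrite -/v -/S2 in B2.
  set G1 := \int[mu3 R]_x (p x * phi x * g x) in B1 *.
  set G2 := \int[mu3 R]_x (q x * phi x * g' x) in B2 *.
  set r := \int[mu3 R]_x (rem x * phi x) in eS Brem.
  have -> : - (n.+1%:R * S) + (G1 + G2) =
     - n.+1%:R * ((S1 - h n * G1) + (S2 - h n * G2) + r).
    rewrite eS; have := hn n.
    have -> : - n.+1%:R * (S1 - h n * G1 + (S2 - h n * G2) + r) =
      - n.+1%:R * (S1 + S2 + r) + (h n * n.+1%:R) * (G1 + G2) by ring.
    by move=> ->; ring.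
  rewrite normrM normrN normr_nat mulrC -ler_pdivlMr//.
  rewrite -/(h n).
  apply: (@le_trans _ _ (`|S1 - h n * G1| + `|S2 - h n * G2| + `|r|)).
    by apply: (le_trans (ler_normD _ _)); apply: lerD => //; exact: ler_normD.
  apply: (@le_trans _ _ (h n * (h n * (nr g + K1) / 2) + h n * (h n * (nr g' + K2) / 2) +
     C / (2 * e) * (h n ^+ 2 * nr g + h n ^+ 2 * nr g'))).
    by apply: lerD => //; apply: lerD.
  rewrite le_eqVlt; apply/orP; left; apply/eqP; rewrite /K.
  by field; rewrite gt_eqF.
have cA' := cvg_harmonic_bound AK.
exact: (cvg_unique _ cA cA').
Qed.

End hypot.

Section hypot0.
Variable R : realType.
Implicit Types (u g : E3 R -> R) (i : 'I_3).

Lemma cvg_root0 (a b : R) : root n.+1%:R^-1 a b @[n --> \oo] --> root 0 a b.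
Proof.
rewrite /root; apply: continuous_cvg; first exact: sqrt_continuous.
apply: cvgD; last exact: cvg_cst.
by rewrite expr2; under eq_fun do rewrite expr2; apply: cvgM; exact: cvg_harmonic.
Qed.

Lemma root_ge0 (e a b : R) : 0 <= root e a b. Proof. exact: sqrtr_ge0. Qed.

Lemma rootC (e a b : R) : root e a b = root e b a.
Proof. by rewrite /root [a ^+ 2 + _]addrC. Qed.

Lemma norm_root_frac (e a b : R) : `|a / root e a b| <= 1.
Proof.
have [->|P0] := eqVneq (root e a b) 0; first by rewrite invr0 mulr0 normr0.
have P1 : 0 < root e a b by rewrite lt_def P0 root_ge0.
rewrite normrM normfV (gtr0_norm P1) ler_pdivrMr// mul1r; exact: norm_le_root1.
Qed.

Lemma norm_root_frac' (e a b : R) : `|b / root e a b| <= 1.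
Proof. by rewrite rootC norm_root_frac. Qed.

(** For a = 0 all the quotients are 0, including 0 / 0 in the limit when b = 0 too. The convergence
    thus holds everywhere, and common zeros of the two functions need no separate treatment. *)
Lemma cvg_root_frac (a b : R) :
  a / root n.+1%:R^-1 a b @[n --> \oo] --> a / root 0 a b.
Proof.
have [->|a0] := eqVneq a 0.
  by under eq_fun do rewrite mul0r; rewrite mul0r; exact: cvg_cst.
apply: cvgM; first exact: cvg_cst.
apply: cvgV; last exact: cvg_root0.
rewrite gt_eqF//; apply: lt_le_trans (norm_le_root1 0 a b).
by rewrite normr_gt0.
Qed.

Lemma root_sub_le (e a b : R) : 0 < e -> `|root e a b - e| <= `|a| + `|b|.
Proof.
move=> e0; have := root_lip e0 0 0 a b.
have -> : root e 0 0 = e.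
  by rewrite /root expr0n/= !addr0 sqrtr_sqr gtr0_norm.
by rewrite !subr0.
Qed.

(** Limit e = 1/(n+1) in [weakd_root]. The bounds |u| + |u'| and |g| + |g'| do not depend on e, so
    dominated convergence applies to both sides of the identity. *)
Lemma weakd_hypot i u g u' g' :
  L2 u -> L2 g -> L2 u' -> L2 g' -> weakd i u g -> weakd i u' g' ->
  [/\ L2 (fun x => root 0 (u x) (u' x)),
      L2 (fun x => u x / root 0 (u x) (u' x) * g x + u' x / root 0 (u x) (u' x) * g' x) &
      weakd i (fun x => root 0 (u x) (u' x))
        (fun x => u x / root 0 (u x) (u' x) * g x + u' x / root 0 (u x) (u' x) * g' x)].
Proof.
move=> Lu Lg Lu' Lg' wg wg'.
have mu := L2_measurable Lu; have mg := L2_measurable Lg.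
have mu' := L2_measurable Lu'; have mg' := L2_measurable Lg'.
have L0 : L2 (fun=> 0 : R).
  by apply: (@L2_compact _ _ 0 0%N) => // x; rewrite normr0.
have e0 n : 0 < n.+1%:R^-1 :> R by rewrite invr_gt0 ltr0n.
pose W (x : E3 R) : R := root 0 (u x) (u' x); rewrite -/W.
set G : E3 R -> R := fun x => _ + _.
pose W_ (n : nat) x := root n.+1%:R^-1 (u x) (u' x) - n.+1%:R^-1.
pose G_ (n : nat) x := u x / root n.+1%:R^-1 (u x) (u' x) * g x +
  u' x / root n.+1%:R^-1 (u x) (u' x) * g' x.
have cW x : W_ n x @[n --> \oo] --> W x.
  rewrite -[W x]subr0; apply: cvgB; [exact: cvg_root0|exact: cvg_harmonic].
have cG x : G_ n x @[n --> \oo] --> G x.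
  apply: cvgD; apply: cvgM; try exact: cvg_cst; first exact: cvg_root_frac.
  under eq_fun do rewrite rootC; rewrite rootC; exact: cvg_root_frac.
have mW_ n : measurable_fun [set: E3 R] (W_ n).
  by apply: measurable_funB => //; exact: measurable_root.
have mG_ n : measurable_fun [set: E3 R] (G_ n).
  have mV : measurable_fun [set: E3 R] (fun x => (root n.+1%:R^-1 (u x) (u' x))^-1).
    have mpow : measurable_fun [set: R] (fun y : R => y `^ (-1)) by exact: measurable_powR.
    have := measurableT_comp mpow (measurable_root n.+1%:R^-1 mu mu').
    congr measurable_fun; apply/funext => x /=.
    by rewrite powR_inv1// root_ge0.
  by apply: measurable_funD; do 2 apply: measurable_funM => //.
have mW : measurable_fun [set: E3 R] W.
  by apply: (@measurable_fun_cvg _ _ _ setT W_) => // x _; exact: cW.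
have mG : measurable_fun [set: E3 R] G.
  by apply: (@measurable_fun_cvg _ _ _ setT G_) => // x _; exact: cG.
have bW_ n x : `|W_ n x| <= `|u x| + `|u' x| by exact: root_sub_le.
have bG_ n x : `|G_ n x| <= `|g x| + `|g' x|.
  apply: (le_trans (ler_normD _ _)).
  by apply: lerD; rewrite normrM ler_piMl// ?norm_root_frac// norm_root_frac'.
have lim_le (h_ : nat -> R) (h C : R) : h_ n @[n --> \oo] --> h ->
    (forall n, `|h_ n| <= C) -> `|h| <= C.
  move=> ch bh; have ch' : `|h_ n| @[n --> \oo] --> `|h| by exact: cvg_norm.
  rewrite -(cvg_lim _ ch')//; apply: limr_le; last exact: nearW.
  by apply/cvg_ex; exists `|h|.
have LW : L2 W.
  apply: (nr_le3 Lu Lu' L0 mW _).1 => x; rewrite normr0 addr0.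
  exact: (lim_le _ _ _ (cW x)).
have LG : L2 G.
  apply: (nr_le3 Lg Lg' L0 mG _).1 => x; rewrite normr0 addr0.
  exact: (lim_le _ _ _ (cG x)).
have LW_ n : L2 (W_ n).
  by apply: (nr_le3 Lu Lu' L0 (mW_ n) _).1 => x; rewrite normr0 addr0.
have LG_ n : L2 (G_ n).
  by apply: (nr_le3 Lg Lg' L0 (mG_ n) _).1 => x; rewrite normr0 addr0.
split => // phi tphi.
have [Lphi Ldphi] := L2_test tphi.
have mphi := L2_measurable Lphi; have mdphi := L2_measurable (Ldphi i).
have dom (a b c : E3 R -> R) : L2 a -> L2 b -> L2 c ->
    (mu3 R).-integrable setT (EFin \o (fun x => (`|a x| + `|b x|) * `|c x|)).
  move=> La Lb Lc.
  have := integrableD measurableT (integrable_abse (integrable_L2M La Lc))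
     (integrable_abse (integrable_L2M Lb Lc)).
  by congr integrable; apply/funext => x /=; rewrite !normrM mulrDl.
have cA : \int[mu3 R]_x (W_ n x * partial i phi x) @[n --> \oo] -->
    \int[mu3 R]_x (W x * partial i phi x).
  apply: (@Rintegral_dct _ _ _ (fun x => (`|u x| + `|u' x|) * `|partial i phi x|)).
  - by move=> n; exact: measurable_funM.
  - by move=> x; apply: cvgM => //; exact: cvg_cst.
  - exact: dom.
  - by move=> n x; rewrite normrM ler_wpM2r.
have cB : \int[mu3 R]_x (G_ n x * phi x) @[n --> \oo] -->
    \int[mu3 R]_x (G x * phi x).
  apply: (@Rintegral_dct _ _ _ (fun x => (`|g x| + `|g' x|) * `|phi x|)).
  - by move=> n; exact: measurable_funM.
  - by move=> x; apply: cvgM => //; exact: cvg_cst.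
  - exact: dom.
  - by move=> n x; rewrite normrM ler_wpM2r.
rewrite !integral_EFin; [|exact: integrable_L2M|exact: integrable_L2M].
rewrite -EFinN; congr EFin.
have E : (fun n => \int[mu3 R]_x (W_ n x * partial i phi x)) =
    (fun n => - \int[mu3 R]_x (G_ n x * phi x)).
  apply/funext => n.
  by rewrite (weakd_Rintegral (LW_ n) (LG_ n) tphi)//; exact: weakd_root.
rewrite E in cA; exact: (cvg_unique _ cA (cvgN cB)).
Qed.

End hypot0.

(** * Functions in H^1 *)

Section h1.
Variable R : realType.
Implicit Types (u v : E3 R -> R) (i : 'I_3).

Lemma derive_shift_fun (f : R3 R -> R) (a x w : R3 R) :
  'D_w (fun y => f (y + a)) x = 'D_w f (x + a).
Proof.
by rewrite /derive; under eq_fun do rewrite /= -addrA.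
Qed.

Lemma derivable_shift_fun (f : R3 R -> R) (a x w : R3 R) :
  derivable f (x + a) w -> derivable (fun y => f (y + a)) x w.
Proof.
rewrite /derivable => h; rewrite (_ : (fun _ => _) = 
  (fun h : R => h^-1 *: ((f \o shift (x + a)) (h *: w) - f (x + a)))) //.
by apply/funext => t /=; rewrite -addrA.
Qed.

Lemma partials_shift (f : R3 R -> R) (a : R3 R) s :
  partials s (fun y => f (y + a)) = (fun y => partials s f (y + a)).
Proof.
elim: s => [//|i s IH] /=; rewrite IH; apply/funext => x.
exact: derive_shift_fun.
Qed.

Lemma test_function_shift (f : R3 R -> R) (a : R3 R) :
  test_function f -> test_function (fun y => f (y + a)).
Proof.
move=> [sf cf]; split.
  move=> s; rewrite partials_shift; have [cs ds] := sf s; split.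
    move=> x; apply: (@continuous_comp _ _ _ (fun y : R3 R => y + a)); last exact: cs.
    by apply: cvgD; [exact: cvg_id|exact: cvg_cst].
  by move=> i x; apply: derivable_shift_fun; exact: ds.
set S := [set x | f x != 0] in cf; set S' := [set _ | _].
have cK : compact ((fun y : R3 R => y - a) @` closure S).
  apply: continuous_compact => //; apply: continuous_subspaceT => x.
  by apply: cvgD; [exact: cvg_id|exact: cvg_cst].
apply: (subclosed_compact _ cK); first exact: closed_closure.
have clK := compact_closed (@norm_hausdorff R _) cK.
rewrite closureE => x; apply; split => // y S'y.
exists (y + a); last by rewrite addrK.
exact: subset_closure.
Qed.

Lemma H1_wgrad u : H1 u ->
  forall i, L2 (wgrad u i) /\ weakd i u (wgrad u i).
Proof.
move=> [_ [g hg]] i.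
have [h1 h2] : L2_weak_gradients u (wgrad u) by apply: (@xgetPex _ _ (L2_weak_gradients u)); exists g.
by split => // phi; exact: h2.
Qed.

(** As [wgrad] is an arbitrary choice among weak gradients, an explicit one agrees with it only
    almost everywhere. The gradient estimates that follow inherit this form. *)
Lemma H1_intro u (g : 'I_3 -> E3 R -> R) : L2 u -> (forall i, L2 (g i)) ->
  (forall i, weakd i u (g i)) ->
  H1 u /\ {ae mu3 R, forall x, forall i, wgrad u i x = g i x}.
Proof.
move=> Lu Lg wg.
have h : H1 u by split => //; exists g; split => // i phi; exact: wg.
split => //.
have e i : {ae mu3 R, forall x, wgrad u i x = g i x}.
  by have [Lw ww] := H1_wgrad h i; exact: (weakd_unique Lu Lw (Lg i) ww (wg i)).
apply: (@filterS3 _ _ (ae_filter_ringOfSetsType (mu3 R)) _ _ _ _ _ 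
  (e (@Ordinal 3 0 isT)) (e (@Ordinal 3 1 isT)) (e (@Ordinal 3 2 isT))).
by move=> x e0 e1 e2; apply: ord3P.
Qed.

Definition gr2 u (x : E3 R) : R := \sum_i wgrad u i x ^+ 2.

Lemma gr2_ge0 u x : 0 <= gr2 u x.
Proof. by apply: sumr_ge0 => i _; exact: sqr_ge0. Qed.

Lemma measurable_gr2 u : H1 u -> measurable_fun [set: E3 R] (gr2 u).
Proof.
move=> h; apply: measurable_sum => i; apply: measurable_funX.
exact: L2_measurable (H1_wgrad h i).1.
Qed.

Lemma gr2_lty u : H1 u -> (\int[mu3 R]_x (gr2 u x)%:E < +oo)%E.
Proof.
move=> h; under eq_integral do rewrite -sumEFin.
rewrite ge0_integral_sum//.
- apply: lte_sum_pinfty => i _.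
  by have /L2P[] := (H1_wgrad h i).1.
- move=> i; apply/measurable_EFinP; apply: measurable_funX.
  exact: L2_measurable (H1_wgrad h i).1.
- by move=> i x _; rewrite lee_fin sqr_ge0.
Qed.

Lemma weakd_translate i u g (a : R3 R) : L2 u -> L2 g -> weakd i u g ->
  weakd i (fun x => u (x - a)) (fun x => g (x - a)).
Proof.
move=> Lu Lg wg phi tphi.
have tp := test_function_shift a tphi.
have [Lphi Ldphi] := L2_test tphi.
have mphi := L2_measurable Lphi; have mdphi := L2_measurable (Ldphi i).
have mus := L2_measurable (L2_shift (- a) Lu).
have mgs := L2_measurable (L2_shift (- a) Lg).
rewrite -(integral_shift a (f := fun x => (u (x - a) * partial i phi x)%:E)); last first.
  by apply/measurable_EFinP; exact: measurable_funM.
rewrite -(integral_shift a (f := fun x => (g (x - a) * phi x)%:E)); last first.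
  by apply/measurable_EFinP; exact: measurable_funM.
under eq_integral do rewrite addrK /partial -derive_shift_fun.
under [in RHS]eq_integral do rewrite addrK.
exact: wg.
Qed.

Lemma H1_shift u (a : R3 R) : H1 u -> H1 (fun x => u (x - a)) /\
  {ae mu3 R, forall x, gr2 (fun x => u (x - a)) x = gr2 u ((x : R3 R) - a)}.
Proof.
move=> h; have Lu := h.1.
have [|||h' e] := @H1_intro (fun x => u (x - a)) (fun i x => wgrad u i (x - a)).
- exact: (L2_shift (- a)).
- by move=> i; apply: (L2_shift (- a)); exact: (H1_wgrad h i).1.
- by move=> i; have [? ?] := H1_wgrad h i; exact: weakd_translate.
split => //; apply: (@filterS _ _ (ae_filter_ringOfSetsType (mu3 R))) e => x e.
by rewrite /gr2; apply: eq_bigr => i _; rewrite e.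
Qed.

(** The gradient is (u grad u + v grad v) / sqrt (u^2 + v^2), and Cauchy-Schwarz applies in each
    direction. Where both functions vanish the formula gives 0 by the convention on division. *)
Lemma H1_hypot u v : H1 u -> H1 v -> H1 (fun x => root 0 (u x) (v x)) /\
  {ae mu3 R, forall x, gr2 (fun x => root 0 (u x) (v x)) x <= gr2 u x + gr2 v x}.
Proof.
move=> hu hv.
pose g i x := u x / root 0 (u x) (v x) * wgrad u i x + v x / root 0 (u x) (v x) * wgrad v i x.
have W i := weakd_hypot hu.1 (H1_wgrad hu i).1 hv.1 (H1_wgrad hv i).1
  (H1_wgrad hu i).2 (H1_wgrad hv i).2.
have [|||h e] := @H1_intro (fun x => root 0 (u x) (v x)) g.
- by have [] := W 0.
- by move=> i; have [] := W i.
- by move=> i; have [] := W i.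
split => //; apply: (@filterS _ _ (ae_filter_ringOfSetsType (mu3 R))) e => x e.
rewrite /gr2 -big_split; apply: ler_sum => i _; rewrite e /g.
set a := u x; set b := v x; set p := wgrad u i x; set q := wgrad v i x.
have [r0|r0] := eqVneq (root 0 a b) 0.
  by rewrite r0 invr0 !mulr0 !mul0r addr0 expr0n addr_ge0// sqr_ge0.
have E := root_sqr 0 a b; rewrite expr0n add0r in E.
have -> : a / root 0 a b * p + b / root 0 a b * q = (a * p + b * q) / root 0 a b.
  by ring.
rewrite expr_div_n ler_pdivrMr ?exprn_even_gt0//= E.
rewrite -subr_ge0.
have -> : (p ^+ 2 + q ^+ 2) * (a ^+ 2 + b ^+ 2) - (a * p + b * q) ^+ 2 =
  (a * q - b * p) ^+ 2 by ring.
exact: sqr_ge0.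
Qed.

End h1.

(** * The Newtonian kernel *)

Section euclidean.
Variable R : realType.
Implicit Types (x y : R3 R).

Lemma enorm_ge0 x : 0 <= enorm x. Proof. exact: sqrtr_ge0. Qed.

Lemma enorm_sqr x : enorm x ^+ 2 = x.1.1 ^+ 2 + x.1.2 ^+ 2 + x.2 ^+ 2.
Proof. by rewrite sqr_sqrtr// !addr_ge0// sqr_ge0. Qed.

Lemma enormN x : enorm (- x) = enorm x.
Proof. by rewrite /enorm/= !sqrrN. Qed.

Lemma enorm_distC x y : enorm (x - y) = enorm (y - x).
Proof. by rewrite -enormN opprB. Qed.

Lemma enorm0 : enorm (0 : R3 R) = 0.
Proof. by rewrite /enorm/= expr0n/= !addr0 sqrtr0. Qed.

Lemma enorm_eq0 x : enorm x = 0 -> x = 0.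
Proof.
move=> x0; have := enorm_sqr x; rewrite x0 expr0n/=.
have := sqr_ge0 x.1.1; have := sqr_ge0 x.1.2; have := sqr_ge0 x.2.
move=> h3 h2 h1 e.
have e1 : x.1.1 ^+ 2 = 0 by lra.
have e2 : x.1.2 ^+ 2 = 0 by lra.
have e3 : x.2 ^+ 2 = 0 by lra.
move: x e1 e2 e3 {x0 h1 h2 h3 e} => [[a b] c] /=.
by move=> /eqP; rewrite sqrf_eq0 => /eqP-> /eqP; rewrite sqrf_eq0 => /eqP-> /eqP;
  rewrite sqrf_eq0 => /eqP->.
Qed.

Lemma enormD x y : enorm (x + y) <= enorm x + enorm y.
Proof.
rewrite -(@ler_pXn2r _ 2)// ?nnegrE ?addr_ge0 ?enorm_ge0//.
rewrite sqrrD !enorm_sqr/=.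
set a := x.1.1; set b := x.1.2; set c := x.2.
set a' := y.1.1; set b' := y.1.2; set c' := y.2.
suff : a * a' + b * b' + c * c' <= enorm x * enorm y by rewrite mulr2n; nra.
have [le0|gt0] := leP (a * a' + b * b' + c * c') 0.
  by rewrite (le_trans le0)// mulr_ge0// enorm_ge0.
rewrite -(@ler_pXn2r _ 2)// ?nnegrE ?mulr_ge0 ?enorm_ge0 ?(ltW gt0)//.
rewrite exprMn !enorm_sqr -/a -/b -/c -/a' -/b' -/c' -subr_ge0.
have -> : (a ^+ 2 + b ^+ 2 + c ^+ 2) * (a' ^+ 2 + b' ^+ 2 + c' ^+ 2) -
   (a * a' + b * b' + c * c') ^+ 2 =
   (a * b' - b * a') ^+ 2 + (a * c' - c * a') ^+ 2 + (b * c' - c * b') ^+ 2 by ring.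
by rewrite !addr_ge0// sqr_ge0.
Qed.

Lemma enorm_coord x : [/\ `|x.1.1| <= enorm x, `|x.1.2| <= enorm x & `|x.2| <= enorm x].
Proof.
have := sqr_ge0 x.1.1; have := sqr_ge0 x.1.2; have := sqr_ge0 x.2 => h3 h2 h1.
by split; rewrite -sqrtr_sqr ler_wsqrtr//; lra.
Qed.

Lemma enorm_le x : enorm x <= `|x.1.1| + `|x.1.2| + `|x.2|.
Proof.
have h1 := normr_ge0 x.1.1; have h2 := normr_ge0 x.1.2; have h3 := normr_ge0 x.2.
rewrite -(@ler_pXn2r _ 2)// ?nnegrE ?addr_ge0 ?enorm_ge0//.
rewrite enorm_sqr -(real_normK (num_real x.1.1)) -(real_normK (num_real x.1.2))
  -(real_normK (num_real x.2)).
by nra.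
Qed.

Lemma measurable_enorm : measurable_fun [set: E3 R] (@enorm R).
Proof.
rewrite /enorm; apply: measurableT_comp.
  exact: continuous_measurable_fun (@sqrt_continuous R).
apply: measurable_funD; last by apply: measurable_funX; exact: measurable_coord2.
apply: measurable_funD; apply: measurable_funX; [exact: measurable_coord11|].
exact: measurable_coord12.
Qed.

Lemma measurable_inv_ge0 d (T : measurableType d) (f : T -> R) : (forall t, 0 <= f t) ->
  measurable_fun setT f -> measurable_fun setT (fun t => (f t)^-1).
Proof.
move=> f0 mf.
have mpow : measurable_fun [set: R] (fun y : R => y `^ (-1)) by exact: measurable_powR.
have := measurableT_comp mpow mf.
by congr measurable_fun; apply/funext => x /=; rewrite powR_inv1.
Qed.

Definition ball3 (S : R) : set (E3 R) := [set x | enorm x <= S].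

Lemma measurable_ball3 S : measurable (ball3 S).
Proof.
have := measurable_enorm measurableT (measurable_itv `]-oo, S]%R).
by rewrite setTI.
Qed.

Lemma mu3_ocbox (a b : R) : a < b ->
  mu3 R (ocbox (fun=> a) (fun=> b)) = ((b - a) ^+ 3)%:E.
Proof.
move=> ab; rewrite ocboxE; set I := `]a, b]%classic.
have mI : measurable (I : set (measurableTypeR R)) by exact: measurable_itv.
have -> : mu3 R (I `*` I `*` I) =
    (lebesgue_measure I * lebesgue_measure I * lebesgue_measure I)%E.
  rewrite -(product_measure1E lebesgue_measure lebesgue_measure mI mI).
  by rewrite -product_measure1E//; exact: measurableX.
rewrite lebesgue_measure_itv/= lte_fin ab -EFinB -!EFinM. congr EFin; ring.
Qed.

Lemma mu3_point (w : R3 R) : mu3 R [set w] = 0%E.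
Proof.
have m1 (t : R) : measurable ([set t] : set (measurableTypeR R)) by [].
have -> : [set w] = [set w.1.1] `*` [set w.1.2] `*` [set w.2] :> set (E3 R).
  apply/seteqP; split => [x -> //|[[x y] z]] /=.
  by case: w => [[p q] s] /= [[-> ->] ->].
have -> : mu3 R ([set w.1.1] `*` [set w.1.2] `*` [set w.2]) =
    (lebesgue_measure [set w.1.1] * lebesgue_measure [set w.1.2] * lebesgue_measure [set w.2])%E.
  rewrite -(product_measure1E lebesgue_measure lebesgue_measure (m1 _) (m1 _)).
  by rewrite -product_measure1E//; exact: measurableX.
by rewrite !lebesgue_measure_set1 mule0.
Qed.

Lemma ae_neq (w : R3 R) : {ae mu3 R, forall x : E3 R, x != w}.
Proof.
exists [set w]; split; [|exact: mu3_point|].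
  rewrite -[X in measurable X](_ : [set w.1.1] `*` [set w.1.2] `*` [set w.2] = _).
    by apply: measurableX => //; exact: measurableX.
  apply/seteqP; split => [[[x y] z] /=|x -> //].
  by case: w => [[p q] s] /= [[-> ->] ->].
by move=> x /= /negP; rewrite negbK => /eqP.
Qed.

Lemma mu3_ball3_lty S : (mu3 R (ball3 S) < +oo)%E.
Proof.
have [S0|S0] := leP S 0.
  apply: (@le_lt_trans _ _ (mu3 R [set 0])); last by rewrite mu3_point ltry.
  apply: le_measure; rewrite ?inE; [exact: measurable_ball3| |].
    rewrite -[X in measurable X](_ : [set 0] `*` [set 0] `*` [set 0] = _).
      by apply: measurableX => //; exact: measurableX.
    by apply/seteqP; split => [[[x y] z] /= [[-> ->] ->]//|x -> //].
  move=> x xS; apply: enorm_eq0; apply/eqP.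
  by rewrite eq_le enorm_ge0 andbT; exact: le_trans xS S0.
apply: (@le_lt_trans _ _ (mu3 R (ocbox (fun=> - (2 * S)) (fun=> S)))).
  apply: le_measure; rewrite ?inE; [exact: measurable_ball3|exact: measurable_ocbox|].
  move=> x xS; have [] := enorm_coord x; rewrite !ler_norml.
  by rewrite /ball3/= in xS => /andP[? ?] /andP[? ?] /andP[? ?]; split; apply/andP; split; lra.
by rewrite mu3_ocbox ?ltry//; lra.
Qed.

Lemma mu3_ball3_le S : 0 < S -> (mu3 R (ball3 S) <= (27 * S ^+ 3)%:E)%E.
Proof.
move=> S0.
(* The half-open box lacks its lower faces, so the lower corner is moved beyond - S; the side 3 S
   gives the factor 27. *)
apply: (@le_trans _ _ (mu3 R (ocbox (fun=> - (2 * S)) (fun=> S)))).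
  apply: le_measure; rewrite ?inE; [exact: measurable_ball3|exact: measurable_ocbox|].
  move=> x xS; have [] := enorm_coord x; rewrite !ler_norml.
  by rewrite /ball3/= in xS => /andP[? ?] /andP[? ?] /andP[? ?]; split; apply/andP; split; lra.
rewrite mu3_ocbox; last by lra.
rewrite lee_fin le_eqVlt; apply/orP; left; apply/eqP; ring.
Qed.

End euclidean.

Section newton_kernel.
Variable R : realType.
Implicit Types (x y w : R3 R).

(** The exponents of |t|^(10/3) and t^2 have ratio 5/3, whose conjugate is 5/2; this is less than 3,
    so that power of the kernel is integrable near the pole. *)
Definition newton52 (x : E3 R) : R := (enorm x)^-1 `^ (5 / 2) * \1_(ball3 1) x.

Lemma newton52_ge0 x : 0 <= newton52 x.
Proof. by rewrite mulr_ge0// powR_ge0. Qed.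

Lemma measurable_newton52 : measurable_fun [set: E3 R] newton52.
Proof.
apply: measurable_funM; last by apply: measurable_indic; exact: measurable_ball3.
have mpow : measurable_fun [set: R] (fun y : R => y `^ (5 / 2)) by exact: measurable_powR.
apply: (measurableT_comp mpow).
by apply: measurable_inv_ge0; [exact: enorm_ge0|exact: measurable_enorm].
Qed.

Lemma newton52_lty : (\int[mu3 R]_x (newton52 x)%:E < +oo)%E.
Proof.
(* Domination by a series replaces polar coordinates. On the shell from 4^-(n+1) to 4^-n the kernel
   is at most 4^(5(n+1)/2) = 32^(n+1), an integer thanks to the base 4, while the ball has volume at
   most 27 * 64^-n; the products decay like 2^-n. *)
pose q (n : nat) : R := 4^-1 ^+ n.
pose f (n : nat) (x : E3 R) : \bar R := (32 ^+ n.+1 * \1_(ball3 (q n)) x)%:E.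
have q0 n : 0 < q n by rewrite exprn_gt0// invr_gt0.
have f0 n x : (0 <= f n x)%E by rewrite lee_fin mulr_ge0// exprn_ge0.
have mf n : measurable_fun [set: E3 R] (f n).
  apply/measurable_EFinP; apply: measurable_funM => //; apply: measurable_indic.
  exact: measurable_ball3.
have ser0 x : (0 <= \sum_(n <oo) f n x)%E by apply: nneseries_ge0 => n _ _; exact: f0.
have ser_ge x n : (f n x <= \sum_(n <oo) f n x)%E.
  have := @nneseries_lim_ge R (f ^~ x) xpredT 0 n.+1 (fun n _ _ => f0 n x).
  by apply: le_trans; rewrite big_nat_recr//= leeDr// sume_ge0.
have mser : measurable_fun [set: E3 R] (fun x => \sum_(n <oo) f n x)%E.
  by apply: ge0_emeasurable_sum => n *; [exact: f0|exact: mf].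
apply: (@le_lt_trans _ _ (\int[mu3 R]_x \sum_(n <oo) f n x)%E).
  apply: ge0_le_integral => //.
  - by move=> x _; rewrite lee_fin newton52_ge0.
  - by apply/measurable_EFinP; exact: measurable_newton52.
  move=> x _; have [->|x0] := eqVneq x 0.
    rewrite /newton52 enorm0 invr0 powR0 ?mul0r; last by rewrite gt_eqF.
    by exact: ser0.
  have e0 : 0 < enorm x.
    by rewrite lt_def enorm_ge0 andbT; apply: contra x0 => /eqP/enorm_eq0->.
  rewrite /newton52 indicE; case: (boolP (x \in _)) => [|_]; last first.
    by rewrite mulr0; exact: ser0.
  rewrite inE mulr1 => x1.
  have ex : exists n, q n <= enorm x.
    exists (Num.truncn (enorm x)^-1).+1.
    rewrite /q exprVn -[leRHS]invrK lef_pV2 ?posrE ?invr_gt0 ?exprn_gt0//.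
    apply: le_trans (ltW (truncnS_gt _)) _.
    set m := (Num.truncn _).+1; rewrite -natrX ler_nat.
    by rewrite ltnW// ltn_expl.
  case: (ex_minnP ex) => -[|m] qm minm.
    have x1' : enorm x = 1 by apply/eqP; rewrite eq_le x1 /=; exact: qm.
    have xq : x \in ball3 (q 0%N) by rewrite inE /ball3/= x1' /q expr0.
    rewrite x1' invr1 powR1; apply: le_trans (ser_ge x 0%N).
    by rewrite lee_fin indicE xq mulr1 expr1 ler1n.
  have xm : enorm x < q m.
    by rewrite ltNge; apply/negP => /minm; rewrite ltnn.
  have xq : x \in ball3 (q m) by rewrite inE /ball3/= ltW.
  apply: le_trans (ser_ge x m); rewrite lee_fin indicE xq mulr1.
  have h4 : (enorm x)^-1 <= 4 ^+ m.+1.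
    rewrite -[leRHS]invrK lef_pV2 ?posrE ?invr_gt0 ?exprn_gt0// -exprVn; exact: qm.
  apply: (@le_trans _ _ ((4 ^+ m.+1) `^ (5 / 2))).
    apply: ge0_ler_powR => //; first by rewrite nnegrE invr_ge0 ltW.
    by rewrite nnegrE exprn_ge0.
  have -> : (4 : R) = 2 ^+ 2 by rewrite -natrX.
  rewrite -exprM -powR_mulrn// -powRrM.
  have -> : (2 * m.+1)%:R * (5 / 2) = (5 * m.+1)%:R :> R by rewrite !natrM; field.
  by rewrite powR_mulrn// exprM -natrX.
rewrite integral_nneseries//.
apply: (@le_lt_trans _ _ (\sum_(n <oo) ((27 * 32 * 2) / (2 ^ n.+1)%:R)%:E)%E).
  apply: lee_nneseries => [n _ _|n _]; first exact: integral_ge0.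
  rewrite /f; under eq_integral do rewrite EFinM.
  rewrite ge0_integralZl//; last first.
    by apply/measurable_EFinP; apply: measurable_indic; exact: measurable_ball3.
  rewrite integral_indic//; last exact: measurable_ball3.
  rewrite setIT; apply: (@le_trans _ _ ((32 ^+ n.+1)%:E * (27 * q n ^+ 3)%:E)%E).
    by apply: lee_wpmul2l; [rewrite lee_fin exprn_ge0|exact: mu3_ball3_le].
  rewrite -EFinM lee_fin le_eqVlt; apply/orP; left; apply/eqP.
  rewrite natrX !(exprS _ n) invfM /q -exprM mulnC exprM.

  have -> : 32 * 32 ^+ n * (27 * (4^-1 ^+ 3) ^+ n) = 27 * 32 * (32 * 4^-1 ^+ 3) ^+ n :> R.
    by rewrite [in RHS]exprMn; move: (32 ^+ n) ((4^-1 ^+ 3) ^+ n) => a b; ring.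
  have -> : 32 * 4^-1 ^+ 3 = 2^-1 :> R by field.
  by rewrite exprVn; field; rewrite expf_neq0.
by apply: le_lt_trans (epsilon_trick0 _ _) _ => //; rewrite ltry.
Qed.

End newton_kernel.

(** * Integrals of the Newtonian kernel over balls *)

Section ball_average.
Variable R : realType.
Implicit Types (x y w : R3 R) (S L : R).
Local Open Scope ereal_scope.

(** Not divided by the volume of the ball, despite the name; only comparisons over the same ball are
    made. *)
Definition newton_avg S (w : R3 R) : \bar R :=
  \int[mu3 R]_x ((enorm ((x : R3 R) - w)%R)^-1 * \1_(ball3 S) x)%:E.

Lemma measurable_newton (w : R3 R) :
  measurable_fun [set: E3 R] (fun x : E3 R => (enorm ((x : R3 R) - w))^-1%R).
Proof.
apply: measurable_inv_ge0; first by move=> x; exact: enorm_ge0.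
exact: (measurable_shift_comp (- w)%R (@measurable_enorm R)).
Qed.

Lemma measurable_indic_ball3 S : measurable_fun [set: E3 R] (\1_(ball3 S) : E3 R -> R).
Proof. by apply: measurable_indic; exact: measurable_ball3. Qed.

Lemma measurable_newton_ball S (w : R3 R) : measurable_fun [set: E3 R]
  (fun x : E3 R => ((enorm ((x : R3 R) - w)%R)^-1 * \1_(ball3 S) x)%:E).
Proof.
apply/measurable_EFinP; apply: measurable_funM; first exact: measurable_newton.
exact: measurable_indic_ball3.
Qed.

Lemma newton_ge0 (w : R3 R) : (0 <= (enorm w)^-1)%R.
Proof. by rewrite invr_ge0 enorm_ge0. Qed.

Lemma newton_ball_ge0 S w x : 0 <= ((enorm (x - w))^-1 * \1_(ball3 S) x)%:E.
Proof. by rewrite lee_fin mulr_ge0// newton_ge0. Qed.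

Lemma newton_avg_ge0 S w : 0 <= newton_avg S w.
Proof. by apply: integral_ge0 => x _; exact: newton_ball_ge0. Qed.

Lemma integral_indic_ball3 S (c : R) : (0 <= c)%R ->
  \int[mu3 R]_x (c * \1_(ball3 S) x)%:E = c%:E * mu3 R (ball3 S).
Proof.
move=> c0; under eq_integral do rewrite EFinM.
rewrite ge0_integralZl//; last by apply/measurable_EFinP; exact: measurable_indic_ball3.
by rewrite integral_indic//; [rewrite setIT|exact: measurable_ball3].
Qed.

Lemma newton_le52 (x : E3 R) : ((enorm x)^-1 <= newton52 x + 1)%R.
Proof.
have [->|x0] := eqVneq x 0%R.
  by rewrite enorm0 invr0 addr_ge0// newton52_ge0.
have e0 : (0 < enorm x)%R.
  by rewrite lt_def enorm_ge0 andbT; apply: contra x0 => /eqP/enorm_eq0->.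
have [x1|x1] := leP (enorm x) 1%R; last first.
  apply: (@le_trans _ _ 1%R); first by rewrite invf_le1// ltW.
  by rewrite lerDr newton52_ge0.
rewrite /newton52 indicE mem_set// mulr1.
apply: (@le_trans _ _ ((enorm x)^-1 `^ (5 / 2))%R); last by rewrite lerDl.
rewrite -[leLHS]powRr1 ?invr_ge0 ?enorm_ge0//; apply: ler_powR; last by lra.
by rewrite invf_ge1.
Qed.

Lemma newton_avg0_lty S : newton_avg S 0%R < +oo.
Proof.
apply: (@le_lt_trans _ _ (\int[mu3 R]_x ((newton52 x)%:E + (1 * \1_(ball3 S) x)%:E))).
  apply: ge0_le_integral => //.
  - by move=> x _; exact: newton_ball_ge0.
  - exact: measurable_newton_ball.
  - apply: emeasurable_funD; apply/measurable_EFinP; first exact: measurable_newton52.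
    by apply: measurable_funM => //; exact: measurable_indic_ball3.
  move=> x _; rewrite -EFinD lee_fin subr0 mul1r indicE; case: (x \in _).
    by rewrite mulr1; exact: newton_le52.
  by rewrite mulr0 addr0 newton52_ge0.
rewrite ge0_integralD//.
- rewrite integral_indic_ball3// mul1e lte_add_pinfty//; first exact: newton52_lty.
  exact: mu3_ball3_lty.
- by move=> x _; rewrite lee_fin newton52_ge0.
- by apply/measurable_EFinP; exact: measurable_newton52.
- by apply/measurable_EFinP; apply: measurable_funM => //; exact: measurable_indic_ball3.
Qed.

(* The part of the kernel above the level [S^-1] is supported in the ball, so
   the integral over a ball is largest when the ball is centred at the pole. *)
Lemma newton_avg_le S w : (0 < S)%R -> newton_avg S w <= newton_avg S 0%R.
Proof.
move=> S0.
pose h (x : E3 R) : R := (Num.max 0 ((enorm x)^-1 - S^-1))%R.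
have h0 x : (0 <= h x)%R by rewrite le_max lexx.
have mh : measurable_fun [set: E3 R] h.
  apply: measurable_maxr => //; apply: measurable_funB => //.
  by apply: measurable_inv_ge0; [exact: enorm_ge0|exact: measurable_enorm].
have mhw : measurable_fun [set: E3 R] (fun x : E3 R => (h ((x : R3 R) - w)%R)%:E).
  by apply/measurable_EFinP; exact: (measurable_shift_comp (- w)%R mh).
have mhE : measurable_fun [set: E3 R] (EFin \o h) by exact/measurable_EFinP.
have mI : measurable_fun [set: E3 R] (fun x : E3 R => (S^-1 * \1_(ball3 S) x)%:E).
  by apply/measurable_EFinP; apply: measurable_funM => //; exact: measurable_indic_ball3.
have I0 x : 0 <= (S^-1 * \1_(ball3 S) x)%:E by rewrite lee_fin mulr_ge0// invr_ge0 ltW.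
apply: (@le_trans _ _ (\int[mu3 R]_x ((S^-1 * \1_(ball3 S) x)%:E + (h ((x : R3 R) - w)%R)%:E))).
  apply: ge0_le_integral => //.
  - by move=> x _; exact: newton_ball_ge0.
  - exact: measurable_newton_ball.
  - exact: emeasurable_funD.
  move=> x _; rewrite -EFinD lee_fin indicE; case: (x \in _).
    by rewrite !mulr1 -lerBlDl le_max lexx orbT.
  by rewrite !mulr0 add0r.
rewrite ge0_integralD//; last by move=> x _; rewrite lee_fin.
rewrite (integral_shift (- w)%R (f := EFin \o h))// -ge0_integralD//; last first.
  by move=> x _; rewrite lee_fin.
rewrite le_eqVlt; apply/orP; left; apply/eqP.
apply: ge0_ae_eq_integral => //.
- exact: emeasurable_funD.
- exact: measurable_newton_ball.
- by move=> x _; apply: adde_ge0; [exact: I0|rewrite /= lee_fin].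
- by move=> x _; exact: newton_ball_ge0.
apply: (@filterS _ _ (ae_filter_ringOfSetsType (mu3 R)) _ _ _ (ae_neq 0%R)) => x x0 _.
have e0 : (0 < enorm x)%R.
  by rewrite lt_def enorm_ge0 andbT; apply: contra x0 => /eqP/enorm_eq0->.
rewrite /= -EFinD subr0 indicE; congr EFin; rewrite /h.
case: (boolP (x \in _)) => [|/negP nx].
  rewrite inE /ball3/= => xS; rewrite !mulr1 max_r ?subrKC// subr_ge0.
  by rewrite lef_pV2 ?posrE.
rewrite !mulr0 add0r max_l// subr_le0 lef_pV2 ?posrE// ltW// ltNge.
by apply/negP => xS; apply: nx; rewrite inE.
Qed.

(** Outside the ball of radius L one has |x - w| <= (1 + |w| / L) |x|; the first term pays for the
    inside. With L large and then S larger still, the position of the pole becomes irrelevant. The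
    point x = w is excluded because the inverse is 0 there by convention. *)
Lemma newton_avg_ge S L w : (0 < L)%R ->
  newton_avg S 0%R <= newton_avg L 0%R + (1 + enorm w / L)%:E * newton_avg S w.
Proof.
move=> L0; have c0 : (0 <= 1 + enorm w / L)%R.
  by rewrite addr_ge0// divr_ge0 ?enorm_ge0// ltW.
rewrite /newton_avg -ge0_integralZl//; last 2 first.
- exact: measurable_newton_ball.
- by move=> x _; exact: newton_ball_ge0.
rewrite -ge0_integralD//; last 4 first.
- by move=> x _; exact: newton_ball_ge0.
- exact: measurable_newton_ball.
- by move=> x _; apply: mule_ge0; [rewrite lee_fin|exact: newton_ball_ge0].
- by apply: measurable_funeM; exact: measurable_newton_ball.
apply: ae_ge0_le_integral => //.
- by move=> x _; exact: newton_ball_ge0.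
- exact: measurable_newton_ball.
- move=> x _; apply: adde_ge0; first exact: newton_ball_ge0.
  by apply: mule_ge0; [rewrite lee_fin|exact: newton_ball_ge0].
- apply: emeasurable_funD; first exact: measurable_newton_ball.
  by apply: measurable_funeM; exact: measurable_newton_ball.
apply: (@filterS _ _ (ae_filter_ringOfSetsType (mu3 R)) _ _ _ (ae_neq w)) => x xw _.
rewrite -EFinM -EFinD lee_fin subr0 [in leLHS]indicE [X in (_ + _ * (_ * X))%R]indicE.
case: (x \in ball3 S); last first.
  by rewrite !mulr0 addr0 mulr_ge0// newton_ge0.
rewrite !mulr1 indicE; case: (boolP (x \in ball3 L)) => [_|/negP nx].
  by rewrite mulr1 lerDl mulr_ge0// newton_ge0.
have xL : (L < enorm x)%R.
  by rewrite ltNge; apply/negP => h; apply: nx; rewrite inE.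
have x0 := lt_trans L0 xL.
have e0 : (0 < enorm (x - w))%R.
  rewrite lt_def enorm_ge0 andbT; apply: contra xw => /eqP/enorm_eq0/eqP.
  by rewrite subr_eq0.
rewrite mulr0 add0r ler_pdivlMr// mulrC ler_pdivrMr//.
apply: (le_trans (enormD _ _)); rewrite enormN mulrDl mul1r lerD2l.
by rewrite mulrAC ler_pdivlMr// ler_wpM2l ?enorm_ge0// ltW.
Qed.

(** Splitting at radius L shows that, relative to the volume of the ball, the integral becomes
    arbitrarily small as S grows. *)
Lemma newton_avg_small S L : (0 < L)%R ->
  newton_avg S 0%R <= newton_avg L 0%R + (L^-1)%:E * mu3 R (ball3 S).
Proof.
move=> L0; have L1 : (0 <= L^-1)%R by rewrite invr_ge0 ltW.
have mI : measurable_fun [set: E3 R] (fun x : E3 R => (L^-1 * \1_(ball3 S) x)%:E).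
  by apply/measurable_EFinP; apply: measurable_funM => //; exact: measurable_indic_ball3.
rewrite -integral_indic_ball3// -ge0_integralD//; last 3 first.
- by move=> x _; exact: newton_ball_ge0.
- exact: measurable_newton_ball.
- by move=> x _; rewrite lee_fin mulr_ge0.
apply: ge0_le_integral => //.
- by move=> x _; exact: newton_ball_ge0.
- exact: measurable_newton_ball.
- by apply: emeasurable_funD => //; exact: measurable_newton_ball.
move=> x _; rewrite -EFinD lee_fin subr0 [in leLHS]indicE [X in (_ + _ * X)%R]indicE.
case: (x \in ball3 S); last by rewrite !mulr0 addr0 mulr_ge0// newton_ge0.
rewrite !mulr1 indicE; case: (boolP (x \in ball3 L)) => [_|/negP nx].
  by rewrite mulr1 lerDl.
have xL : (L < enorm x)%R.
  by rewrite ltNge; apply/negP => h; apply: nx; rewrite inE.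
by rewrite mulr0 add0r lef_pV2 ?posrE// ?ltW// (lt_trans L0).
Qed.

Lemma sub_box_ball3 S : ocbox (fun=> 0%R) (fun=> S / 3)%R `<=` ball3 S.
Proof.
move=> x [] /andP[a1 a2] /andP[b1 b2] /andP[c1 c2].
apply: (le_trans (enorm_le x)); rewrite !gtr0_norm//; lra.
Qed.

Lemma mu3_ball3_ge S : (0 < S)%R -> ((S / 3) ^+ 3)%:E <= mu3 R (ball3 S).
Proof.
move=> S0; rewrite -[X in (X ^+ 3)%R]subr0 -mu3_ocbox; last by rewrite divr_gt0.
apply: le_measure; rewrite ?inE; [exact: measurable_ocbox|exact: measurable_ball3|].
exact: sub_box_ball3.
Qed.

(** The kernel is at least 1/S on a box of side S/3 in the ball. The constant is irrelevant:
    unboundedness in S is what lets the Coulomb terms outweigh the overlap. *)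
Lemma newton_avg_large S : (0 < S)%R -> (S ^+ 2 / 27)%:E <= newton_avg S 0%R.
Proof.
move=> S0.
have -> : (S ^+ 2 / 27 = S^-1 * (S / 3 - 0) ^+ 3)%R.
  by field; rewrite gt_eqF.
rewrite EFinM -mu3_ocbox; last by rewrite divr_gt0.
set B := ocbox _ _; have mB : measurable B by exact: measurable_ocbox.
have S1 : (0 <= S^-1)%R by rewrite invr_ge0 ltW.
have <- : \int[mu3 R]_x (S^-1 * \1_B x)%:E = (S^-1)%:E * mu3 R B.
  under eq_integral do rewrite EFinM.
  by rewrite ge0_integralZl// ?integral_indic ?setIT//; apply/measurable_EFinP; exact: measurable_indic.
apply: ge0_le_integral => //.
- by move=> x _; rewrite lee_fin mulr_ge0.
- by apply/measurable_EFinP; apply: measurable_funM => //; exact: measurable_indic.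
- exact: measurable_newton_ball.
move=> x _; rewrite lee_fin subr0 !indicE; case: (boolP (x \in B)) => [|_]; last first.
  by rewrite mulr0 mulr_ge0// newton_ge0.
rewrite inE => xB; have xS := sub_box_ball3 xB.
rewrite mem_set// !mulr1 lef_pV2 ?posrE//.
have [/andP[x1 _] _ _] := xB.
have [h _ _] := enorm_coord x.
by apply: lt_le_trans h; rewrite normr_gt0 gt_eqF.
Qed.

End ball_average.

(** * Newtonian potentials and interactions *)

Section newton_potential.
Variable R : realType.
Local Open Scope ereal_scope.
Implicit Types (a b h k : E3 R -> \bar R) (S : R).

Let fst3 : measurable_fun [set: E3 R * E3 R] (fun p : E3 R * E3 R => p.1).
Proof. exact: measurable_fst. Qed.

Let snd3 : measurable_fun [set: E3 R * E3 R] (fun p : E3 R * E3 R => p.2).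
Proof. exact: measurable_snd. Qed.

Lemma measurable_sub3 : measurable_fun [set: E3 R * E3 R]
  (fun p : E3 R * E3 R => ((p.2 : R3 R) - p.1)%R : E3 R).
Proof.
have m11 := @measurable_coord11 R; have m12 := @measurable_coord12 R.
have m2 := @measurable_coord2 R.
apply: measurable_fun_pair; first apply: measurable_fun_pair.
- by apply: measurable_funB; [exact: (measurableT_comp m11 snd3)|exact: (measurableT_comp m11 fst3)].
- by apply: measurable_funB; [exact: (measurableT_comp m12 snd3)|exact: (measurableT_comp m12 fst3)].
- by apply: measurable_funB; [exact: (measurableT_comp m2 snd3)|exact: (measurableT_comp m2 fst3)].
Qed.

Lemma measurable_sub3_comp h : measurable_fun setT h ->
  measurable_fun [set: E3 R * E3 R]
  (fun p : E3 R * E3 R => h (((p.2 : R3 R) - p.1)%R : E3 R)).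
Proof. by move=> mh; exact: (measurableT_comp mh measurable_sub3). Qed.

Definition inv3 (x : E3 R) : \bar R := ((enorm x)^-1)%:E.

Lemma inv3_ge0 x : 0 <= inv3 x. Proof. by rewrite lee_fin newton_ge0. Qed.

Lemma inv3_distC (x y : R3 R) : inv3 (x - y)%R = inv3 (y - x)%R.
Proof. by rewrite /inv3 enorm_distC. Qed.

Lemma measurable_inv3 : measurable_fun [set: E3 R] inv3.
Proof.
apply/measurable_EFinP; apply: measurable_inv_ge0; first exact: enorm_ge0.
exact: measurable_enorm.
Qed.

Definition pot b (y : E3 R) : \bar R := \int[mu3 R]_z (b z * inv3 ((y : R3 R) - z)%R).

Lemma pot_ge0 b y : (forall z, 0 <= b z) -> 0 <= pot b y.
Proof. by move=> b0; apply: integral_ge0 => z _; rewrite mule_ge0// inv3_ge0. Qed.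

Lemma measurable_pot b : measurable_fun setT b -> (forall z, 0 <= b z) ->
  measurable_fun setT (pot b).
Proof.
move=> mb b0.
pose F (p : E3 R * E3 R) := b p.2 * inv3 ((p.2 : R3 R) - p.1)%R.
have mF : measurable_fun setT F.
  apply: emeasurable_funM; first exact: (measurableT_comp mb snd3).
  exact: (measurable_sub3_comp measurable_inv3).
have := @measurable_fun_fubini_tonelli_F _ _ _ _ _ (mu3 R) F mF
  (fun p => mule_ge0 (b0 _) (inv3_ge0 _)).
congr measurable_fun; apply/funext => y; apply: eq_integral => z _.
by rewrite /F/= inv3_distC.
Qed.

Lemma tonelli_diff k a h :
  measurable_fun setT k -> measurable_fun setT a -> measurable_fun setT h ->
  (forall x, 0 <= k x) -> (forall x, 0 <= a x) -> (forall x, 0 <= h x) ->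
  \int[mu3 R]_x (k x * \int[mu3 R]_y (a y * h ((y : R3 R) - x)%R)) =
  \int[mu3 R]_y (a y * \int[mu3 R]_x (k x * h ((y : R3 R) - x)%R)).
Proof.
move=> mk ma mh k0 a0 h0.
pose F (p : E3 R * E3 R) := k p.1 * (a p.2 * h ((p.2 : R3 R) - p.1)%R).
have mF : measurable_fun setT F.
  apply: emeasurable_funM; first exact: (measurableT_comp mk fst3).
  apply: emeasurable_funM; first exact: (measurableT_comp ma snd3).
  exact: (measurable_sub3_comp mh).
have F0 p : 0 <= F p by rewrite !mule_ge0.
have e1 x : k x * \int[mu3 R]_y (a y * h ((y : R3 R) - x)%R) = \int[mu3 R]_y F (x, y).
  rewrite -ge0_integralZl//.
    apply: emeasurable_funM => //.
    exact: (measurableT_comp mh (measurable_shift (- x)%R)).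
  by move=> y _; rewrite mule_ge0.
have e2 y : a y * \int[mu3 R]_x (k x * h ((y : R3 R) - x)%R) = \int[mu3 R]_x F (x, y).
  rewrite -ge0_integralZl//.
  - by apply: eq_integral => x _; rewrite /F/= muleCA.
  - apply: emeasurable_funM => //.
    have := measurableT_comp (measurable_sub3_comp mh) (@measurable_pair2 _ _ (E3 R) (E3 R) y).
    exact.
  - by move=> x _; rewrite mule_ge0.
under eq_integral do rewrite e1; under [in RHS]eq_integral do rewrite e2.
exact: fubini_tonelli.
Qed.

Lemma measurable_diff_integral a h :
  measurable_fun setT a -> measurable_fun setT h ->
  (forall x, 0 <= a x) -> (forall x, 0 <= h x) ->
  measurable_fun [set: E3 R] (fun x => \int[mu3 R]_y (a y * h ((y : R3 R) - x)%R)).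
Proof.
move=> ma mh a0 h0.
pose F (p : E3 R * E3 R) := a p.2 * h ((p.2 : R3 R) - p.1)%R.
have mF : measurable_fun setT F.
  apply: emeasurable_funM; first exact: (measurableT_comp ma snd3).
  exact: (measurable_sub3_comp mh).
exact: (@measurable_fun_fubini_tonelli_F _ _ _ _ _ (mu3 R) F mF
  (fun p => mule_ge0 (a0 _) (h0 _))).
Qed.

(** Integrated over all translations, the overlap of two densities is the product of their masses.
    This bounds its integral over a ball independently of the radius. *)
Lemma integral_diff a h :
  measurable_fun setT a -> measurable_fun setT h ->
  (forall x, 0 <= a x) -> (forall x, 0 <= h x) ->
  \int[mu3 R]_x \int[mu3 R]_y (a y * h ((y : R3 R) - x)%R) =
  (\int[mu3 R]_y a y) * \int[mu3 R]_y h y.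
Proof.
move=> ma mh a0 h0.
have sw x : \int[mu3 R]_y (a y * h ((y : R3 R) - x)%R) =
    \int[mu3 R]_y (a ((y : R3 R) + x)%R * h y).
  rewrite -(integral_shift x (f := fun y => a y * h ((y : R3 R) - x)%R)).
    by apply: eq_integral => y _; rewrite addrK.
  apply: emeasurable_funM => //.
  exact: (measurableT_comp mh (measurable_shift (- x)%R)).
under eq_integral do rewrite sw.
pose F (p : E3 R * E3 R) := a ((p.2 : R3 R) + p.1)%R * h p.2.
have madd : measurable_fun [set: E3 R * E3 R]
    (fun p : E3 R * E3 R => ((p.2 : R3 R) + p.1)%R : E3 R).
  have m11 := @measurable_coord11 R; have m12 := @measurable_coord12 R.
  have m2 := @measurable_coord2 R.
  apply: measurable_fun_pair; first apply: measurable_fun_pair.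
  - by apply: measurable_funD; [exact: (measurableT_comp m11 snd3)|exact: (measurableT_comp m11 fst3)].
  - by apply: measurable_funD; [exact: (measurableT_comp m12 snd3)|exact: (measurableT_comp m12 fst3)].
  - by apply: measurable_funD; [exact: (measurableT_comp m2 snd3)|exact: (measurableT_comp m2 fst3)].
have mF : measurable_fun setT F.
  apply: emeasurable_funM; last exact: (measurableT_comp mh snd3).
  exact: (measurableT_comp ma madd).
have F0 p : 0 <= F p by rewrite mule_ge0.
rewrite (fubini_tonelli (m1 := mu3 R) (m2 := mu3 R) F mF F0)/=.
rewrite -ge0_integralZl//; last exact: integral_ge0.
apply: eq_integral => y _; rewrite muleC.
rewrite -(integral_shift y ma) -ge0_integralZl//; last first.
  exact: (measurableT_comp ma (measurable_shift y)).
by apply: eq_integral => x _; rewrite /F/= muleC [in LHS]addrC.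
Qed.

Definition ind3 S (x : E3 R) : \bar R := (\1_(ball3 S) x)%:E.

Lemma ind3_ge0 S x : 0 <= ind3 S x. Proof. by rewrite lee_fin. Qed.

Lemma measurable_ind3 S : measurable_fun setT (ind3 S).
Proof. apply/measurable_EFinP; exact: measurable_indic_ball3. Qed.

Lemma newton_avgE S (w : R3 R) :
  \int[mu3 R]_x (ind3 S x * inv3 (w - x)%R) = newton_avg S w.
Proof.
by apply: eq_integral => x _; rewrite inv3_distC /inv3 /ind3 -EFinM mulrC.
Qed.

Lemma measurable_rev (y : R3 R) :
  measurable_fun [set: E3 R] (fun z : E3 R => (y - (z : R3 R))%R : E3 R).
Proof. exact: (measurableT_comp measurable_sub3 (@measurable_pair2 _ _ (E3 R) (E3 R) y)). Qed.

Lemma measurable_newton_avg_rev S (y : R3 R) :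
  measurable_fun [set: E3 R] (fun z : E3 R => newton_avg S (y - (z : R3 R))%R).
Proof.
have := measurableT_comp (measurable_pot (measurable_ind3 S) (@ind3_ge0 S)) (measurable_rev y).
by congr measurable_fun; apply/funext => z /=; rewrite -newton_avgE.
Qed.

Lemma ball_integral_pot S b (y : R3 R) : measurable_fun setT b -> (forall z, 0 <= b z) ->
  \int[mu3 R]_x (ind3 S x * pot b (y - x)%R) =
  \int[mu3 R]_z (b z * newton_avg S (y - z)%R).
Proof.
move=> mb b0.
pose F (p : E3 R * E3 R) := ind3 S p.1 * (b p.2 * inv3 ((y - p.1)%R - p.2)%R).
have mF : measurable_fun setT F.
  apply: emeasurable_funM; first exact: (measurableT_comp (measurable_ind3 S) fst3).
  apply: emeasurable_funM; first exact: (measurableT_comp mb snd3).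
  have m11 := @measurable_coord11 R; have m12 := @measurable_coord12 R.
  have m2 := @measurable_coord2 R.
  apply: (measurableT_comp measurable_inv3).
  apply: measurable_fun_pair; first apply: measurable_fun_pair.
  - by apply: measurable_funB; [apply: measurable_funB => //; exact: (measurableT_comp m11 fst3)|exact: (measurableT_comp m11 snd3)].
  - by apply: measurable_funB; [apply: measurable_funB => //; exact: (measurableT_comp m12 fst3)|exact: (measurableT_comp m12 snd3)].
  - by apply: measurable_funB; [apply: measurable_funB => //; exact: (measurableT_comp m2 fst3)|exact: (measurableT_comp m2 snd3)].
have F0 p : 0 <= F p by rewrite !mule_ge0// ?ind3_ge0// inv3_ge0.
have e1 x : ind3 S x * pot b (y - (x : R3 R))%R = \int[mu3 R]_z F (x, z).
  rewrite -ge0_integralZl//; last 2 first.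
  - by move=> z _; rewrite mule_ge0// inv3_ge0.
  - exact: ind3_ge0.
  apply: emeasurable_funM => //.
  exact: (measurableT_comp measurable_inv3 (measurable_rev (y - (x : R3 R))%R)).
under eq_integral do rewrite e1.
rewrite (fubini_tonelli (m1 := mu3 R) (m2 := mu3 R) F mF F0)/=.
apply: eq_integral => z _; rewrite -newton_avgE -ge0_integralZl//.
- by apply: eq_integral => x _; rewrite /F/= muleCA; congr (_ * (_ * inv3 _)); rewrite addrAC.
- apply: emeasurable_funM; first exact: measurable_ind3.
  exact: (measurableT_comp measurable_inv3 (measurable_rev (y - (z : R3 R))%R)).
- by move=> x _; rewrite mule_ge0 ?ind3_ge0// inv3_ge0.
Qed.

Lemma ball_integral_pot_le S b (y : R3 R) : (0 < S)%R -> measurable_fun setT b ->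
  (forall z, 0 <= b z) ->
  \int[mu3 R]_x (ind3 S x * pot b (y - x)%R) <= (\int[mu3 R]_z b z) * newton_avg S 0%R.
Proof.
move=> S0 mb b0; rewrite ball_integral_pot// muleC.
rewrite -ge0_integralZl//; last exact: newton_avg_ge0.
apply: ge0_le_integral => //.
- by move=> z _; rewrite mule_ge0// newton_avg_ge0.
- by apply: emeasurable_funM => //; exact: measurable_newton_avg_rev.
- by apply: emeasurable_funM.
by move=> z _; rewrite muleC lee_pmul// ?newton_avg_ge0// newton_avg_le.
Qed.

End newton_potential.

Section convolution.
Variable R : realType.
Local Open Scope ereal_scope.

Lemma measurable_conv (k h : E3 R -> \bar R) :
  measurable_fun setT k -> measurable_fun setT h ->
  (forall x, 0 <= k x) -> (forall x, 0 <= h x) ->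
  measurable_fun [set: E3 R] (fun y => \int[mu3 R]_x (k x * h ((y : R3 R) - x)%R)).
Proof.
move=> mk mh k0 h0.
pose F (p : E3 R * E3 R) := k p.2 * h ((p.1 : R3 R) - p.2)%R.
have msub : measurable_fun [set: E3 R * E3 R]
    (fun p : E3 R * E3 R => ((p.1 : R3 R) - p.2)%R : E3 R).
  exact: (measurableT_comp (@measurable_sub3 R) (@measurable_swap _ _ (E3 R) (E3 R))).
have mF : measurable_fun setT F.
  apply: emeasurable_funM; last exact: (measurableT_comp mh msub).
  exact: (measurableT_comp mk (@measurable_snd _ _ (E3 R) (E3 R))).
exact: (@measurable_fun_fubini_tonelli_F _ _ _ _ _ (mu3 R) F mF
  (fun p => mule_ge0 (k0 _) (h0 _))).
Qed.

End convolution.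

(** * Choice of the translation by averaging *)

Section choice_of_shift.
Variable R : realType.
Local Open Scope ereal_scope.

(** For two densities, the excess energy allowed when they are superposed: a multiple of the
    overlap, bounding the local terms, and the Coulomb cross term. The latter has coefficient 1
    because the factor 1/2 of the energy meets two equal cross terms. *)
Definition interaction (C : R) (a b : E3 R -> \bar R) (x : R3 R) : \bar R :=
  C%:E * \int[mu3 R]_y (a y * b ((y : R3 R) - x)%R) +
  \int[mu3 R]_y (a y * pot b ((y : R3 R) - x)%R).

Variables (C : R) (a b : E3 R -> R) (m m' : R).
Hypotheses (C0 : (0 <= C)%R) (ma : measurable_fun setT a) (mb : measurable_fun setT b).
Hypotheses (a0 : forall x, (0 <= a x)%R) (b0 : forall x, (0 <= b x)%R).
Hypotheses (am : \int[mu3 R]_x (a x)%:E = m%:E) (bm : \int[mu3 R]_x (b x)%:E = m'%:E).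

Let A := EFin \o a.
Let B := EFin \o b.
Let mA : measurable_fun setT A. Proof. exact/measurable_EFinP. Qed.
Let mB : measurable_fun setT B. Proof. exact/measurable_EFinP. Qed.
Let A0 x : 0 <= A x. Proof. by rewrite lee_fin. Qed.
Let B0 x : 0 <= B x. Proof. by rewrite lee_fin. Qed.
Let m0 : (0 <= m)%R.
Proof. by rewrite -lee_fin -am; apply: integral_ge0 => x _; exact: A0. Qed.
Let m'0 : (0 <= m')%R.
Proof. by rewrite -lee_fin -bm; apply: integral_ge0 => x _; exact: B0. Qed.
Let avg (S : R) : R := fine (newton_avg S 0%R).
Let avgE S : newton_avg S 0%R = (avg S)%:E.
Proof. by rewrite /avg fineK// ge0_fin_numE ?newton_avg_ge0// newton_avg0_lty. Qed.
Let avg0 S : (0 <= avg S)%R. Proof. by rewrite -lee_fin -avgE newton_avg_ge0. Qed.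

Lemma interaction_ge0 x : 0 <= interaction C A B x.
Proof.
apply: adde_ge0; first apply: mule_ge0; rewrite ?lee_fin//; apply: integral_ge0 => y _;
  rewrite mule_ge0// pot_ge0//.
Qed.

Lemma measurable_interaction : measurable_fun [set: E3 R] (interaction C A B).
Proof.
apply: emeasurable_funD.
  by apply: measurable_funeM; exact: measurable_diff_integral.
by apply: measurable_diff_integral => //; [exact: measurable_pot|move=> y; exact: pot_ge0].
Qed.

Lemma ball_interaction_le (S : R) : (0 < S)%R ->
  \int[mu3 R]_x (ind3 S x * interaction C A B x) <= (C * m * m' + m * m' * avg S)%:E.
Proof.
move=> S0; rewrite /interaction.
under eq_integral => x _.
  rewrite ge0_muleDr; last 2 first.
  - by rewrite mule_ge0 ?lee_fin//; apply: integral_ge0 => y _; rewrite mule_ge0.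
  - by apply: integral_ge0 => y _; rewrite mule_ge0// pot_ge0.
  over.
have md := measurable_diff_integral mA mB A0 B0.
have mp := measurable_diff_integral mA (measurable_pot mB B0) A0 (fun y => pot_ge0 y B0).
have d0 x : 0 <= \int[mu3 R]_y (A y * B ((y : R3 R) - x)%R).
  by apply: integral_ge0 => y _; rewrite mule_ge0.
have p0 x : 0 <= \int[mu3 R]_y (A y * pot B ((y : R3 R) - x)%R).
  by apply: integral_ge0 => y _; rewrite mule_ge0// pot_ge0.
rewrite ge0_integralD//; last 4 first.
- by move=> x _; rewrite mule_ge0 ?ind3_ge0// mule_ge0// lee_fin.
- by apply: emeasurable_funM; [exact: measurable_ind3|exact: measurable_funeM].
- by move=> x _; rewrite mule_ge0 ?ind3_ge0.
- by apply: emeasurable_funM => //; exact: measurable_ind3.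
rewrite EFinD; apply: leeD.
  apply: (@le_trans _ _ (\int[mu3 R]_x (C%:E * \int[mu3 R]_y (A y * B ((y : R3 R) - x)%R)))).
    apply: ge0_le_integral => //.
    - by move=> x _; rewrite mule_ge0 ?ind3_ge0// mule_ge0// lee_fin.
    - by apply: emeasurable_funM; [exact: measurable_ind3|exact: measurable_funeM].
    - exact: measurable_funeM.
    move=> x _; rewrite -[leRHS]mul1e lee_pmul ?ind3_ge0// ?mule_ge0 ?lee_fin//.
  rewrite ge0_integralZl//.
  by rewrite integral_diff// am bm -!EFinM mulrA.
rewrite tonelli_diff//; [|exact: measurable_ind3|exact: measurable_pot|move=> y; exact: ind3_ge0|move=> y; exact: pot_ge0].
apply: (@le_trans _ _ (\int[mu3 R]_y (((m' * avg S)%:E) * A y))).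
  apply: ge0_le_integral => //.
  - move=> y _; rewrite mule_ge0//; apply: integral_ge0 => x _.
    by rewrite mule_ge0 ?ind3_ge0// pot_ge0.
  - exact: (emeasurable_funM mA (measurable_conv (measurable_ind3 S)
      (measurable_pot mB B0) (@ind3_ge0 R S) (fun y => pot_ge0 y B0))).
  - exact: measurable_funeM.
  move=> y _; rewrite muleC; apply: lee_wpmul2r => //.
  by rewrite EFinM -bm -avgE; exact: ball_integral_pot_le.
rewrite ge0_integralZl//; last by rewrite lee_fin mulr_ge0.
by rewrite am -EFinM lee_fin mulrC mulrA.
Qed.

(** A function whose integral over the ball exceeds that of the interaction must exceed the
    interaction at some point. *)
Lemma exists_lt_of_ball (S : R) (g : R3 R -> \bar R) :
  measurable_fun [set: E3 R] g -> (forall x, 0 <= g x) -> (0 < S)%R ->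
  (C * m * m' + m * m' * avg S)%:E < \int[mu3 R]_x (ind3 S x * g x) ->
  exists x, interaction C A B x < g x.
Proof.
move=> mg g0 S0 h; apply: contrapT => nx.
have := le_lt_trans (ball_interaction_le S0) h.
rewrite ltNge => /negP; apply; apply: ge0_le_integral => //.
- by move=> x _; rewrite mule_ge0 ?ind3_ge0.
- by apply: emeasurable_funM => //; exact: measurable_ind3.
- by apply: emeasurable_funM; [exact: measurable_ind3|exact: measurable_interaction].
move=> x _; apply: lee_wpmul2l; first exact: ind3_ge0.
by rewrite leNgt; apply/negP => hx; apply: nx; exists x.
Qed.

Lemma exists_shift_small (d : R) : (0 < d)%R -> exists x, interaction C A B x < d%:E.
Proof.
move=> d0; set c := (m * m')%R; have c0 : (0 <= c)%R by rewrite mulr_ge0.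
(* [L] makes c / L at most d / 2, so the part of the kernel beyond radius L uses up at most half of
   d times the volume. [K] is the volume for which the other half covers the remaining terms, and
   [S] is chosen so that (S / 3)^3 is at least [K]. *)
pose L : R := (2 * c / d + 1)%R.
have L0 : (0 < L)%R by rewrite ltr_wpDl// divr_ge0 ?mulr_ge0// ltW.
pose K : R := (2 / d * (C * c + c * avg L + 1))%R.
have K0 : (0 <= K)%R by rewrite mulr_ge0 ?divr_ge0 ?addr_ge0 ?mulr_ge0// ltW.
pose S : R := (3 * (K + 1))%R.
have S0 : (0 < S)%R by rewrite mulr_gt0// ltr_wpDl.
apply: (@exists_lt_of_ball S (fun=> d%:E)) => //.
  by move=> x; rewrite lee_fin ltW.
under eq_integral do rewrite muleC.
have dE : 0 <= d%:E by rewrite lee_fin ltW.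
rewrite ge0_integralZl//; [|exact: measurable_ind3|by move=> x _; exact: ind3_ge0].
rewrite /ind3 integral_indic//; last exact: measurable_ball3.
pose s := fine (mu3 R (ball3 S)).
have sE : mu3 R (ball3 S) = s%:E by rewrite fineK// ge0_fin_numE// mu3_ball3_lty.
rewrite setIT [X in _ < _ * X]sE.
have h1 := newton_avg_small S L0; rewrite !avgE sE -EFinM -EFinD lee_fin in h1.
have h2 := mu3_ball3_ge S0; rewrite sE lee_fin in h2.
rewrite -EFinM lte_fin.
have sK : (K <= s)%R.
  apply: le_trans h2; rewrite /S mulrAC divff// mul1r.
  have : (K + 1 <= (K + 1) ^+ 3)%R by rewrite ler_eXnr// lerDr.
  by lra.
have h3 : (c * avg S <= c * avg L + d / 2 * s)%R.
  apply: (le_trans (ler_wpM2l c0 h1)); rewrite mulrDr lerD2l mulrA.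
  apply: ler_wpM2r; first by apply: le_trans sK.
  rewrite ler_pdivrMr// /L mulrDr mulr1.
  have -> : (d / 2 * (2 * c / d) = c)%R by field; rewrite gt_eqF.
  by rewrite lerDl divr_ge0// ltW.
have h4 : (C * c + c * avg L + 1 <= d / 2 * s)%R.
  have := sK; rewrite /K -ler_pdivlMl ?divr_gt0// invf_div.
  by [].
rewrite -mulrA -/c; lra.
Qed.

Lemma exists_radius (t : R) : (t < m')%R -> exists2 r : R, (0 < r)%R &
  (t%:E < \int[mu3 R]_z (B z * ind3 r z)).
Proof.
move=> tm.
have ib : (mu3 R).-integrable setT B.
  apply/integrableP; split => //.
  under eq_integral do rewrite gee0_abs//.
  by rewrite bm ltry.
have cb (x : E3 R) : (b x * \1_(ball3 n%:R) x)%R @[n --> \oo] --> b x.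
  apply: cvg_near_cst; near=> n.
  rewrite indicE mem_set ?mulr1//.
  near: n; exact: nbhs_infty_ger.
have mfn n : measurable_fun [set: E3 R] (fun x => b x * \1_(ball3 n%:R) x)%R.
  by apply: measurable_funM => //; exact: measurable_indic_ball3.
have bnd n (x : E3 R) : (`|b x * \1_(ball3 n%:R) x| <= b x)%R.
  rewrite normrM (ger0_norm (b0 x)) ler_piMr//.
  by rewrite indicE normr_nat; case: (_ \in _).
have := Rintegral_dct mfn cb ib bnd.
rewrite [X in _ --> X](_ : _ = m'); last by rewrite /Rintegral bm.
move=> cv.
have : \forall n \near \oo, (t < \int[mu3 R]_x (b x * \1_(ball3 n%:R) x))%R.
  exact: (cvgr_gt _ cv).
move=> [N _ HN]; exists N.+1%:R => //.
have := HN N.+1 (leqnSn N) => /=.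
rewrite -lte_fin; congr (_ < _).
rewrite -integral_EFin.
  by apply: eq_integral => x _; rewrite EFinM.
apply: (le_integrable measurableT _ _ ib) => //.
  apply/measurable_EFinP; apply: measurable_funM => //; exact: measurable_indic_ball3.
by move=> x _; rewrite lee_fin (ger0_norm (b0 x)).
Unshelve. all: by end_near. Qed.

Section attraction.
Variables (K : nat) (alpha : 'I_K -> R) (r : 'I_K -> R3 R).
Hypothesis alpha0 : forall k, (0 < alpha k)%R.

Lemma attractionE (x : R3 R) :
  \int[mu3 R]_y ((V_TF alpha r y)%:E * B ((y : R3 R) - x)%R) =
  \sum_k (alpha k)%:E * pot B (r k - x)%R.
Proof.
have mBx : measurable_fun [set: E3 R] (fun y : E3 R => B ((y : R3 R) - x)%R).
  exact: (measurableT_comp mB (measurable_shift (- x)%R)).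
have mi k : measurable_fun [set: E3 R] (fun y : E3 R => inv3 ((y : R3 R) - r k)%R).
  exact: (measurableT_comp (@measurable_inv3 R) (measurable_shift (- r k)%R)).
have ak k : 0 <= (alpha k)%:E by rewrite lee_fin ltW.
transitivity (\int[mu3 R]_y \sum_k (alpha k)%:E * (inv3 ((y : R3 R) - r k)%R * B ((y : R3 R) - x)%R)).
  apply: eq_integral => y _; rewrite /V_TF -sumEFin ge0_sume_distrl.
    by apply: eq_bigr => k _; rewrite muleA -EFinM.
  by move=> k _; rewrite lee_fin mulr_ge0 ?newton_ge0// ltW.
rewrite ge0_integral_sum//; last 2 first.
- by move=> k; apply: measurable_funeM; exact: emeasurable_funM.
- by move=> k y _; rewrite mule_ge0// mule_ge0// inv3_ge0.
apply: eq_bigr => k _; rewrite ge0_integralZl//; last 2 first.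
- exact: emeasurable_funM.
- by move=> y _; rewrite mule_ge0// inv3_ge0.
congr (_ * _).
rewrite -(integral_shift x (f := fun y => inv3 ((y : R3 R) - r k)%R * B ((y : R3 R) - x)%R)).
  apply: eq_integral => y _; rewrite addrK muleC inv3_distC; congr (_ * inv3 _).
  by rewrite opprD addrA addrAC.
exact: emeasurable_funM.
Qed.

Lemma exists_shift_attraction : (0 < m')%R -> (m < \sum_k alpha k)%R ->
  exists x, interaction C A B x <
    \int[mu3 R]_y ((V_TF alpha r y)%:E * B ((y : R3 R) - x)%R).
Proof.
move=> m'1; set Z : R := (\sum_k alpha k)%R => mZ.
have Z0 : (0 < Z)%R := le_lt_trans m0 mZ.
set c := (m * m')%R; have c0 : (0 <= c)%R by rewrite mulr_ge0.
(* A mass strictly between m m' / Z and m': a ball already contains more than [t] of the mass of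
   [b], and Z t still exceeds m m'. The difference [gap] is the margin to be shared out. *)
pose t : R := ((c / Z + m') / 2)%R.
have cZ : (c / Z < m')%R by rewrite ltr_pdivrMr// /c mulrC ltr_pM2l.
have tm' : (t < m')%R by rewrite /t; lra.
have t0 : (0 < t)%R by rewrite /t divr_gt0// ltr_wpDl// divr_ge0// ltW.
pose gap : R := (Z * t - c)%R.
have gap0 : (0 < gap)%R.
  by rewrite subr_gt0 -ltr_pdivrMl// mulrC /t; lra.
have [r0 r00 It] := exists_radius tm'.
(* Bounds the distance from every nucleus to every point of the ball of radius [r0]. [L] is then
   taken so large that the factor [q] lost in [newton_avg_ge] at that distance costs at most half of
   [gap]. *)
pose om : R := (r0 + \sum_k enorm (r k))%R.
have om0 : (0 <= om)%R by rewrite addr_ge0 ?(ltW r00)// sumr_ge0// => k _; exact: enorm_ge0.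
pose L : R := (2 * c * om / gap + 1)%R.
have L0 : (0 < L)%R by rewrite ltr_wpDl// divr_ge0 ?mulr_ge0// ltW.
pose q : R := (1 + om / L)%R.
have q0 : (0 < q)%R by rewrite ltr_pwDl// divr_ge0// ltW.
have qc : (q * c <= c + gap / 2)%R.
  rewrite /q mulrDl mul1r lerD2l mulrAC ler_pdivrMr// /L mulrDr mulr1.
  have -> : (gap / 2 * (2 * c * om / gap) = om * c)%R by field; rewrite gt_eqF.
  by rewrite lerDl divr_ge0// ltW.
(* All the terms that do not depend on the radius; [S] is chosen so that the other half of [gap],
   multiplied by the growing [avg S], exceeds them. *)
pose Q : R := (C * c * q + Z * t * avg L)%R.
have Q0 : (0 <= Q)%R.
  have := ltW q0; have := ltW Z0; have := ltW t0 => ? ? ?.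
  by apply: addr_ge0; do 2 (apply: mulr_ge0 => //).
pose S : R := (27 * (2 / gap * (Q + 1)) + 1)%R.
have S1 : (1 <= S)%R.
  rewrite lerDr; apply: mulr_ge0 => //; apply: mulr_ge0; last by rewrite addr_ge0.
  by rewrite divr_ge0// ltW.
have S0 : (0 < S)%R by apply: lt_le_trans S1.
have aS : (Q + 1 <= gap / 2 * avg S)%R.
  have := newton_avg_large S0; rewrite avgE lee_fin => h.
  have hS : (S / 27 <= S ^+ 2 / 27)%R by rewrite ler_pM2r// ler_eXnr.
  have : (2 / gap * (Q + 1) <= avg S)%R.
    by apply: le_trans (le_trans hS h); rewrite ler_pdivlMr// /S; lra.
  by rewrite -ler_pdivlMl ?divr_gt0// invf_div.
(* The lower bound that [newton_avg_ge] gives for the integral of the kernel with pole at any point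
   of norm at most [om]. *)
pose d : R := ((avg S - avg L) / q)%R.
have main : (C * m * m' + m * m' * avg S < Z * (d * t))%R.
  rewrite -mulrA -/c /d.
  have -> : (Z * ((avg S - avg L) / q * t) = Z * t * (avg S - avg L) / q)%R by ring.
  rewrite ltr_pdivlMr//.
  have := ler_wpM2r (avg0 S) qc; have := aS; rewrite /Q /gap; lra.
have d0 : (0 <= d)%R.
  have h : (0 < Z * (d * t))%R.
    by apply: le_lt_trans main; rewrite addr_ge0// mulr_ge0// mulr_ge0.
  by move: h; rewrite pmulr_rgt0// pmulr_lgt0// => /ltW.
apply: (@exists_lt_of_ball S) => //.
- apply: measurable_diff_integral => //.
    apply/measurable_EFinP; apply: measurable_sum => k; apply: measurable_funM => //.
    exact: measurable_newton.
  move=> x; rewrite lee_fin; apply: sumr_ge0 => k _.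
  by rewrite mulr_ge0 ?newton_ge0// ltW.
- move=> x; apply: integral_ge0 => y _; apply: mule_ge0 => //.
  rewrite lee_fin; apply: sumr_ge0 => k _.
  by rewrite mulr_ge0 ?newton_ge0// ltW.
under eq_integral => x _.
  rewrite attractionE ge0_sume_distrr; last first.
    by move=> k _; rewrite mule_ge0 ?lee_fin ?(ltW (alpha0 k))// pot_ge0.
  under eq_bigr do rewrite muleCA.
  over.
have mp k : measurable_fun [set: E3 R] (fun x : E3 R => ind3 S x * pot B (r k - (x : R3 R))%R).
  apply: emeasurable_funM; first exact: measurable_ind3.
  exact: (measurableT_comp (measurable_pot mB B0) (measurable_rev (r k))).
have ip0 k x : 0 <= ind3 S x * pot B (r k - (x : R3 R))%R.
  by rewrite mule_ge0 ?ind3_ge0// pot_ge0.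
rewrite ge0_integral_sum//; last 2 first.
- by move=> k; exact: measurable_funeM.
- by move=> k x _; rewrite mule_ge0// lee_fin ltW.
apply: (@lt_le_trans _ _ (\sum_k ((alpha k)%:E * (d * t)%:E))).
  rewrite -ge0_sume_distrl; last by move=> k _; rewrite lee_fin ltW.
  by rewrite sumEFin -EFinM lte_fin.
apply: lee_sum => k _; rewrite ge0_integralZl//; last by rewrite lee_fin ltW.
apply: lee_wpmul2l; first by rewrite lee_fin ltW.
rewrite ball_integral_pot//.
apply: (@le_trans _ _ (\int[mu3 R]_z (d%:E * (B z * ind3 r0 z)))).
  rewrite ge0_integralZl//; last 2 first.
  - by apply: emeasurable_funM => //; exact: measurable_ind3.
  - by move=> z _; rewrite mule_ge0 ?ind3_ge0.
  by rewrite EFinM; apply: lee_wpmul2l; [rewrite lee_fin|exact: ltW].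
apply: ge0_le_integral => //.
- by move=> z _; apply: mule_ge0 => //; apply: mule_ge0 => //; exact: ind3_ge0.
- by apply: measurable_funeM; apply: emeasurable_funM => //; exact: measurable_ind3.
- by apply: emeasurable_funM => //; exact: measurable_newton_avg_rev.
move=> z _; rewrite muleCA; apply: lee_wpmul2l => //.
rewrite /ind3 indicE; case: (boolP (z \in _)) => [|_]; last by rewrite mule0 newton_avg_ge0.
rewrite inE mule1 /ball3/= => zr.
have rz : (enorm (r k - (z : R3 R)) <= om)%R.
  apply: (le_trans (enormD _ _)); rewrite enormN addrC; apply: lerD => //.
  rewrite (bigD1 k)//= lerDl sumr_ge0// => j _; exact: enorm_ge0.
have := newton_avg_ge S (r k - (z : R3 R))%R L0; rewrite !avgE.
have := newton_avg_le (r k - (z : R3 R))%R S0; have := newton_avg_ge0 S (r k - (z : R3 R))%R.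
rewrite avgE; case: (newton_avg S _) => [v||]//; rewrite -EFinM -EFinD !lee_fin => v0 _ h.
rewrite /d ler_pdivrMr// lerBlDl; apply: (le_trans h); rewrite lerD2l mulrC ler_wpM2l//.
by rewrite lerD2l ler_pM2r// invr_gt0.
Qed.

End attraction.

End choice_of_shift.

(** * Local terms and form-small potentials *)

Section local_terms.
Variable R : realType.
Implicit Types (t : R) (V : E3 R -> R).

(* Turns the fractional powers of the energy into integer ones. *)
Definition rad t : R := `|t| `^ (2 / 3).

Lemma rad_ge0 t : 0 <= rad t. Proof. exact: powR_ge0. Qed.

Lemma rad_pow t n : rad t ^+ n = `|t| `^ (2 / 3 * n%:R).
Proof. by rewrite -powR_mulrn ?powR_ge0// -powRrM. Qed.

Lemma rad3 t : rad t ^+ 3 = t ^+ 2.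
Proof.
rewrite rad_pow (_ : 2 / 3 * 3%:R = 2%:R); last by field.
by rewrite powR_mulrn// real_normK// num_real.
Qed.

Lemma rad4 t : rad t ^+ 4 = `|t| `^ (8 / 3).
Proof. by rewrite rad_pow; congr (_ `^ _); field. Qed.

Lemma rad5 t : rad t ^+ 5 = `|t| `^ (10 / 3).
Proof. by rewrite rad_pow; congr (_ `^ _); field. Qed.

Lemma measurable_rad (u : E3 R -> R) : measurable_fun setT u ->
  measurable_fun setT (rad \o u).
Proof.
move=> mu; have mpow : measurable_fun [set: R] (fun y : R => y `^ (2 / 3)).
  exact: measurable_powR.
exact: (measurableT_comp mpow (measurableT_comp (@normr_measurable R setT) mu)).
Qed.

Lemma rad4_le (c1 c2 z : R) : 0 < c1 -> 0 <= z ->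
  c2 * z ^+ 4 <= c1 / 4 * z ^+ 5 + c2 ^+ 2 / c1 * z ^+ 3.
Proof.
move=> c10 z0; rewrite -subr_ge0.
have -> : c1 / 4 * z ^+ 5 + c2 ^+ 2 / c1 * z ^+ 3 - c2 * z ^+ 4 =
   z ^+ 3 * (c1 * (z / 2 - c2 / c1) ^+ 2) by field; rewrite gt_eqF.
by rewrite mulr_ge0 ?exprn_ge0// mulr_ge0 ?sqr_ge0// ltW.
Qed.

(** Young's inequality with exponents 5/2 and 5/3, obtained crudely by comparing b with e z. In its
    application b is the square root of the kernel and z^3 = t^2. *)
Lemma young52 (e b z : R) : 0 < e -> 0 <= b -> 0 <= z ->
  b ^+ 2 * z ^+ 3 <= e ^+ 2 * z ^+ 5 + e ^- 3 * b ^+ 5.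
Proof.
move=> e0 b0 z0; have [h|h] := leP b (e * z).
  have h2 : b ^+ 2 <= (e * z) ^+ 2 by rewrite ler_pXn2r ?nnegrE// (le_trans b0).
  apply: (@le_trans _ _ ((e * z) ^+ 2 * z ^+ 3)).
    by rewrite ler_wpM2r// exprn_ge0.
  by rewrite exprMn -mulrA -exprD lerDl mulr_ge0 ?exprn_ge0// invr_ge0 exprn_ge0// ltW.
have h2 : z ^+ 3 <= (b / e) ^+ 3.
  rewrite ler_pXn2r ?nnegrE ?divr_ge0 ?(ltW e0)//.
  by rewrite ler_pdivlMr// mulrC ltW.
apply: (@le_trans _ _ (b ^+ 2 * (b / e) ^+ 3)).
  by rewrite ler_wpM2l// exprn_ge0.
rewrite (_ : b ^+ 2 * (b / e) ^+ 3 = e ^- 3 * b ^+ 5).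
  by rewrite lerDr mulr_ge0 ?exprn_ge0// ltW.
by field; rewrite gt_eqF.
Qed.

(** Here s^3 and p^3 are the two densities; say p <= s. The fifth powers leave an excess 3 c1 s^2
    p^3, which is not bounded by the product of the densities when s is small. Convexity of r^(4/3)
    gains 4/3 s p^3, of which p^4 <= s p^3 consumes one unit; the surplus c2 s p^3 / 3 compensates
    for small s. The constant is the one for which what remains is s p^3 times a perfect square. *)
Lemma cube_coupling (c1 c2 s p z : R) : 0 < c1 -> 0 < c2 ->
  0 <= s -> 0 <= p -> 0 <= z -> z ^+ 3 = s ^+ 3 + p ^+ 3 ->
  c1 * z ^+ 5 - c2 * z ^+ 4 <= (c1 * s ^+ 5 - c2 * s ^+ 4) + (c1 * p ^+ 5 - c2 * p ^+ 4) +
    27 * c1 ^+ 2 / (4 * c2) * (s ^+ 3 * p ^+ 3).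
Proof.
move=> c10 c20; wlog ps : s p / p <= s => [H|] s0 p0 z0 E.
  have [ps|/ltW sp] := leP p s; first exact: H.
  rewrite (addrC (c1 * s ^+ 5 - _)) (mulrC (s ^+ 3)); apply: H => //.
  by rewrite addrC.
have [s00|s00] := eqVneq s 0.
  have p00 : p = 0 by apply/eqP; rewrite eq_le p0 andbT -s00.
  have z00 : z = 0.
    by move: E; rewrite s00 p00 expr0n addr0 => /eqP; rewrite expf_eq0 => /andP[_ /eqP].
  by rewrite s00 p00 z00 !expr0n/= !mulr0 subrr !addr0.
have s1 : 0 < s by rewrite lt_def s00.
have p3 : 0 <= p ^+ 3 by rewrite exprn_ge0.
have sz : s <= z.
  by rewrite -(@ler_pXn2r _ 3)// E lerDl.
have z5 : z ^+ 5 <= s ^+ 5 + 3 * s ^+ 2 * p ^+ 3.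
  rewrite -(ler_pM2r s1); apply: (@le_trans _ _ (z ^+ 6)).
    by rewrite [leRHS]exprSr ler_wpM2l// exprn_ge0.
  have -> : z ^+ 6 = (s ^+ 3 + p ^+ 3) ^+ 2 by rewrite -E -exprM.
  have h : p ^+ 3 * p ^+ 3 <= s ^+ 3 * p ^+ 3 by rewrite ler_wpM2r// ler_pXn2r.
  have -> : (s ^+ 5 + 3 * s ^+ 2 * p ^+ 3) * s = s ^+ 6 + 3 * (s ^+ 3 * p ^+ 3) by ring.
  have -> : (s ^+ 3 + p ^+ 3) ^+ 2 = s ^+ 6 + 2 * (s ^+ 3 * p ^+ 3) + p ^+ 3 * p ^+ 3 by ring.
  by lra.
have p4 : p ^+ 4 <= s * p ^+ 3 by rewrite exprS ler_wpM2r.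
have z4 : s ^+ 4 + 4 / 3 * s * p ^+ 3 <= z ^+ 4.
  have -> : p ^+ 3 = z ^+ 3 - s ^+ 3 by rewrite E addrAC subrr add0r.
  rewrite -subr_ge0.
  have -> : z ^+ 4 - (s ^+ 4 + 4 / 3 * s * (z ^+ 3 - s ^+ 3)) =
     (z - s) ^+ 2 * (3 * z ^+ 2 + 2 * z * s + s ^+ 2) / 3 by field.
  by rewrite divr_ge0// mulr_ge0 ?sqr_ge0// !addr_ge0 ?sqr_ge0// !mulr_ge0// sqr_ge0.
have k1 : c1 * z ^+ 5 <= c1 * (s ^+ 5 + 3 * s ^+ 2 * p ^+ 3) by rewrite ler_pM2l.
have k2 : c2 * (s ^+ 4 + p ^+ 4 + s * p ^+ 3 / 3) <= c2 * z ^+ 4.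
  by rewrite ler_pM2l//; lra.
have c15 : 0 <= c1 * p ^+ 5 by rewrite mulr_ge0 ?exprn_ge0// ltW.
have k3 : 3 * c1 * s ^+ 2 * p ^+ 3 - c2 * (s * p ^+ 3) / 3 <=
    27 * c1 ^+ 2 / (4 * c2) * (s ^+ 3 * p ^+ 3).
  rewrite -subr_ge0.
  have -> : 27 * c1 ^+ 2 / (4 * c2) * (s ^+ 3 * p ^+ 3) -
     (3 * c1 * s ^+ 2 * p ^+ 3 - c2 * (s * p ^+ 3) / 3) =
     (s * p ^+ 3) * ((9 * c1 * s - 2 * c2) ^+ 2 / (12 * c2)) by field; rewrite gt_eqF.
  apply: mulr_ge0; first exact: mulr_ge0.
  by apply: divr_ge0; [exact: sqr_ge0|rewrite mulr_ge0// ltW].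
by lra.
Qed.

Lemma rad_hypot_coupling (c1 c2 a b : R) : 0 < c1 -> 0 < c2 ->
  c1 * rad (root 0 a b) ^+ 5 - c2 * rad (root 0 a b) ^+ 4 <=
  (c1 * rad a ^+ 5 - c2 * rad a ^+ 4) + (c1 * rad b ^+ 5 - c2 * rad b ^+ 4) +
    27 * c1 ^+ 2 / (4 * c2) * (a ^+ 2 * b ^+ 2).
Proof.
move=> c10 c20; rewrite -(rad3 a) -(rad3 b).
apply: cube_coupling; rewrite ?rad_ge0// !rad3.
by have := root_sqr 0 a b; rewrite expr0n add0r.
Qed.

(* Potentials that are form-small with respect to the local repulsion,
   pointwise up to an integrable function and a bounded multiple of u^2. *)
Definition small_potential V := [/\ measurable_fun setT V, forall x, 0 <= V x &
  forall e : R, 0 < e -> exists C : R, exists k : E3 R -> R,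
    [/\ 0 <= C, measurable_fun setT k, forall x, 0 <= k x,
        (\int[mu3 R]_x (k x)%:E < +oo)%E &
        forall x t, V x * t ^+ 2 <= e * rad t ^+ 5 + k x + C * t ^+ 2]].

Lemma small_potential_le V V' : measurable_fun setT V' ->
  (forall x, 0 <= V' x <= V x) -> small_potential V -> small_potential V'.
Proof.
move=> mV' V'V [_ _ HV]; split => // [x|e e0]; first by have /andP[] := V'V x.
have [C [k [C0 mk k0 ik H]]] := HV e e0; exists C, k; split => // x t.
apply: le_trans (H x t); rewrite ler_wpM2r ?sqr_ge0//.
by have /andP[] := V'V x.
Qed.

Lemma small_potential_cst (c : R) : 0 <= c -> small_potential (fun=> c).
Proof.
move=> c0; split => // e e0; exists c, (fun=> 0); split => // [|x t].
  by rewrite integral0 ltry.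
by rewrite addr0 lerDr mulr_ge0 ?exprn_ge0 ?rad_ge0// ltW.
Qed.

Lemma small_potentialD V V' : small_potential V -> small_potential V' ->
  small_potential (fun x => V x + V' x).
Proof.
move=> [mV V0 HV] [mV' V0' HV']; split.
- exact: measurable_funD.
- by move=> x; rewrite addr_ge0.
move=> e e0; have e2 : 0 < e / 2 by rewrite divr_gt0.
have [C [k [C0 mk k0 ik H]]] := HV _ e2; have [C' [k' [C0' mk' k0' ik' H']]] := HV' _ e2.
exists (C + C'), (fun x => k x + k' x); split => //.
- exact: addr_ge0.
- exact: measurable_funD.
- by move=> x; rewrite addr_ge0.
- under eq_integral do rewrite EFinD.
  rewrite ge0_integralD//; first exact: lte_add_pinfty.
  + by move=> x _; rewrite lee_fin.
  + exact/measurable_EFinP.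
  + by move=> x _; rewrite lee_fin.
  + exact/measurable_EFinP.
- by move=> x t; have := H x t; have := H' x t; rewrite !mulrDl; lra.
Qed.

Lemma small_potentialZ V (c : R) : 0 <= c -> small_potential V ->
  small_potential (fun x => c * V x).
Proof.
move=> c0 [mV V0 HV]; split.
- exact: measurable_funM.
- by move=> x; rewrite mulr_ge0.
move=> e e0; have e2 : 0 < e / (c + 1) by rewrite divr_gt0// ltr_wpDl.
have [C [k [C0 mk k0 ik H]]] := HV _ e2.
exists (c * C), (fun x => c * k x); split => //.
- exact: mulr_ge0.
- exact: measurable_funM.
- by move=> x; rewrite mulr_ge0.
- under eq_integral do rewrite EFinM.
  rewrite ge0_integralZl//; [|exact/measurable_EFinP|by move=> x _; rewrite lee_fin].
  exact: lte_mul_pinfty.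
- move=> x t; rewrite -mulrA; apply: (le_trans (ler_wpM2l c0 (H x t))).
  have h : c * (e / (c + 1)) <= e.
    by rewrite mulrA ler_pdivrMr ?ltr_wpDl// mulrC ler_pM2l// lerDl.
  have := ler_wpM2r (exprn_ge0 5 (rad_ge0 t)) h; lra.
Qed.

Lemma small_potential_sum (I : Type) (s : seq I) (F : I -> E3 R -> R) :
  (forall i, small_potential (F i)) -> small_potential (fun x => \sum_(i <- s) F i x).
Proof.
move=> HF; elim: s => [|i s IH].
  by under eq_fun do rewrite big_nil; exact: small_potential_cst.
by under eq_fun do rewrite big_cons; exact: small_potentialD.
Qed.

(** Inside the unit ball around the pole [young52] applies with weight sqrt e; outside it the kernel
    is at most 1, which is the origin of the constant C = 1. *)
Lemma small_potential_newton (a : R3 R) :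
  small_potential (fun x : E3 R => (enorm ((x : R3 R) - a))^-1).
Proof.
split.
- exact: measurable_newton.
- by move=> x; exact: newton_ge0.
move=> e e0; pose d := Num.sqrt e.
have d0 : 0 < d by rewrite sqrtr_gt0.
have dE : d ^+ 2 = e by rewrite sqr_sqrtr// ltW.
have d3 : 0 <= d ^- 3 by rewrite invr_ge0 exprn_ge0// ltW.
exists 1, (fun x : E3 R => d ^- 3 * newton52 ((x : R3 R) - a)); split => //.
- apply: measurable_funM => //.
  exact: (measurable_shift_comp (- a) (@measurable_newton52 R)).
- by move=> x; rewrite mulr_ge0// newton52_ge0.
- rewrite (integral_shift (- a) (f := fun x => (d ^- 3 * newton52 x)%:E)); last first.
    by apply/measurable_EFinP; apply: measurable_funM => //; exact: measurable_newton52.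
  under eq_integral do rewrite EFinM.
  rewrite ge0_integralZl//; last 2 first.
  + by apply/measurable_EFinP; exact: measurable_newton52.
  + by move=> x _; rewrite lee_fin newton52_ge0.
  by apply: lte_mul_pinfty => //; exact: newton52_lty.
move=> x t; set y := (x : R3 R) - a; have y0 := newton_ge0 y.
have [y1|y1] := leP (enorm y) 1.
  have -> : newton52 y = Num.sqrt (enorm y)^-1 ^+ 5.
    rewrite /newton52 indicE mem_set// mulr1 -{1}(sqr_sqrtr y0).
    rewrite -powR_mulrn ?sqrtr_ge0// -powRrM.
    rewrite (_ : 2%:R * (5 / 2) = 5%:R); last by field.
    by rewrite powR_mulrn// sqrtr_ge0.
  have := young52 d0 (sqrtr_ge0 (enorm y)^-1) (rad_ge0 t).
  rewrite sqr_sqrtr// rad3 dE => h; apply: (le_trans h).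
  by rewrite lerDl mul1r sqr_ge0.
apply: (@le_trans _ _ (1 * t ^+ 2)).
  by rewrite ler_wpM2r ?sqr_ge0// invf_le1 ?(ltW y1)// (lt_trans ltr01).
rewrite lerDr addr_ge0//; apply: mulr_ge0 => //; first exact: ltW.
- by rewrite exprn_ge0// rad_ge0.
- exact: newton52_ge0.
Qed.

Lemma small_potential_TF (K : nat) (alpha : 'I_K -> R) (r : 'I_K -> R3 R) :
  (forall k, 0 < alpha k) -> small_potential (V_TF alpha r).
Proof.
move=> a0; apply: small_potential_sum => k.
by apply: small_potentialZ; [exact: ltW|exact: small_potential_newton].
Qed.

Lemma small_potential_power (nu : R) : 0 < nu -> nu < 1 ->
  small_potential (fun x : E3 R => (enorm x `^ nu)^-1).
Proof.
move=> n0 n1; apply: (@small_potential_le (fun x : E3 R => 1 + (enorm ((x : R3 R) - 0))^-1)).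
- apply: measurable_inv_ge0; first by move=> x; exact: powR_ge0.
  have mpow : measurable_fun [set: R] (fun y : R => y `^ nu) by exact: measurable_powR.
  exact: (measurableT_comp mpow (@measurable_enorm R)).
- move=> x; rewrite subr0 invr_ge0 powR_ge0/=.
  have [->|x0] := eqVneq (enorm x) 0.
    by rewrite powR0 ?gt_eqF// invr0 addr0.
  have e0 : 0 < enorm x by rewrite lt_def x0 enorm_ge0.
  have [x1|x1] := leP (enorm x) 1.
    apply: (@le_trans _ _ (enorm x)^-1); last by rewrite lerDr.
    rewrite lef_pV2 ?posrE ?powR_gt0//.
    rewrite -[leLHS]powRr1 ?(ltW e0)//; apply: ger_powR; [by rewrite e0|exact: ltW].
  apply: (@le_trans _ _ 1); last by rewrite lerDl newton_ge0.
  rewrite invf_le1 ?powR_gt0// -[leLHS](powRr0 (enorm x)).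
  by apply: ler_powR; exact: ltW.
- apply: small_potentialD; last exact: small_potential_newton.
  exact: small_potential_cst.
Qed.

End local_terms.

(** * The energy *)

Section energy_bounds.
Variable R : realType.
Local Open Scope ereal_scope.
Implicit Types (u v : E3 R -> R) (V : E3 R -> R).

(** [F] need not be integrable. Its negative part lies below [h], so if one side is infinite both
    are +oo. This allows lower bounds on the energy before it is known to be finite. *)
Lemma integral_add_compensated (F h : E3 R -> R) : measurable_fun setT F ->
  (mu3 R).-integrable setT (EFin \o h) -> (forall x, 0 <= h x)%R ->
  (forall x, 0 <= F x + h x)%R ->
  \int[mu3 R]_x (F x + h x)%:E = \int[mu3 R]_x (F x)%:E + \int[mu3 R]_x (h x)%:E.
Proof.
move=> mF ih h0 S0.
have mh : measurable_fun setT h by apply/measurable_EFinP; case/integrableP: ih.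
have mS : measurable_fun setT (fun x => F x + h x)%R by exact: measurable_funD.
have hfin : \int[mu3 R]_x (h x)%:E \is a fin_num by exact: integrable_fin_num.
have [Sfin|Sinf] := ltP (\int[mu3 R]_x (F x + h x)%:E) +oo.
  have iS : (mu3 R).-integrable setT (EFin \o (fun x => F x + h x)%R).
    apply/integrableP; split; first exact/measurable_EFinP.
    by under eq_integral do rewrite /= ger0_norm//.
  have iF : (mu3 R).-integrable setT (EFin \o F).
    have := integrableB measurableT iS ih; congr integrable; apply/funext => x /=.
    by rewrite -EFinB addrK.
  rewrite -integralD//.
move: Sinf; rewrite leye_eq => /eqP Sinf; rewrite Sinf.
suff -> : \int[mu3 R]_x (F x)%:E = +oo by move: hfin; case: (\int[mu3 R]_x (h x)%:E).
have mFE : measurable_fun setT (EFin \o F) by exact/measurable_EFinP.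
have -> : \int[mu3 R]_x (F x)%:E =
    \int[mu3 R]_x (EFin \o F)^\+ x - \int[mu3 R]_x (EFin \o F)^\- x.
  exact: (integralE _ _ (EFin \o F)).
have neg : \int[mu3 R]_x (EFin \o F)^\- x <= \int[mu3 R]_x (h x)%:E.
  apply: ge0_le_integral => //; first exact: measurable_funeneg.
  - exact/measurable_EFinP.
  - move=> x _; rewrite funenegE ge_max lee_fin; apply/andP; split; last by rewrite lee_fin.
    by have := S0 x; lra.
have pos : \int[mu3 R]_x (EFin \o F)^\+ x = +oo.
  have : \int[mu3 R]_x (F x + h x)%:E <=
      \int[mu3 R]_x (EFin \o F)^\+ x + \int[mu3 R]_x (h x)%:E.
    rewrite -ge0_integralD//; last 3 first.
    - exact: measurable_funepos.
    - by move=> y _; rewrite lee_fin.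
    - exact/measurable_EFinP.
    apply: ge0_le_integral => //.
    - by move=> y _; rewrite lee_fin.
    - exact/measurable_EFinP.
    - by apply: emeasurable_funD; [exact: measurable_funepos|exact/measurable_EFinP].
    by move=> y _; rewrite EFinD leeD2r// funeposE le_max lexx.
  rewrite Sinf; have : 0 <= \int[mu3 R]_x (EFin \o F)^\+ x by exact: integral_ge0.
  move: hfin; case: (\int[mu3 R]_x (h x)%:E) => // r _.
  by case: (\int[mu3 R]_x (EFin \o F)^\+ x).
rewrite pos; have : 0 <= \int[mu3 R]_x (EFin \o F)^\- x by exact: integral_ge0.
move: neg hfin; case: (\int[mu3 R]_x (h x)%:E) => // r.
by case: (\int[mu3 R]_x (EFin \o F)^\- x).
Qed.

Definition repulsion u := \int[mu3 R]_x (rad (u x) ^+ 5)%:E.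
Definition sq u (x : E3 R) : \bar R := (u x ^+ 2)%:E.
Definition coulomb_energy u := \int[mu3 R]_x (sq u x * pot (sq u) x).

Lemma sq_ge0 u x : 0 <= sq u x. Proof. by rewrite lee_fin sqr_ge0. Qed.

Lemma measurable_sq u : measurable_fun setT u -> measurable_fun setT (sq u).
Proof. by move=> mu; apply/measurable_EFinP; exact: measurable_funX. Qed.

Lemma coulomb_energy_ge0 u : 0 <= coulomb_energy u.
Proof.
by apply: integral_ge0 => x _; apply: mule_ge0; [exact: sq_ge0|apply: pot_ge0 => z; exact: sq_ge0].
Qed.

Lemma repulsion_ge0 u : 0 <= repulsion u.
Proof. by apply: integral_ge0 => x _; rewrite lee_fin exprn_ge0 ?rad_ge0. Qed.

Definition loc (c1 c2 : R) V u (x : E3 R) : R :=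
  (c1 * rad (u x) ^+ 5 - c2 * rad (u x) ^+ 4 - V x * u x ^+ 2)%R.

Lemma energyE c1 c2 V u : measurable_fun setT u ->
  energy c1 c2 V u = \int[mu3 R]_x (gr2 u x + loc c1 c2 V u x)%:E + (2^-1)%:E * coulomb_energy u.
Proof.
move=> mu; rewrite /energy; congr (_ + _ * _).
  by apply: eq_integral => x _; rewrite /loc rad5 rad4 !addrA.
apply: eq_integral => x _; rewrite /pot -ge0_integralZl//.
- by apply: eq_integral => y _; rewrite /sq /inv3 -!EFinM mulrA.
- apply: emeasurable_funM; first exact: measurable_sq.
  exact: (measurableT_comp (@measurable_inv3 R) (measurable_rev x)).
- by move=> y _; apply: mule_ge0; [exact: sq_ge0|exact: inv3_ge0].
- exact: sq_ge0.
Qed.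

Lemma measurable_rad_pow u n : measurable_fun setT u ->
  measurable_fun setT (fun x => rad (u x) ^+ n)%R.
Proof. by move=> mu; apply: measurable_funX; exact: measurable_rad. Qed.

Lemma measurable_loc c1 c2 V u : measurable_fun setT V -> measurable_fun setT u ->
  measurable_fun setT (loc c1 c2 V u).
Proof.
move=> mV mu; apply: measurable_funB; first apply: measurable_funB.
- by apply: measurable_funM => //; exact: measurable_rad_pow.
- by apply: measurable_funM => //; exact: measurable_rad_pow.
- by apply: measurable_funM => //; exact: measurable_funX.
Qed.

Lemma integrable_ge0 (f : E3 R -> R) : measurable_fun setT f -> (forall x, 0 <= f x)%R ->
  \int[mu3 R]_x (f x)%:E < +oo -> (mu3 R).-integrable setT (EFin \o f).
Proof.
move=> mf f0 foo; apply/integrableP; split; first exact/measurable_EFinP.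
by under eq_integral do rewrite /= ger0_norm//.
Qed.

Lemma integrable_sqr u : L2 u -> (mu3 R).-integrable setT (EFin \o (fun x => u x ^+ 2)%R).
Proof.
by move=> L2u; exact: (integrable_L2M L2u L2u).
Qed.

(** One quarter of c1 |u|^(10/3) absorbs the c2 term, another quarter the potential; the remaining
    half is the bound. Gradient and Coulomb energy are dropped as nonnegative, and [h] restores the
    integrable errors. *)
Lemma energy_lower (c1 c2 m C : R) V (k : E3 R -> R) u :
  (0 < c1)%R -> (0 <= C)%R -> measurable_fun setT V -> measurable_fun setT k ->
  (forall x, 0 <= k x)%R -> \int[mu3 R]_x (k x)%:E < +oo ->
  (forall x t, V x * t ^+ 2 <= c1 / 4 * rad t ^+ 5 + k x + C * t ^+ 2)%R ->
  admissible m u ->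
  (c1 / 2)%:E * repulsion u <=
    energy c1 c2 V u + ((C + c2 ^+ 2 / c1) * m + fine (\int[mu3 R]_x (k x)%:E))%:E.
Proof.
move=> c10 C0 mV mk k0 ik HV [hu]; rewrite massE => um.
have Lu := hu.1; have mu := L2_measurable Lu.
set C' := (C + c2 ^+ 2 / c1)%R.
have C'0 : (0 <= C')%R by rewrite addr_ge0// divr_ge0 ?sqr_ge0// ltW.
pose h (x : E3 R) : R := (C' * u x ^+ 2 + k x)%R.
have h0 x : (0 <= h x)%R by rewrite addr_ge0// mulr_ge0// sqr_ge0.
have iku := integrable_ge0 mk k0 ik.
have i2 := integrableZl measurableT C' (integrable_sqr Lu).
have ih : (mu3 R).-integrable setT (EFin \o h) by exact: (integrableD measurableT i2 iku).
have hE : \int[mu3 R]_x (h x)%:E = (C' * m + fine (\int[mu3 R]_x (k x)%:E))%:E.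
  under eq_integral do rewrite EFinD EFinM.
  rewrite ge0_integralD//; last 4 first.
  - by move=> x _; rewrite mule_ge0 ?lee_fin// sqr_ge0.
  - by apply: measurable_funeM; exact: measurable_sq.
  - by move=> x _; rewrite lee_fin.
  - exact/measurable_EFinP.
  rewrite ge0_integralZl//; last 2 first.
  - exact: measurable_sq.
  - by move=> x _; exact: sq_ge0.
  rewrite [RHS]EFinD fineK; last by rewrite ge0_fin_numE//; apply: integral_ge0 => x _; rewrite lee_fin.
  by rewrite [in RHS]EFinM -um.
pose F x := (gr2 u x + loc c1 c2 V u x)%R.
have mF : measurable_fun setT F.
  by apply: measurable_funD; [exact: measurable_gr2|exact: measurable_loc].
have low x : (c1 / 2 * rad (u x) ^+ 5 <= F x + h x)%R.
  have := gr2_ge0 u x; have := HV x (u x).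
  have := rad4_le c2 c10 (rad_ge0 (u x)); rewrite rad3 /F /h /loc /C'.
  by lra.
have r0 x : (0 <= c1 / 2 * rad (u x) ^+ 5)%R.
  by rewrite mulr_ge0 ?exprn_ge0 ?rad_ge0// divr_ge0// ltW.
have S0 x : (0 <= F x + h x)%R by exact: le_trans (low x).
have key : (c1 / 2)%:E * repulsion u <= \int[mu3 R]_x (F x)%:E + \int[mu3 R]_x (h x)%:E.
  rewrite -integral_add_compensated// /repulsion -ge0_integralZl//; last 3 first.
  - by apply/measurable_EFinP; exact: measurable_rad_pow.
  - by move=> x _; rewrite lee_fin exprn_ge0 ?rad_ge0.
  - by rewrite lee_fin divr_ge0// ltW.
  apply: ge0_le_integral => //.
  - by move=> x _; rewrite -EFinM lee_fin.
  - by apply: measurable_funeM; apply/measurable_EFinP; exact: measurable_rad_pow.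
  - by apply/measurable_EFinP; apply: measurable_funD => //; apply/measurable_EFinP; case/integrableP: ih.
  - by move=> x _; rewrite -EFinM lee_fin.
rewrite energyE// -hE; apply: (le_trans key).
have d0 : 0 <= (2^-1)%:E * coulomb_energy u by rewrite mule_ge0 ?coulomb_energy_ge0// lee_fin.
by apply: leeD2r; rewrite leeDl.
Qed.

(** Sobolev's inequality would give the second condition from the first; here it is deduced from
    finiteness of the energy instead, in [energy_lty]. *)
Definition fin_energy u := H1 u /\ repulsion u < +oo.

Lemma fin_rad5 u : fin_energy u -> (mu3 R).-integrable setT (EFin \o (fun x => rad (u x) ^+ 5)%R).
Proof.
move=> [hu Pfin]; apply: integrable_ge0 => //.
  by apply: measurable_rad_pow; exact: L2_measurable hu.1.
by move=> x; rewrite exprn_ge0 ?rad_ge0.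
Qed.

Lemma fin_rad4 u : fin_energy u -> (mu3 R).-integrable setT (EFin \o (fun x => rad (u x) ^+ 4)%R).
Proof.
move=> fu; have i5 := fin_rad5 fu; have i2 := integrable_sqr fu.1.1.
have mu := L2_measurable fu.1.1.
apply: (le_integrable measurableT _ _ (integrableD measurableT i5 i2)).
  by apply/measurable_EFinP; exact: measurable_rad_pow.
move=> x _ /=; rewrite lee_fin.
have h4 : (0 <= rad (u x) ^+ 4)%R by rewrite exprn_ge0 ?rad_ge0.
have h5 : (0 <= rad (u x) ^+ 5)%R by rewrite exprn_ge0 ?rad_ge0.
have h2 := sqr_ge0 (u x).
rewrite !ger0_norm ?addr_ge0//.
have := rad4_le (c1 := 4) 2 (ltr0n _ 4) (rad_ge0 (u x)); rewrite rad3; lra.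
Qed.

Lemma fin_V V u : small_potential V -> fin_energy u ->
  (mu3 R).-integrable setT (EFin \o (fun x => V x * u x ^+ 2)%R).
Proof.
move=> [mV V0 HV] fu; have i5 := fin_rad5 fu; have i2 := integrable_sqr fu.1.1.
have mu := L2_measurable fu.1.1.
have [C [k [C0 mk k0 ik H]]] := HV 1%R ltr01.
have := integrableD measurableT (integrableD measurableT i5 (integrable_ge0 mk k0 ik))
  (integrableZl measurableT C i2).
apply: le_integrable => //.
  by apply/measurable_EFinP; apply: measurable_funM => //; exact: measurable_funX.
move=> x _ /=; have := H x (u x); rewrite mul1r => h.
have v0 : (0 <= V x * u x ^+ 2)%R by rewrite mulr_ge0 ?sqr_ge0.
rewrite lee_fin (ger0_norm v0) ger0_norm//.
exact: le_trans h.
Qed.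

Lemma fin_loc c1 c2 V u : small_potential V -> fin_energy u ->
  (mu3 R).-integrable setT (EFin \o loc c1 c2 V u).
Proof.
move=> sV fu.
exact: (integrableB measurableT (integrableB measurableT
  (integrableZl measurableT c1 (fin_rad5 fu)) (integrableZl measurableT c2 (fin_rad4 fu)))
  (fin_V sV fu)).
Qed.

Lemma fin_gr2 u : H1 u -> (mu3 R).-integrable setT (EFin \o gr2 u).
Proof.
move=> hu; apply: integrable_ge0; [exact: measurable_gr2|exact: gr2_ge0|exact: gr2_lty].
Qed.

Definition gradient_energy u : R := (\int[mu3 R]_x gr2 u x)%R.
Definition local_energy c1 c2 V u : R := (\int[mu3 R]_x loc c1 c2 V u x)%R.

Lemma energy_finE c1 c2 V u : small_potential V -> fin_energy u ->
  energy c1 c2 V u = (gradient_energy u + local_energy c1 c2 V u)%:E + (2^-1)%:E * coulomb_energy u.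
Proof.
move=> sV fu; rewrite energyE; last exact: L2_measurable fu.1.1.
have ig := fin_gr2 fu.1; have il := fin_loc c1 c2 sV fu.
rewrite EFinD -!integral_EFin// -integralD//.
Qed.

Lemma energy_lty c1 c2 V u : (0 < c1)%R -> small_potential V -> H1 u ->
  energy c1 c2 V u < +oo -> fin_energy u /\ coulomb_energy u < +oo.
Proof.
move=> c10 sV hu efin.
have c14 : (0 < c1 / 4)%R by rewrite divr_gt0.
have fu : fin_energy u.
  split => //; have [mV V0 /(_ _ c14)[C [k [C0 mk k0 ik H]]]] := sV.
  have ma : admissible (nr u) u by split => //; rewrite massE nrE//; exact: hu.1.
  have := energy_lower c2 c10 C0 mV mk k0 ik H ma.
  have := repulsion_ge0 u; case: (repulsion u) => // [r _ _|_]; first exact: ltry.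
  rewrite gt0_muley ?lte_fin ?divr_gt0//.
  by move: efin; case: (energy _ _ _ _).
split => //; move: efin; rewrite energy_finE//; have := coulomb_energy_ge0 u.
case: (coulomb_energy u) => [r _ _|_|//]; first exact: ltry.
by rewrite gt0_muley ?lte_fin ?invr_gt0.
Qed.

End energy_bounds.

(** * Superposition *)

Section superposition.
Variable R : realType.
Local Open Scope ereal_scope.
Implicit Types (u v : E3 R -> R) (V : E3 R -> R) (a b : E3 R -> \bar R).

Lemma pot_sym a b : measurable_fun setT a -> measurable_fun setT b ->
  (forall x, 0 <= a x) -> (forall x, 0 <= b x) ->
  \int[mu3 R]_x (a x * pot b x) = \int[mu3 R]_x (b x * pot a x).
Proof.
move=> ma mb a0 b0.
pose F (p : E3 R * E3 R) := a p.1 * (b p.2 * inv3 ((p.2 : R3 R) - p.1)%R).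
have mF : measurable_fun setT F.
  apply: emeasurable_funM; first exact: (measurableT_comp ma (@measurable_fst _ _ (E3 R) (E3 R))).
  apply: emeasurable_funM; first exact: (measurableT_comp mb (@measurable_snd _ _ (E3 R) (E3 R))).
  exact: (measurable_sub3_comp (@measurable_inv3 R)).
have F0 p : 0 <= F p by apply: mule_ge0 => //; apply: mule_ge0 => //; exact: inv3_ge0.
have mi (c : E3 R -> \bar R) (x : E3 R) : measurable_fun setT c ->
    measurable_fun [set: E3 R] (fun y : E3 R => c y * inv3 ((x : R3 R) - y)%R).
  move=> mc; apply: emeasurable_funM => //.
  exact: (measurableT_comp (@measurable_inv3 R) (measurable_rev x)).
have cpot (c : E3 R -> \bar R) (k : \bar R) (x : E3 R) : measurable_fun setT c ->
    (forall y, 0 <= c y) -> 0 <= k ->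
    k * pot c x = \int[mu3 R]_y (k * (c y * inv3 ((x : R3 R) - y)%R)).
  move=> mc c0 k0; rewrite (ge0_integralZl (mu3 R) measurableT (mi c x mc) _ k0)//.
  by move=> y _; apply: mule_ge0; [exact: c0|exact: inv3_ge0].
transitivity (\int[mu3 R]_x \int[mu3 R]_y F (x, y)).
  apply: eq_integral => x _; rewrite (cpot _ _ _ mb b0 (a0 x)).
  by apply: eq_integral => y _; rewrite /F/= inv3_distC.
rewrite (fubini_tonelli (m1 := mu3 R) (m2 := mu3 R) F mF F0).
apply: eq_integral => y _; rewrite (cpot _ _ _ ma a0 (b0 y)).
by apply: eq_integral => x _; rewrite /F/= muleCA.
Qed.

Lemma pot_shift b (x : R3 R) (y : E3 R) : measurable_fun setT b ->
  pot (fun z => b ((z : R3 R) - x)%R) y = pot b ((y : R3 R) - x)%R.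
Proof.
move=> mb; rewrite /pot.
rewrite -(integral_shift x (f := fun z => b ((z : R3 R) - x)%R * inv3 ((y : R3 R) - z)%R)).
  by apply: eq_integral => z _; rewrite addrK opprD addrA addrAC.
apply: emeasurable_funM; first exact: (measurableT_comp mb (measurable_shift (- x)%R)).
exact: (measurableT_comp (@measurable_inv3 R) (measurable_rev y)).
Qed.

Lemma potD a b y : measurable_fun setT a -> measurable_fun setT b ->
  (forall x, 0 <= a x) -> (forall x, 0 <= b x) ->
  pot (fun z => a z + b z) y = pot a y + pot b y.
Proof.
move=> ma mb a0 b0; rewrite /pot.
have mi c : measurable_fun setT c ->
    measurable_fun [set: E3 R] (fun z : E3 R => c z * inv3 ((y : R3 R) - z)%R).
  move=> mc; apply: emeasurable_funM => //.
  exact: (measurableT_comp (@measurable_inv3 R) (measurable_rev y)).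
under eq_integral do rewrite ge0_muleDl//.
rewrite ge0_integralD//.
- by move=> z _; apply: mule_ge0 => //; exact: inv3_ge0.
- exact: mi.
- by move=> z _; apply: mule_ge0 => //; exact: inv3_ge0.
- exact: mi.
Qed.

(** [r'] and the translate of [r] are kept distinct because the chosen weak gradient of a translate
    is the translate of the chosen gradient only almost everywhere. *)
Lemma Rintegral_le_shift (p q r r' : E3 R -> R) (x : R3 R) :
  (forall y, 0 <= p y)%R -> (forall y, 0 <= q y)%R -> (forall y, 0 <= r y)%R ->
  (forall y, 0 <= r' y)%R ->
  (mu3 R).-integrable setT (EFin \o p) -> (mu3 R).-integrable setT (EFin \o q) ->
  (mu3 R).-integrable setT (EFin \o r) -> (mu3 R).-integrable setT (EFin \o r') ->
  {ae mu3 R, forall y, r' y = r ((y : R3 R) - x)%R} ->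
  {ae mu3 R, forall y, (p y <= q y + r' y)%R} ->
  (\int[mu3 R]_y p y <= \int[mu3 R]_y q y + \int[mu3 R]_y r y)%R.
Proof.
move=> p0 q0 r0 r'0 ip iq ir ir' er ple.
have M f : (mu3 R).-integrable setT (EFin \o f) -> measurable_fun setT (EFin \o f).
  by case/integrableP.
suff : (\int[mu3 R]_y p y)%:E <= (\int[mu3 R]_y q y)%:E + (\int[mu3 R]_y r y)%:E by [].
rewrite -!integral_EFin//.
have -> : \int[mu3 R]_y (r y)%:E = \int[mu3 R]_y (r' y)%:E.
  rewrite -(integral_shift (- x)%R (M _ ir)); apply: ge0_ae_eq_integral => //.
  - exact: (measurableT_comp (M _ ir) (measurable_shift (- x)%R)).
  - exact: M.
  - by move=> y _; rewrite lee_fin.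
  - by move=> y _; rewrite lee_fin.
  by apply: (@filterS _ _ (ae_filter_ringOfSetsType (mu3 R))) er => y /= -> _.
rewrite -ge0_integralD//; last 4 first.
- by move=> y _; rewrite lee_fin.
- exact: M.
- by move=> y _; rewrite lee_fin.
- exact: M.
apply: ae_ge0_le_integral => //.
- by move=> y _; rewrite lee_fin.
- exact: M.
- by move=> y _; rewrite adde_ge0 ?lee_fin.
- by apply: emeasurable_funD; exact: M.
by apply: (@filterS _ _ (ae_filter_ringOfSetsType (mu3 R))) ple => y h _; rewrite -EFinD lee_fin.
Qed.

Lemma mule_sum_ge0 (s t p q : \bar R) : 0 <= s -> 0 <= t -> 0 <= p -> 0 <= q ->
  (s + t) * (p + q) = (s * p + s * q) + (t * p + t * q).
Proof. by move=> s0 t0 p0 q0; rewrite ge0_muleDl// !ge0_muleDr. Qed.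

Lemma adde_double_mid (p q r : \bar R) : (p + q) + (q + r) = p + r + 2%:E * q.
Proof. by rewrite mule_natl mule2n -!addeA; congr (_ + _); rewrite (addeA q q r) addeC. Qed.

Lemma self_energyD a b (x : R3 R) : measurable_fun setT a -> measurable_fun setT b ->
  (forall y, 0 <= a y) -> (forall y, 0 <= b y) ->
  \int[mu3 R]_y ((a y + b ((y : R3 R) - x)%R) * pot (fun z => a z + b ((z : R3 R) - x)%R) y) =
  \int[mu3 R]_y (a y * pot a y) + \int[mu3 R]_y (b y * pot b y) +
  2%:E * \int[mu3 R]_y (a y * pot b ((y : R3 R) - x)%R).
Proof.
move=> ma mb a0 b0; pose c (y : E3 R) := b ((y : R3 R) - x)%R.
have mc : measurable_fun setT c by exact: (measurableT_comp mb (measurable_shift (- x)%R)).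
have c0 y : 0 <= c y by exact: b0.
have mm (f g : E3 R -> \bar R) : measurable_fun setT f -> measurable_fun setT g ->
    (forall y, 0 <= g y) -> measurable_fun setT (fun y => f y * pot g y).
  by move=> mf mg g0; exact: (emeasurable_funM mf (measurable_pot mg g0)).
have m0 (f g : E3 R -> \bar R) : (forall y, 0 <= f y) -> (forall y, 0 <= g y) ->
    forall y, 0 <= f y * pot g y.
  by move=> f0 g0 y; apply: mule_ge0; [exact: f0|exact: pot_ge0].
have e1 : \int[mu3 R]_y (a y * pot c y) = \int[mu3 R]_y (a y * pot b ((y : R3 R) - x)%R).
  by apply: eq_integral => y _; rewrite (pot_shift x y mb).
have e2 : \int[mu3 R]_y (c y * pot c y) = \int[mu3 R]_y (b y * pot b y).
  rewrite -(integral_shift (- x)%R (mm b b mb mb b0)).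
  by apply: eq_integral => y _; rewrite (pot_shift x y mb).
have e3 := pot_sym mc ma c0 a0.
have D (f g : E3 R -> \bar R) : measurable_fun setT f -> measurable_fun setT g ->
    (forall y, 0 <= f y) -> (forall y, 0 <= g y) ->
    \int[mu3 R]_y (f y + g y) = \int[mu3 R]_y f y + \int[mu3 R]_y g y.
  by move=> mf mg f0 g0; rewrite (ge0_integralD (mu3 R) measurableT (fun y _ => f0 y) mf (fun y _ => g0 y) mg).
transitivity (\int[mu3 R]_y ((a y * pot a y + a y * pot c y) +
    (c y * pot a y + c y * pot c y))).
  apply: eq_integral => y _; rewrite (potD y ma mc a0 c0) -/(c y).
  exact: (mule_sum_ge0 (a0 y) (c0 y) (pot_ge0 y a0) (pot_ge0 y c0)).
rewrite (D _ _ (emeasurable_funD (mm _ _ ma ma a0) (mm _ _ ma mc c0))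
  (emeasurable_funD (mm _ _ mc ma a0) (mm _ _ mc mc c0))
  (fun y => adde_ge0 (m0 _ _ a0 a0 y) (m0 _ _ a0 c0 y))
  (fun y => adde_ge0 (m0 _ _ c0 a0 y) (m0 _ _ c0 c0 y))).
rewrite (D _ _ (mm _ _ ma ma a0) (mm _ _ ma mc c0) (m0 _ _ a0 a0) (m0 _ _ a0 c0)).
rewrite (D _ _ (mm _ _ mc ma a0) (mm _ _ mc mc c0) (m0 _ _ c0 a0) (m0 _ _ c0 c0)).
rewrite [X in _ + (X + _) = _]e3 [X in _ + X + _ = _]e1 [X in _ + (X + _) = _]e1.
rewrite [X in _ + (_ + X) = _]e2.
exact: adde_double_mid.
Qed.

Section two_functions.
Variables (u v : E3 R -> R) (x : R3 R).
Hypotheses (fu : fin_energy u) (fv : fin_energy v).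

Let vt : E3 R -> R := fun y => v ((y : R3 R) - x)%R.
Let w : E3 R -> R := fun y => root 0 (u y) (vt y).

Let mu : measurable_fun setT u. Proof. exact: L2_measurable fu.1.1. Qed.
Let mv : measurable_fun setT v. Proof. exact: L2_measurable fv.1.1. Qed.
Let mvt : measurable_fun setT vt. Proof. exact: (measurable_shift_comp (- x)%R mv). Qed.

Lemma sq_hypot y : sq w y = sq u y + sq vt y.
Proof. by rewrite /sq root_sqr expr0n add0r EFinD. Qed.

Lemma mass_hypot m m' : mass u = m%:E -> mass v = m'%:E -> mass w = (m + m')%:E.
Proof.
rewrite !massE /nsq => um vm.
have -> : \int[mu3 R]_y (w y ^+ 2)%:E = \int[mu3 R]_y (sq u y + sq vt y).
  by apply: eq_integral => y _; exact: sq_hypot.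
rewrite ge0_integralD//; last 4 first.
- by move=> y _; exact: sq_ge0.
- exact: measurable_sq.
- by move=> y _; exact: sq_ge0.
- exact: measurable_sq.
rewrite EFinD -um -vm; congr (_ + _).
exact: (integral_shift (- x)%R (measurable_sq mv)).
Qed.

Lemma fin_energy_shift : fin_energy vt.
Proof.
split; first by have [] := H1_shift x fv.1.
have mP : measurable_fun setT (fun y => (rad (v y) ^+ 5)%:E).
  by apply/measurable_EFinP; exact: measurable_rad_pow.
have e : repulsion vt = repulsion v by exact: (integral_shift (- x)%R mP).
rewrite e; exact: fv.2.
Qed.

Let hw : H1 w. Proof. by have [] := H1_hypot fu.1 fin_energy_shift.1. Qed.

Lemma fin_energy_hypot : fin_energy w.
Proof.
split => //; have fvt := fin_energy_shift.
have iP := integrableD measurableT (fin_rad5 fu) (fin_rad5 fvt).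
have mw : measurable_fun setT w := L2_measurable hw.1.
have : (mu3 R).-integrable setT (EFin \o (fun y => rad (w y) ^+ 5)%R).
  (* If a is the larger of s and p, then z^3 <= 2 a^3 <= (2 a)^3, so z^5 <= 2^5 a^5. *)
  apply: (le_integrable measurableT _ _ (integrableZl measurableT 32%R iP)).
    by apply/measurable_EFinP; exact: measurable_rad_pow.
  move=> y _ /=; rewrite lee_fin.
  have s0 := rad_ge0 (u y); have p0 := rad_ge0 (vt y); have z0 := rad_ge0 (w y).
  rewrite !ger0_norm ?mulr_ge0 ?addr_ge0 ?exprn_ge0//.
  have E : (rad (w y) ^+ 3 = rad (u y) ^+ 3 + rad (vt y) ^+ 3)%R.
    by rewrite !rad3 root_sqr expr0n add0r.
  move: s0 p0 z0 E; move: (rad (u y)) (rad (vt y)) (rad (w y)) => s p z s0 p0 z0 E.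
  have h (a : R) : (0 <= a)%R -> (s <= a)%R -> (p <= a)%R -> (z ^+ 5 <= 32 * a ^+ 5)%R.
    move=> a0 sa pa; have za : (z <= 2 * a)%R.
      rewrite -(@ler_pXn2r _ 3)// ?nnegrE ?mulr_ge0// E exprMn.
      have h1 : (s ^+ 3 <= a ^+ 3)%R by rewrite ler_pXn2r.
      have h2 : (p ^+ 3 <= a ^+ 3)%R by rewrite ler_pXn2r.
      have h3 : (0 <= a ^+ 3)%R by rewrite exprn_ge0.
      have e8 : ((2 : R) ^+ 3 = 8)%R by rewrite -natrX.
      by rewrite e8; lra.
    have -> : (32 * a ^+ 5 = (2 * a) ^+ 5)%R by rewrite exprMn -natrX.
    by rewrite ler_pXn2r// nnegrE mulr_ge0.
  have s5 : (0 <= s ^+ 5)%R by rewrite exprn_ge0.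
  have p5 : (0 <= p ^+ 5)%R by rewrite exprn_ge0.
  have [sp|/ltW ps] := leP s p.
    by have := h p p0 sp (lexx _); lra.
  by have := h s s0 (lexx _) ps; lra.
move=> /integrableP[_]; apply: le_lt_trans; apply: ge0_le_integral => //.
- by move=> y _; rewrite lee_fin exprn_ge0 ?rad_ge0.
- by apply/measurable_EFinP; exact: measurable_rad_pow.
- apply: measurableT_comp => //; apply/measurable_EFinP; exact: measurable_rad_pow.
- by move=> y _ /=; rewrite lee_fin ler_norm.
Qed.

Lemma gradient_energy_hypot : (gradient_energy w <= gradient_energy u + gradient_energy v)%R.
Proof.
have [_ eg] := H1_shift x fv.1; have [_ le_g] := H1_hypot fu.1 fin_energy_shift.1.
exact: (Rintegral_le_shift (@gr2_ge0 R w) (@gr2_ge0 R u) (@gr2_ge0 R v) (@gr2_ge0 R vt)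
  (fin_gr2 hw) (fin_gr2 fu.1) (fin_gr2 fv.1) (fin_gr2 fin_energy_shift.1) eg le_g).
Qed.

Lemma coulomb_energy_hypot : coulomb_energy w = coulomb_energy u + coulomb_energy v + 2%:E * \int[mu3 R]_y (sq u y * pot (sq v) ((y : R3 R) - x)%R).
Proof.
have e : sq w = (fun y => sq u y + sq v ((y : R3 R) - x)%R) by apply/funext => y; exact: sq_hypot.
rewrite {1}/coulomb_energy e.
exact: (self_energyD x (measurable_sq mu) (measurable_sq mv) (@sq_ge0 R u) (@sq_ge0 R v)).
Qed.

End two_functions.

End superposition.

(** * The energy of a superposition *)

Section superposition_energy.
Variable R : realType.
Local Open Scope ereal_scope.
Implicit Types (u v : E3 R -> R) (V : E3 R -> R).

Lemma Rintegral_superpose (f f1 f2 f3 f4 : E3 R -> R) (K : R) (x : R3 R) :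
  (mu3 R).-integrable setT (EFin \o f) -> (mu3 R).-integrable setT (EFin \o f1) ->
  (mu3 R).-integrable setT (EFin \o f2) -> (mu3 R).-integrable setT (EFin \o f3) ->
  (mu3 R).-integrable setT (EFin \o f4) ->
  (forall y, f y + f4 y <= f1 y + f2 ((y : R3 R) - x) + K * f3 y)%R ->
  (\int[mu3 R]_y f y + \int[mu3 R]_y f4 y <=
   \int[mu3 R]_y f1 y + \int[mu3 R]_y f2 y + K * \int[mu3 R]_y f3 y)%R.
Proof.
move=> i0 i1 i2 i3 i4 h.
have m2 : measurable_fun setT f2 by apply/measurable_EFinP; case/integrableP: i2.
have i2' : (mu3 R).-integrable setT (EFin \o (fun y => f2 ((y : R3 R) - x)%R)).
  have /integrableP[_ b2] := i2; apply/integrableP; split.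
    by apply/measurable_EFinP; exact: (measurable_shift_comp (- x)%R m2).
  have m2' : measurable_fun setT (abse \o (EFin \o f2)).
    by apply: measurableT_comp => //; exact/measurable_EFinP.
  by have := integral_shift (- x)%R m2' => /= ->.
have iK := integrableZl measurableT K i3.
have i12 := integrableD measurableT i1 i2'.
have -> : (\int[mu3 R]_y f2 y = \int[mu3 R]_y f2 ((y : R3 R) - x))%R.
  by rewrite (Rintegral_shift (- x)%R m2).
have -> : (K * \int[mu3 R]_y f3 y = \int[mu3 R]_y (K * f3 y))%R by rewrite RintegralZl.
rewrite -(RintegralD measurableT i0 i4).
rewrite -(RintegralD measurableT i1 i2') -(RintegralD measurableT i12 iK).
apply: le_Rintegral => //.
- exact: (integrableD measurableT i0 i4).
- exact: (integrableD measurableT i12 iK).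
Qed.

Lemma coupling_potential (q A B C k a2 b2 w2 : R) :
  (A <= B + C + k * (a2 * b2) -> w2 = a2 + b2 ->
   A - q * w2 + q * b2 <= (B - q * a2) + (C - 0 * b2) + k * (a2 * b2))%R.
Proof. by move=> h ->; rewrite mul0r mulrDr; lra. Qed.

Variables (c1 c2 : R).
Hypotheses (c1_gt0 : (0 < c1)%R) (c2_gt0 : (0 < c2)%R).

Definition coupling : R := (27 * c1 ^+ 2 / (4 * c2))%R.

Lemma coupling_gt0 : (0 < coupling)%R.
Proof. by rewrite divr_gt0 ?mulr_gt0 ?exprn_gt0. Qed.

(** Gradients, local terms and Coulomb terms are compared one by one. The potential of [w] acts on
    both densities although [v] carries none on the right; this extra attraction is added on the
    left, so that nothing is subtracted in the extended reals. *)
Lemma superpose V u v (x : R3 R) : small_potential V -> fin_energy u -> fin_energy v ->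
  coulomb_energy u < +oo -> coulomb_energy v < +oo -> interaction coupling (sq u) (sq v) x < +oo ->
  energy c1 c2 V (fun y => root 0 (u y) (v ((y : R3 R) - x)%R)) +
    \int[mu3 R]_y ((V y)%:E * sq v ((y : R3 R) - x)%R) <=
  energy c1 c2 V u + energy c1 c2 (fun=> 0%R) v + interaction coupling (sq u) (sq v) x.
Proof.
move=> sV fu fv Du_fin Dv_fin I_fin.
have s0 : small_potential (fun _ : E3 R => 0%R) by exact: small_potential_cst.
have fw := fin_energy_hypot x fu fv; have fvt := fin_energy_shift x fv.
have mu := L2_measurable fu.1.1; have mvt := L2_measurable fvt.1.1.
set vt := fun y : E3 R => v ((y : R3 R) - x)%R in fw fvt mvt *.
set w := fun y : E3 R => root 0 (u y) (vt y) in fw *.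
have K0 := coupling_gt0.
pose a : \bar R := \int[mu3 R]_y (u y ^+ 2 * vt y ^+ 2)%:E.
pose b : \bar R := \int[mu3 R]_y (sq u y * pot (sq v) ((y : R3 R) - x)%R).
have a0 : 0 <= a by apply: integral_ge0 => y _; rewrite lee_fin mulr_ge0 ?sqr_ge0.
have b0 : 0 <= b.
  apply: integral_ge0 => y _; apply: mule_ge0; first exact: sq_ge0.
  by apply: pot_ge0 => z; exact: sq_ge0.
have IE : interaction coupling (sq u) (sq v) x = coupling%:E * a + b.
  by [].
rewrite IE in I_fin *.
have [a' aE] : exists a' : R, a = a'%:E.
  move: I_fin a0 b0; case: (a) => [r| |//]; first by exists r.
  by rewrite gt0_muley ?lte_fin//; case: (b).
have [b' bE] : exists b' : R, b = b'%:E.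
  move: I_fin a0 b0; rewrite aE; case: (b) => [r| |//]; first by exists r.
  by [].
have ia : (mu3 R).-integrable setT (EFin \o (fun y => u y ^+ 2 * vt y ^+ 2)%R).
  apply: integrable_ge0.
  - by apply: measurable_funM; exact: measurable_funX.
  - by move=> y; rewrite mulr_ge0 ?sqr_ge0.
  - by rewrite -/a aE ltry.
have iV := fin_V sV fvt.
have EV : \int[mu3 R]_y ((V y)%:E * sq v ((y : R3 R) - x)%R) =
    (\int[mu3 R]_y (V y * vt y ^+ 2)%R)%:E.
  by rewrite -(integral_EFin iV).
rewrite EV (energy_finE c1 c2 sV fw) (energy_finE c1 c2 sV fu) (energy_finE c1 c2 s0 fv).
have DE := coulomb_energy_hypot x fu fv; rewrite -/vt -/w -/b in DE.
have [du duE] : exists d : R, coulomb_energy u = d%:E.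
  by move: (coulomb_energy_ge0 u) Du_fin; case: (coulomb_energy u) => // r _ _; exists r.
have [dv dvE] : exists d : R, coulomb_energy v = d%:E.
  by move: (coulomb_energy_ge0 v) Dv_fin; case: (coulomb_energy v) => // r _ _; exists r.
rewrite DE duE dvE aE bE.
have aR : (\int[mu3 R]_y (u y ^+ 2 * vt y ^+ 2))%R = a'.
  by apply: EFin_inj; rewrite -(integral_EFin ia).
have G := gradient_energy_hypot x fu fv; rewrite -/vt -/w in G.
have L := @Rintegral_superpose (loc c1 c2 V w) (loc c1 c2 V u) (loc c1 c2 (fun=> 0%R) v)
  (fun y => u y ^+ 2 * vt y ^+ 2)%R (fun y => V y * vt y ^+ 2)%R coupling x
  (fin_loc c1 c2 sV fw) (fin_loc c1 c2 sV fu) (fin_loc c1 c2 s0 fv) ia iV.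
have {}L : (local_energy c1 c2 V w + \int[mu3 R]_y (V y * vt y ^+ 2) <=
    local_energy c1 c2 V u + local_energy c1 c2 (fun=> 0) v + coupling * a')%R.
  rewrite -aR; apply: L => y.
  have := rad_hypot_coupling (u y) (vt y) c1_gt0 c2_gt0.
  have wE : (w y ^+ 2 = u y ^+ 2 + vt y ^+ 2)%R by rewrite root_sqr expr0n add0r.
  by move=> h; exact: (coupling_potential (V y) h wE).
move: L G; move: (local_energy c1 c2 V w) (local_energy c1 c2 V u) (local_energy c1 c2 _ v) (gradient_energy w) (gradient_energy u) (gradient_energy v)
  (\int[mu3 R]_y (V y * vt y ^+ 2))%R => lw lu lv gw gu gv I4 L G.
have : (gw + lw + 2^-1 * (du + dv + 2 * b') + I4 <=
  gu + lu + 2^-1 * du + (gv + lv + 2^-1 * dv) + (coupling * a' + b'))%R by lra.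
exact.
Qed.

End superposition_energy.

(** * Trial functions of finite energy *)

Section states.
Variable R : realType.
Variables (c1 c2 : R).
Hypotheses (c1_gt0 : 0 < c1) (c2_gt0 : 0 < c2).
Implicit Types (u v : E3 R -> R) (V : E3 R -> R).

Let V0 : E3 R -> R := fun=> 0.

(** Bundles what one superposition requires and its result provides again, so that the operation can
    be iterated; finite mass and energy are kept as real numbers. *)
Definition state V (m e : R) u := [/\ fin_energy u, (coulomb_energy u < +oo)%E, mass u = m%:E &
  energy c1 c2 V u = e%:E].

Lemma state_of_energy V m u : small_potential V -> admissible m u ->
  (energy c1 c2 V u < +oo)%E -> exists e, state V m e u.
Proof.
move=> sV [hu um] efin; have [fu dfin] := energy_lty c1_gt0 sV hu efin.
have [d dE] : exists d : R, coulomb_energy u = d%:E.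
  by move: (coulomb_energy_ge0 u) dfin; case: (coulomb_energy u) => // r _ _; exists r.
exists (gradient_energy u + local_energy c1 c2 V u + 2^-1 * d); split => //.
by rewrite (energy_finE c1 c2 sV fu) dE.
Qed.

Lemma state_superpose V m e u m' e' v (x : R3 R) (d : R) :
  small_potential V -> state V m e u -> state V0 m' e' v ->
  (interaction (coupling c1 c2) (sq u) (sq v) x <
   \int[mu3 R]_y ((V y)%:E * sq v ((y : R3 R) - x)%R) + d%:E)%E ->
  exists w e'', state V (m + m') e'' w /\ e'' < e + e' + d.
Proof.
move=> sV [fu du mu eu] [fv dv mv ev] h.
pose w : E3 R -> R := fun y : E3 R => root 0 (u y) (v ((y : R3 R) - x)).
have iV := fin_V sV (fin_energy_shift x fv).
have EV : (\int[mu3 R]_y ((V y)%:E * sq v ((y : R3 R) - x)%R) =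
    (\int[mu3 R]_y (V y * v ((y : R3 R) - x) ^+ 2)%R)%:E)%E.
  by rewrite -(integral_EFin iV).
move: h; rewrite EV; set q := Rintegral _ _ _ => h.
have I_fin : (interaction (coupling c1 c2) (sq u) (sq v) x < +oo)%E.
  by apply: lt_trans h _; rewrite -EFinD ltry.
have := superpose c1_gt0 c2_gt0 sV fu fv du dv I_fin.
rewrite EV -/q -/w eu -/V0 ev => hs.
have [i iE] : exists i : R, interaction (coupling c1 c2) (sq u) (sq v) x = i%:E.
  have : (0 <= interaction (coupling c1 c2) (sq u) (sq v) x)%E.
    apply: (interaction_ge0 (ltW (coupling_gt0 c1_gt0 c2_gt0))).
    - by move=> y; exact: sqr_ge0.
    - by move=> y; exact: sqr_ge0.
  by move: I_fin; case: (interaction _ _ _ _) => // r _ _; exists r.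
rewrite iE in h hs.
have wM : admissible (m + m') w.
  split; first by have [] := fin_energy_hypot x fu fv.
  exact: (mass_hypot x fu fv mu mv).
have wfin : (energy c1 c2 V w < +oo)%E.
  by move: hs; case: (energy c1 c2 V w) => [r _|//|//]; exact: ltry.
have [e'' sw] := state_of_energy sV wM wfin.
exists w, e''; split => //.
have [_ _ _ ew] := sw; move: hs; rewrite ew => hs.
have {}hs : e'' + q <= e + e' + i by exact: hs.
have {}h : i < q + d by exact: h.
by lra.
Qed.

Lemma state_density V m e u : state V m e u ->
  [/\ measurable_fun setT (fun x => u x ^+ 2), (forall x, 0 <= u x ^+ 2) &
      (\int[mu3 R]_x (u x ^+ 2)%:E = m%:E)%E].
Proof.
move=> [fu _ mu _]; split.
- by apply: measurable_funX; exact: L2_measurable fu.1.1.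
- by move=> x; exact: sqr_ge0.
- by rewrite -mu massE.
Qed.

(** The attraction by [V] is nonnegative and dropped: the tolerance [d] alone pays for the
    interaction, whatever the masses. *)
Lemma state_add V m e u m' e' v (d : R) : 0 < d ->
  small_potential V -> state V m e u -> state V0 m' e' v ->
  exists w e'', state V (m + m') e'' w /\ e'' < e + e' + d.
Proof.
move=> d0 sV su sv.
have [ma a0 am] := state_density su; have [mb b0 bm] := state_density sv.
have [x hx] := exists_shift_small (ltW (coupling_gt0 c1_gt0 c2_gt0)) ma mb a0 b0 am bm d0.
apply: (state_superpose (x := x) sV su sv); apply: (lt_le_trans hx).
rewrite leeDr//; apply: integral_ge0 => y _; apply: mule_ge0; last exact: sq_ge0.
by have [_ V_ge0 _] := sV; rewrite lee_fin.
Qed.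

Lemma state_add_attraction (K : nat) (alpha : 'I_K -> R) (r : 'I_K -> R3 R) m e u m' e' v :
  (forall k, 0 < alpha k) -> 0 < m' -> m < \sum_k alpha k ->
  state (V_TF alpha r) m e u -> state V0 m' e' v ->
  exists w e'', state (V_TF alpha r) (m + m') e'' w /\ e'' < e + e'.
Proof.
move=> al0 m'0 mZ su sv; have sV := small_potential_TF r al0.
have [ma a0 am] := state_density su; have [mb b0 bm] := state_density sv.
have [x hx] := exists_shift_attraction (ltW (coupling_gt0 c1_gt0 c2_gt0)) ma mb a0 b0 am bm
  r al0 m'0 mZ.
have [w [e'' [sw lt]]] : exists w e'', state (V_TF alpha r) (m + m') e'' w /\ e'' < e + e' + 0.
  by apply: (state_superpose (x := x) sV su sv); rewrite adde0.
by exists w, e''; rewrite addr0 in lt.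
Qed.

Lemma state_add_seq (T : Type) (s : seq T) (mm ee : T -> R) (vv : T -> E3 R -> R)
  V m e u (d : R) : 0 < d -> small_potential V -> state V m e u ->
  (forall i, state V0 (mm i) (ee i) (vv i)) ->
  exists w e'', state V (m + \sum_(i <- s) mm i) e'' w /\
    e'' < e + \sum_(i <- s) ee i + d.
Proof.
move=> d0 sV su sv; elim: s m e u d d0 su => [|i s IH] m e u d d0 su.
  by exists u, e; rewrite !big_nil !addr0 ltrDl.
(* Half of the tolerance goes to this superposition, the other half to all the later ones. *)
have d2 : 0 < d / 2 by rewrite divr_gt0.
have [w [e1 [sw lt1]]] := state_add d2 sV su (sv i).
have [w' [e2 [sw' lt2]]] := IH _ _ _ _ d2 sw.
exists w', e2; rewrite !big_cons addrA; split => //; lra.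
Qed.

Lemma inf_energy_gtNy V m : small_potential V -> (-oo < inf_energy c1 c2 V m)%E.
Proof.
move=> sV; have c14 : 0 < c1 / 4 by rewrite divr_gt0.
have [mV _ /(_ _ c14)[C [k [C0 mk k0 ik H]]]] := sV.
set A := (C + c2 ^+ 2 / c1) * m + fine (\int[mu3 R]_x (k x)%:E)%E.
apply: (@lt_le_trans _ _ (- A)%:E); first exact: ltNyr.
apply: le_ereal_inf_tmp => _ [u au <-].
have := energy_lower c2 c1_gt0 C0 mV mk k0 ik H au; rewrite -/A.
have P0 : (0 <= (c1 / 2)%:E * repulsion u)%E.
  apply: mule_ge0; last exact: repulsion_ge0.
  by rewrite lee_fin; apply: divr_ge0 => //; exact: ltW.
move=> /(le_trans P0); case: (energy c1 c2 V u) => [r h|_|//]; last by rewrite leey.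
have {}h : 0 <= r + A by exact: h.
by rewrite lee_fin; lra.
Qed.

Lemma inf_energy_le V m u : admissible m u -> (inf_energy c1 c2 V m <= energy c1 c2 V u)%E.
Proof. by move=> au; apply: ereal_inf_lbound; exists u. Qed.

Lemma energy_mono V V' u : small_potential V -> small_potential V' ->
  (forall x, V x <= V' x) -> H1 u -> (energy c1 c2 V' u <= energy c1 c2 V u)%E.
Proof.
move=> sV sV' VV' hu.
have [efin|] := ltP (energy c1 c2 V u) +oo%E; last by rewrite leye_eq => /eqP->; rewrite leey.
have [fu dfin] := energy_lty c1_gt0 sV hu efin.
rewrite (energy_finE c1 c2 sV fu) (energy_finE c1 c2 sV' fu).
apply: leeD2r; rewrite lee_fin lerD2l; apply: le_Rintegral => //.
- exact: fin_loc sV' fu.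
- exact: fin_loc sV fu.
by move=> x _; rewrite /loc lerD2l lerN2 ler_wpM2r// sqr_ge0.
Qed.

Lemma energy_add_potential V W u : small_potential V -> small_potential W ->
  fin_energy u ->
  energy c1 c2 V u = (energy c1 c2 (fun x => V x + W x)%R u +
    (\int[mu3 R]_x (W x * u x ^+ 2)%R)%:E)%E.
Proof.
move=> sV sW fu; have sVW := small_potentialD sV sW.
rewrite (energy_finE c1 c2 sV fu) (energy_finE c1 c2 sVW fu) addeAC; congr (_ + _)%E.
rewrite -EFinD; congr EFin; rewrite -addrA; congr (_ + _).
rewrite -(RintegralD measurableT (fin_loc c1 c2 sVW fu) (fin_V sW fu)).
by apply: eq_Rintegral => x _; rewrite /loc mulrDl; ring.
Qed.

End states.

(** * Minimizing sequences and splitting *)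

Section perturbation.
Variable R : realType.
Variables (c1 c2 : R).
Hypotheses (c1_gt0 : 0 < c1) (c2_gt0 : 0 < c2).

Lemma infinite_inf_energy (V : E3 R -> R) (M : R) w :
  inf_energy c1 c2 V M = +oo%E -> admissible M w -> energy c1 c2 V w = +oo%E.
Proof.
by move=> I_oo aw; apply/eqP; rewrite -leye_eq -I_oo; exact: inf_energy_le.
Qed.

Lemma perturbed_minimizing (V W : E3 R -> R) (Z : nat -> R) (M : R) (u : nat -> E3 R -> R) :
  small_potential V -> small_potential W -> (forall n, 0 <= Z n) ->
  Z n @[n --> \oo] --> 0 ->
  (forall n, minimizer c1 c2 (fun x => V x + Z n * W x) M (u n)) ->
  minimizing_sequence c1 c2 V M u.
Proof.
move=> sV sW Z0 cZ um; have au n : admissible M (u n) by have [] := um n.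
split => //; set I0 := inf_energy c1 c2 V M.
have [I_oo|] := eqVneq I0 +oo%E.
  rewrite I_oo (_ : (fun n => energy c1 c2 V (u n)) = fun=> +oo%E).
    exact: cvg_cst.
  by apply/funext => n; exact: infinite_inf_energy I_oo (au n).
rewrite -ltey => I_fin.
have [_ [w aw <-] wfin] := ereal_inf_lt I_fin.
have sn n : small_potential (fun x => V x + Z n * W x).
  by apply: small_potentialD => //; exact: small_potentialZ.
(* The single potential V + B W dominates all the perturbed ones, so one choice of [C] and [k]
   bounds the repulsion uniformly in n. *)
have [B [B0 ZB]] : exists B : R, 0 <= B /\ forall n, Z n <= B.
  have Zc : cvgn Z by apply/cvg_ex; exists 0.
  have [B1 [_ HB]] := cvg_seq_bounded Zc.
  have lt : B1 < `|B1| + 1 by rewrite (le_lt_trans (ler_norm _))// ltrDl.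
  exists (`|B1| + 1); split; first by rewrite addr_ge0.
  by move=> n; apply: (le_trans (ler_norm _)); exact: (HB _ lt n I).
have sB : small_potential (fun x => V x + B * W x).
  by apply: small_potentialD => //; exact: small_potentialZ.
have [mV V0 _] := sV; have [mW W0 HW] := sW.
have c14 : 0 < c1 / 4 by rewrite divr_gt0.
have [_ _ /(_ _ c14)[C [k [C0 mk k0 ik H]]]] := sB.
have mono n w' : H1 w' ->
    (energy c1 c2 (fun x => V x + Z n * W x)%R w' <= energy c1 c2 V w')%E.
  by move=> h; apply: energy_mono => // x; rewrite lerDl mulr_ge0.
have minn n w' : admissible M w' ->
    (energy c1 c2 (fun x => V x + Z n * W x)%R (u n) <= energy c1 c2 V w')%E.
  move=> aw'; have [_ ->] := um n.
  by apply: (le_trans (inf_energy_le _ _ _ aw')); apply: mono; exact: aw'.1.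
have fu n : fin_energy (u n).
  have := le_lt_trans (minn n w aw) wfin.
  by move=> /(energy_lty c1_gt0 (sn n) (au n).1)[].
pose A := (C + c2 ^+ 2 / c1) * M + fine (\int[mu3 R]_x (k x)%:E)%E.
have [e [_ _ _ ew]] := state_of_energy c1_gt0 sV aw wfin.
(* The energy [e] of one fixed admissible function bounds the perturbed energies of all the [u n],
   and [energy_lower] turns this into a bound on the repulsion. *)
pose P := 2 / c1 * (e + A).
have repulsion_le n : (repulsion (u n) <= P%:E)%E.
  have mn : measurable_fun setT (fun x => V x + Z n * W x).
    by apply: measurable_funD => //; exact: measurable_funM.
  have Hn x t : (V x + Z n * W x) * t ^+ 2 <= c1 / 4 * rad t ^+ 5 + k x + C * t ^+ 2.
    apply: le_trans (H x t); apply: ler_wpM2r; first exact: sqr_ge0.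
    by rewrite lerD2l ler_wpM2r.
  have h1 := energy_lower c2 c1_gt0 C0 mn mk k0 ik Hn (au n).
  have h2 := minn n w aw; rewrite ew in h2; rewrite -/A in h1.
  have := le_trans h1 (leeD2r A%:E h2); have := (fu n).2; have := repulsion_ge0 (u n).
  case: (repulsion (u n)) => // p _ _ h; rewrite lee_fin.
  have {}h : c1 / 2 * p <= e + A by exact: h.
  by rewrite /P mulrC -ler_pdivrMr ?divr_gt0// invf_div mulrC.
have [C' [k' [C'0 mk' k'0 ik' H']]] := HW 1 ltr01.
(* The smallness of [W] is used with parameter 1: the repulsion, the integrable part and the mass
   each contribute one term. *)
pose D := P + fine (\int[mu3 R]_x (k' x)%:E)%E + C' * M.
have WD n : \int[mu3 R]_x (W x * u n x ^+ 2) <= D.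
  have Lun := (au n).1.1.
  have i5 := fin_rad5 (fu n); have i2 := integrable_sqr Lun.
  have iC := integrableZl measurableT C' i2.
  have ik2 := integrable_ge0 mk' k'0 ik'.
  have i5k := integrableD measurableT i5 ik2.
  have E5 : \int[mu3 R]_x (rad (u n x) ^+ 5) <= P.
    have : ((\int[mu3 R]_x (rad (u n x) ^+ 5))%R%:E <= P%:E)%E by rewrite -(integral_EFin i5); exact: repulsion_le.
    by [].
  have E2 : \int[mu3 R]_x (u n x ^+ 2) = M.
    by apply: EFin_inj; rewrite -(integral_EFin i2); have := (au n).2; rewrite massE.
  apply: (@le_trans _ _ (\int[mu3 R]_x (rad (u n x) ^+ 5 + k' x + C' * u n x ^+ 2))).
    apply: le_Rintegral => //.
    - exact: fin_V sW (fu n).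
    - exact: (integrableD measurableT i5k iC).
    by move=> x _; have := H' x (u n x); rewrite mul1r.
  rewrite (RintegralD measurableT i5k iC) (RintegralD measurableT i5 ik2).
  rewrite (_ : \int[mu3 R]_x (C' * u n x ^+ 2) = C' * M); last by rewrite RintegralZl// E2.
  by rewrite /D !lerD2r.
have upper n w' : admissible M w' ->
    (energy c1 c2 V (u n) <= energy c1 c2 V w' + (Z n * D)%:E)%E.
  move=> aw'; have sZ := small_potentialZ (Z0 n) sW.
  rewrite (energy_add_potential c1 c2 sV sZ (fu n)).
  apply: leeD; first exact: minn.
  rewrite lee_fin; apply: le_trans (ler_wpM2l (Z0 n) (WD n)).
  rewrite -RintegralZl//; last exact: fin_V sW (fu n).
  by under eq_Rintegral do rewrite -mulrA.
have I_gt := inf_energy_gtNy c2 c1_gt0 M sV.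
have [i iE] : exists i : R, I0 = i%:E.
  by move: I_fin I_gt; rewrite -/I0; case: I0 => // r _ _; exists r.
have lo n : (I0 <= energy c1 c2 V (u n))%E by exact: inf_energy_le.
(* The error does not depend on the competitor, so it can be moved aside before taking the infimum
   over all competitors. *)
have up n : (energy c1 c2 V (u n) <= I0 + (Z n * D)%:E)%E.
  rewrite -leeBlDr//; apply: le_ereal_inf_tmp => _ [w' aw' <-].
  by rewrite leeBlDr//; exact: upper.
apply: (@squeeze_cvge _ _ _ _ (fun=> I0) _ (fun n => I0 + (Z n * D)%:E)%E).
- by apply: nearW => n; rewrite lo up.
- exact: cvg_cst.
rewrite iE; under eq_fun do rewrite -EFinD.
apply: cvg_EFin; first by apply: nearW.
rewrite /comp/= -[X in _ --> X]addr0; apply: cvgD; first exact: cvg_cst.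
by rewrite -[X in _ --> X](mul0r D); apply: cvgM => //; exact: cvg_cst.
Qed.

End perturbation.

Section splitting.
Variable R : realType.
Variables (c1 c2 : R).
Hypotheses (c1_gt0 : 0 < c1) (c2_gt0 : 0 < c2).

Lemma splitting_mass (K : nat) (alpha : 'I_K -> R) (r : 'I_K -> R3 R) (M : R)
    (N : nat) (m : 'I_N.+1 -> R) (v : 'I_N.+1 -> E3 R -> R) :
  (forall k, 0 < alpha k) ->
  let V := V_TF alpha r in
  let Vi (i : 'I_N.+1) : R3 R -> R := if i == ord0 then V else fun=> 0 in
  (forall i, 0 < m i) -> (forall i, minimizer c1 c2 (Vi i) (m i) (v i)) ->
  \sum_i m i = M ->
  (\sum_i inf_energy c1 c2 (Vi i) (m i) = inf_energy c1 c2 V M)%E ->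
  (inf_energy c1 c2 V M < +oo)%E ->
  (1 <= N)%N -> \sum_k alpha k <= m ord0.
Proof.
move=> al0 V; case: N m v => [|N] m v Vi m0 vmin mM IM I_fin // _.
rewrite leNgt; apply/negP => mZ.
have sV : small_potential V by exact: small_potential_TF.
have sVi i : small_potential (Vi i).
  by rewrite /Vi; case: ifP => _ //; exact: small_potential_cst.
(* An infinite term would make the whole sum +oo, since none of the other infima is -oo. *)
have vfin i : (inf_energy c1 c2 (Vi i) (m i) < +oo)%E.
  rewrite ltey; apply/negP => /eqP Ii; move: I_fin; rewrite -IM.
  rewrite (bigD1 i)//= Ii addye ?ltxx//.
  apply: (big_ind (fun x : \bar R => x != -oo%E)) => // [|j _].
    by case=> [a| |] // [b| |].
  by rewrite gt_eqF// inf_energy_gtNy.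
have [e He] : exists e : 'I_N.+2 -> R, forall i, state c1 c2 (Vi i) (m i) (e i) (v i).
  have h i : exists e, state c1 c2 (Vi i) (m i) e (v i).
    by have [ai Ei] := vmin i; apply: state_of_energy => //; rewrite Ei.
  by exists (fun i => projT1 (cid (h i))) => i; exact: projT2 (cid (h i)).
have eI i : inf_energy c1 c2 (Vi i) (m i) = (e i)%:E.
  by have [_ <-] := vmin i; have [] := He i.
have eM : inf_energy c1 c2 V M = (\sum_i e i)%:E.
  by rewrite -IM -sumEFin; apply: eq_bigr => i _; exact: eI.
have S0 : state c1 c2 V (m ord0) (e ord0) (v ord0) by have := He ord0; rewrite /Vi eqxx.
have Sl i : state c1 c2 (fun=> 0) (m (lift ord0 i)) (e (lift ord0 i)) (v (lift ord0 i)).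
  by have := He (lift ord0 i); rewrite /Vi.
have [w [e1 [Sw lt1]]] := state_add_attraction c1_gt0 c2_gt0 al0 (m0 (lift ord0 ord0)) mZ S0 (Sl ord0).
(* The energy strictly gained by superposing the components of index 0 and 1 is the entire tolerance
   for adding the remaining ones; the total then stays strictly below the sum of the energies. *)
pose d := e ord0 + e (lift ord0 ord0) - e1.
have d0 : 0 < d by rewrite subr_gt0.
have [w' [e2 [Sw' lt2]]] := state_add_seq c1_gt0 c2_gt0 (index_enum 'I_N) d0 sV Sw
  (fun i => Sl (lift ord0 i)).
have [fw' _ mw' ew'] := Sw'.
have : (inf_energy c1 c2 V M <= energy c1 c2 V w')%E.
  apply: inf_energy_le; split; first exact: fw'.1.
  by rewrite mw' -mM !big_ord_recl addrA.
rewrite ew' eM lee_fin leNgt => /negP; apply.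
by rewrite !big_ord_recl; move: lt2; rewrite /d; lra.
Qed.

End splitting.

Theorem propositionI3 (R : realType) (c1 c2 : R) (c1_gt0 : 0 < c1)
    (c2_gt0 : 0 < c2)
    (K : nat) (K_gt0 : (0 < K)%N)
    (alpha : 'I_K -> R) (alpha_gt0 : forall k, 0 < alpha k)
    (r : 'I_K -> R3 R)
    (nu : R) (nu_gt0 : 0 < nu) (nu_lt1 : nu < 1)
    (Z : nat -> R) (Z_gt0 : forall n, 0 < Z n)
    (Z_cvg0 : Z n @[n --> \oo] --> (0 : R))
    (M : R) (M_gt0 : 0 < M) (u : nat -> R3 R -> R)
    (u_min : forall n,
      minimizer c1 c2 (fun x => V_TF alpha r x + Z n / enorm x `^ nu) M (u n)) :
  minimizing_sequence c1 c2 (V_TF alpha r) M u /\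
  (attained_masses c1 c2 (V_TF alpha r) M \/
   forall (N : nat) (m : 'I_N.+1 -> R) (t : 'I_N.+1 -> nat -> R3 R)
     (v : 'I_N.+1 -> R3 R -> R),
     concentration_data c1 c2 (V_TF alpha r) M u m t v ->
     (1 <= N)%N /\ \sum_k alpha k <= m ord0).
Proof.
split.
  exact: (perturbed_minimizing c1_gt0 (small_potential_TF r alpha_gt0)
    (small_potential_power nu_gt0 nu_lt1) (fun n => ltW (Z_gt0 n)) Z_cvg0 u_min).
have [att|natt] := pselect (exists w, minimizer c1 c2 (V_TF alpha r) M w).
  by left.
right=> N m t v [m0 _ vmin [mM IM] _].
have N1 : (1 <= N)%N.
  (* With a single component the mass identity reads m 0 = M, so [v ord0] is a minimizer for the
     whole mass. *)
  case: N m t v m0 vmin mM IM => // m t v _ vmin mM _; exfalso; apply: natt.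
  exists (v ord0); have := vmin ord0; rewrite eqxx.
  by move: mM; rewrite big_ord_recl big_ord0 addr0 => ->.
split => //; apply: (splitting_mass c1_gt0 c2_gt0 alpha_gt0 m0 vmin mM IM _ N1).
(* An infinite infimum would be attained by any admissible function, and [u 0] is one. *)
rewrite ltey; apply/negP => /eqP I_oo; apply: natt; exists (u 0%N).
have a0 := (u_min 0%N).1; split => //.
by rewrite I_oo; exact: (infinite_inf_energy I_oo a0).
Qed.
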